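(* Let $I$ be a countable non-empty set, $i_0\in I$, and let $\mathcal{M}$ be a nuclear and $1$-normal $I\times I$-matrix over $\widehat{A}$. For each $r\in\mathbb{Z}$, the $\sigma$-similarity classes (over $A\widehat{\otimes}_RB$) of $\mathcal{B}^r(\mathcal{M})$ and $\mathcal{B}^r_{-}(\mathcal{M})$ depend only on the $\sigma$-similarity class (over $\widehat{A}$) of $\mathcal{M}$. That is: if $\mathcal{M}'$ is another nuclear $1$-normal $I\times I$-matrix over $\widehat{A}$ which is $\sigma$-similar to $\mathcal{M}$ over $\widehat{A}$ (and $\nu$, hence $B$, is admissible for both), then $\mathcal{B}^r(\mathcal{M}')$ is $\sigma$-similar to $\mathcal{B}^r(\mathcal{M})$ and $\mathcal{B}^r_{-}(\mathcal{M}')$ is $\sigma$-similar to $\mathcal{B}^r_{-}(\mathcal{M})$ over $A\widehat{\otimes}_RB$.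
   Context: Setting. $K/\mathbb{Q}_p$ is finite with ring of integers $R$, uniformizer $\pi$, residue field $k=\mathbb{F}_q$, absolute ramification index $e$; $\mathrm{ord}_p(p)=1$, $\mathrm{ord}_\pi(\pi)=1$; for $x$ in an $R$-module $E$ with $\pi E\neq E$, $\mathrm{ord}_\pi(x)=\sup\{n/m : n\in\mathbb{N}_0, m\in\mathbb{N}, x^m\in\pi^nE\}$, similarly $\mathrm{ord}_p$. For positive integers $m,c$ let $[m,c]=\{\sum_{j\ge0}\pi^jp_j : p_j\in R[X_1,\dots,X_n],\ \deg p_j\le m+cj\}$ and $R[X]^{\dagger}=\bigcup_{m,c}[m,c]$. $X=\mathrm{Spec}(\overline{A})$ is a smooth affine connected $k$-scheme, $\overline{A}=A/\pi A$ with $A=R[X]^{\dagger}/(g_1,\dots,g_r)$, $g_j\in R[X_1,\dots,X_n]-\pi R[X_1,\dots,X_n]$, $A$ flat over $R$; $\widehat{A}$ is its $\pi$-adic completion; $\sigma$ is an $R$-algebra endomorphism of $A$ (extended to $\widehat{A}$, and to $A\widehat{\otimes}_RB=\widehat{A}\widehat{\otimes}_RB$ as $\sigma\otimes1$) lifting the $q$-th power Frobenius of $\overline{A}$. It is assumed that $A$ is a finite free $\sigma(A)$-module of rank $q^{\dim X}$ and that the module of $p$-adically separated differentials $\Omega^1_{A/R}$ is free over $A$. Matrices. An $I\times I$-matrix $(a_{i_1,i_2})$ is nuclear if for each $M>0$ there are only finitely many $i_2$ with $\inf_{i_1}\mathrm{ord}_\pi(a_{i_1,i_2})<M$. For $\mathcal{A}=\widehat{A}$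 or $A\widehat{\otimes}_RB$, an $I_1\times I_1$-matrix $\mathcal{M}_1$ and an $I_2\times I_2$-matrix $\mathcal{M}_2$ over $\mathcal{A}$ are $\sigma$-similar over $\mathcal{A}$ if there are an $I_1\times I_2$-matrix $\mathcal{S}$ and an $I_2\times I_1$-matrix $\mathcal{S}'$ over $\mathcal{A}$ with $\mathcal{S}\mathcal{S}'$, $\mathcal{S}'\mathcal{S}$ identity matrices and $\mathcal{S}'\mathcal{M}_1\mathcal{S}^\sigma=\mathcal{M}_2$ (all products converging coefficientwise). With $i_0\in I$ fixed, $\mathcal{M}=(a_{i_1,i_2})$ over $\widehat{A}$ is $1$-normal if $1-a_{i_0,i_0}\in\pi\widehat{A}$ and $a_{i_1,i_2}\in\pi\widehat{A}$ for all $(i_1,i_2)\ne(i_0,i_0)$. The matrices $\mathcal{B}^r(\mathcal{M})$. Put $I_1=I-\{i_0\}$ and $\mu=\inf(\{\mathrm{ord}_p(a_{i_0,i_0}-1)\}\cup\{\mathrm{ord}_p(a_{i_1,i_2}):(i_1,i_2)\neq(i_0,i_0)\})\geq 1/e$. A rational number $\nu$ is chosen as follows (call it admissible for $\mathcal{M}$): if $\mu>\frac1{p-1}$, then $\nu>\frac1{p-1}-\mu$; if only $\mu\ge\frac1{p^b}\frac1{p-1}$ for some $b\in\mathbb{N}_0$, then $\nu>b$. Let $B=\{\sum_{n\ge0}c_nV^n : c_n\in K,\ \mathrm{ord}_p(c_n)+\nu n\to\infty,\ \mathrm{ord}_p(c_n)+\nu n\ge0\ \forall n\}$. Let $J$ be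 the set of maps $q:I_1\to\mathbb{N}_0$ with finite support, $|q|=\sum_iq(i)$, and $C=\prod_J A\widehat{\otimes}_RB$, made a ring by $(\beta\beta')_q=\sum_{q_1+q_2=q}\beta_{q_1}\beta'_{q_2}$; thus $C\cong(A\widehat{\otimes}_RB)[[I_1]]$, the power series ring on the set of variables $I_1$. Let $\lambda:\prod_I\widehat{A}\to C$ send $(a_i)_i$ to the element whose component at $q=0$ is $a_{i_0}$, whose component at the indicator function of $i\in I_1$ is $a_i$, and whose other components are $0$ (i.e. $a_{i_0}+\sum_{i\in I_1}a_i\cdot i$). For $i_2\in I$ let $a_{(i_2)}=(a_{i_1,i_2})_{i_1\in I}$ be the $i_2$-th column of $\mathcal{M}$. For $r\in\mathbb{Z}$, $\mathcal{B}^r(\mathcal{M})$ is the $J\times J$-matrix over $A\widehat{\otimes}_RB$ whose $q_2$-th column ($q_2\in J$), viewed as an element of $C$, is $$b^{(r)}_{(q_2)}=\lambda(a_{(i_0)})^V\lambda(a_{(i_0)})^r\,\frac{\prod_{i\in I_1}\lambda(a_{(i)})^{q_2(i)}}{\lambda(a_{(i_0)})^{|q_2|}},\qquad \lambda(a_{(i_0)})^V:=\exp(V\log\lambda(a_{(i_0)})).$$ $\mathcal{B}^r_{-}(\mathcal{M})$ is obtained by replacing $V$ by $-V$, i.e. using $\lambda(a_{(i_0)})^{-V}$ instead of $\lambda(a_{(i_0)})^V$. *)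

(* Defs.v *)
From HB Require Import structures.
From mathcomp Require Import all_boot all_order all_algebra all_field.
From mathcomp Require Import finmap.
From mathcomp Require Import boolp classical_sets functions cardinality fsbigop.
From mathcomp Require Import reals constructive_ereal ereal.
(* The notations of monalg clash with those of classical_sets. *)
From mathcomp Require Import -(notations) monalg.

Set Implicit Arguments.
Unset Strict Implicit.
Unset Printing Implicit Defensive.

Import Order.TTheory GRing.Theory Num.Theory.
Local Open Scope classical_set_scope.
Local Open Scope ring_scope.

(** Power series in an arbitrary set of (commuting) variables.  The exponents
    are the finitely supported maps [I -> nat], i.e. the [cmonom I] of monalg,
    whose product [mulcm] is the addition of exponents.  [pseries] is not a
    notation: the bare function type carries the pointwise product. *)

Definition pseries (I : choiceType) (R : Type) := cmonom I -> R.

Section PSeriesRing.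
Variables (I : choiceType) (R : comNzRingType).
Implicit Types (f g h : pseries I R) (q : cmonom I).

HB.instance Definition _ := GRing.Zmodule.copy (pseries I R) (cmonom I -> R).

Definition ps_splits q : set (cmonom I * cmonom I) :=
  [set x | mulcm x.1 x.2 = q].

Definition ps_one : pseries I R := fun q => (q == onecm I)%:R.

Definition ps_mul f g : pseries I R :=
  fun q => \sum_(x \in ps_splits q) f x.1 * g x.2.

Definition ps_scale (c : R) f : pseries I R := fun q => c * f q.

Lemma ps_splits_finite q : finite_set (ps_splits q).
Proof.
have [n] := ubnP (mdeg q); elim: n q => // n IHn q /ltnSE le_q_n.
have [/eqP q1|] := boolP (finsupp q == fset0).
  have q_1 : q = onecm I.
    apply/eqP/cmP => i; rewrite onecmE; apply: fsfun_dflt.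
    by rewrite q1 in_fset0.
  apply: (@sub_finite_set _ _ [set (onecm I, onecm I)]); last exact: finite_set1.
  by case=> a b; rewrite /ps_splits /= q_1 => /mulcm_eq0 [-> ->].
case/fset0Pn => i qi.
pose q' := divcm q (ucm i).
have qE : q = mulcm (ucm i) q'.
  apply/eqP/cmP => j; rewrite mulcmE ucmE divcmE ucmE.
  case: eqVneq => [<-|_] /=; last by rewrite add0n subn0.
  by rewrite subnKC // lt0n -mem_finsupp.
have lt_q' : (mdeg q' < n)%N.
  apply: leq_trans le_q_n; rewrite [X in (_ < mdeg X)%N]qE.
  by rewrite (mdegM (ucm i) q') mdegU.
have fin' := IHn _ lt_q'.
apply: (@sub_finite_set _ _
  ((fun x => (mulcm (ucm i) x.1, x.2)) @` ps_splits q' `|`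
   (fun x => (x.1, mulcm (ucm i) x.2)) @` ps_splits q')); last first.
  by rewrite finite_setU; split; apply: finite_image.
case=> a b /= ab_q.
have sub (c : cmonom I) : (0 < c i)%N -> c = mulcm (ucm i) (divcm c (ucm i)).
  move=> ci; apply/eqP/cmP => j; rewrite mulcmE ucmE divcmE ucmE.
  by case: eqVneq => [<-|_] /=; rewrite ?add0n ?subn0 // subnKC.
have canc (c d : cmonom I) : mulcm (ucm i) c = mulcm (ucm i) d -> c = d.
  move=> /eqP/cmP eq_cd; apply/eqP/cmP => j.
  by apply/(@addnI (ucm i j)); have := eq_cd j; rewrite !mulcmE.
have : (0 < a i + b i)%N by rewrite -mulcmE [mulcm a b]ab_q lt0n -mem_finsupp.
rewrite addn_gt0 => /orP [ai|bi].
  left; exists (divcm a (ucm i), b); last by rewrite /= -sub.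
  by rewrite /ps_splits /=; apply: canc; rewrite mulcmA -sub // ab_q.
right; exists (a, divcm b (ucm i)); last by rewrite /= -sub.
rewrite /ps_splits /=; apply: canc.
by rewrite mulcmA (mulcmC (ucm i)) -mulcmA -sub // ab_q.
Qed.

Let spl q := fset_set (ps_splits q).

Let ps_mulE f g q : ps_mul f g q = \sum_(x <- spl q) f x.1 * g x.2.
Proof. by rewrite /ps_mul fsbig_finite //; apply: ps_splits_finite. Qed.

Let mem_spl q x : (x \in spl q) = (mulcm x.1 x.2 == q).
Proof.
rewrite in_fset_set; last exact: ps_splits_finite.
by apply/idP/eqP => [/set_mem|?]; [|apply/mem_set].
Qed.

Fact ps_mulC : commutative ps_mul.
Proof.
move=> f g; apply/funext => q; rewrite !ps_mulE.
pose sw (x : cmonom I * cmonom I) := (x.2, x.1).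
have sw_inj : injective sw by case=> a b [c d] [-> ->].
rewrite (perm_big (map sw (spl q))) /=.
  by rewrite big_map; apply: eq_bigr => x _; rewrite mulrC.
apply: uniq_perm; rewrite ?map_inj_uniq ?fset_uniq // => -[a b].
rewrite mem_spl /=; apply/idP/mapP => [ab|[[c d] + [-> ->]]].
  by exists (b, a); rewrite // mem_spl /= mulcmC.
by rewrite mem_spl /= mulcmC.
Qed.

Fact ps_mulA : associative ps_mul.
Proof.
move=> f g h; apply/funext => q; rewrite !ps_mulE.
pose F (t : cmonom I * (cmonom I * cmonom I)) := f t.1 * (g t.2.1 * h t.2.2).
pose s1 := [seq (x.1, y) | x <- spl q, y <- spl x.2].
pose s2 := [seq (y.1, (y.2, x.2)) | x <- spl q, y <- spl x.1].
transitivity (\sum_(t <- s1) F t).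
  rewrite big_allpairs_dep; apply: eq_bigr => x _.
  by rewrite ps_mulE big_distrr.
transitivity (\sum_(t <- s2) F t); last first.
  rewrite big_allpairs_dep; apply: eq_bigr => x _.
  by rewrite ps_mulE big_distrl; apply: eq_bigr => y _; rewrite /F /= mulrA.
apply: perm_big; apply: uniq_perm.
- apply: allpairs_uniq_dep; rewrite ?fset_uniq //.
  move=> [[a b] y] [[a' b'] y'] /allpairsPdep [x1 [y1 [+ + e1]]].
  move=> + + /allpairsPdep [x2 [y2 [+ + e2]]] /= [ea ey].
  case: e1 e2 => <- <- [] <- <-; rewrite !mem_spl -ey -ea /=.
  by move=> _ /eqP <- _ /eqP <-.
- apply: allpairs_uniq_dep; rewrite ?fset_uniq //; first by move=> x _; exact: fset_uniq.
  move=> [[a b] [c d]] [[a' b'] [c' d']] /allpairsPdep [x1 [y1 [+ + e1]]].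
  move=> + + /allpairsPdep [x2 [y2 [+ + e2]]] /= [ea ec eb].
  case: e1 e2 => <- <- [] <- <-; rewrite !mem_spl -ea -eb -ec /=.
  by move=> _ /eqP <- _ /eqP <-.
move=> [a [b c]]; apply/allpairsPdep/allpairsPdep.
  case=> [[x1 x2] [[y1 y2]]]; rewrite !mem_spl /= => -[/eqP <- /eqP <- [-> -> ->]].
  by exists (mulcm x1 y1, y2), (x1, y1); rewrite !mem_spl /= mulcmA !eqxx.
case=> [[x1 x2] [[y1 y2]]]; rewrite !mem_spl /= => -[/eqP <- /eqP <- [-> -> ->]].
by exists (y1, mulcm y2 x2), (y2, x2); rewrite !mem_spl /= mulcmA !eqxx.
Qed.

Fact ps_mul1 : left_id ps_one ps_mul.
Proof.
move=> f; apply/funext => q; rewrite ps_mulE.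
rewrite (big_fsetD1 (onecm I, q)) /=; last by rewrite mem_spl /= mul0cm.
rewrite /ps_one eqxx mul1r big_seq big1 ?addr0 // => -[a b].
rewrite in_fsetD1 mem_spl /= => /andP[+ /eqP abq].
have [a1|] := eqVneq a (onecm I); last by rewrite mul0r.
by move: abq; rewrite a1 mul0cm => ->; rewrite eqxx.
Qed.

Fact ps_mulDl : left_distributive ps_mul +%R.
Proof.
move=> f g h; apply/funext => q; 
transitivity (ps_mul f h q + ps_mul g h q); last by [].
rewrite !ps_mulE -big_split.
by apply: eq_bigr => x _; apply: mulrDl.
Qed.

Fact ps_one_neq0 : ps_one != 0.
Proof.
apply/eqP => /(congr1 (fun f : pseries I R => f (onecm I))).
by rewrite /ps_one eqxx => /eqP; rewrite oner_eq0.
Qed.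

HB.instance Definition _ := GRing.Zmodule_isComNzRing.Build (pseries I R)
  ps_mulA ps_mulC ps_mul1 ps_mulDl ps_one_neq0.

Fact ps_scaleA a b f : ps_scale a (ps_scale b f) = ps_scale (a * b) f.
Proof. by apply/funext => q; rewrite /ps_scale mulrA. Qed.

Fact ps_scale1 : left_id 1 ps_scale.
Proof. by move=> f; apply/funext => q; rewrite /ps_scale mul1r. Qed.

Fact ps_scaleDr : right_distributive ps_scale +%R.
Proof. by move=> c f g; apply/funext => q; rewrite /ps_scale mulrDr. Qed.

Fact ps_scaleDl f : {morph ps_scale^~ f : a b / a + b}.
Proof. by move=> a b; apply/funext => q; rewrite /ps_scale mulrDl. Qed.

HB.instance Definition _ := GRing.Zmodule_isLmodule.Build R (pseries I R)
  ps_scaleA ps_scale1 ps_scaleDr ps_scaleDl.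

Fact ps_scaleAl (c : R) f g : c *: (f * g) = c *: f * g.
Proof.
apply/funext => q; transitivity (c * ps_mul f g q); first by [].
transitivity (ps_mul (c *: f) g q); last by [].
rewrite !ps_mulE big_distrr.
by apply: eq_bigr => x _; apply: mulrA.
Qed.

HB.instance Definition _ :=
  GRing.Lmodule_isLalgebra.Build R (pseries I R) ps_scaleAl.
HB.instance Definition _ :=
  GRing.Lalgebra_isComAlgebra.Build R (pseries I R).

Definition ps_unit : {pred pseries I R} := fun f => `[< exists g, g * f = 1 >].
Definition ps_inv f : pseries I R :=
  if f \in ps_unit then xget f [set g | g * f = 1] else f.

Fact ps_mulV : {in ps_unit, left_inverse 1 ps_inv *%R}.
Proof.
move=> f fU; rewrite /ps_inv fU.
by case: xgetP => [g -> //|no]; case/asboolP: fU => g /no.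
Qed.

Fact ps_unitP f g : g * f = 1 -> ps_unit f.
Proof. by move=> gf; apply/asboolP; exists g. Qed.

Fact ps_inv_out : {in [predC ps_unit], ps_inv =1 id}.
Proof. by move=> f; rewrite inE /ps_inv => /negbTE ->. Qed.

HB.instance Definition _ := GRing.ComNzRing_hasMulInverse.Build (pseries I R)
  ps_mulV ps_unitP ps_inv_out.

End PSeriesRing.

Definition ps_map (I : choiceType) (R S : Type) (f : R -> S) (x : pseries I R) :
  pseries I S := fun q => f (x q).

Definition ps_var (I : choiceType) (R : comNzRingType) (i : I) : pseries I R :=
  fun q => (q == ucm i)%:R.

Notation polynomials n R := (malg (cmonom 'I_n) R).

Definition ps_of_poly (n : nat) (R : comNzRingType) (f : polynomials n R) :
  pseries 'I_n R := fun q => mcoeff q f.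

Definition degree_le (n : nat) (R : comNzRingType) (f : polynomials n R)
    (d : nat) : Prop :=
  forall q, (d < mdeg q)%N -> mcoeff q f = 0.

(** Subrings, quotients, completions, localizations and tensor products are
    rings given, up to isomorphism, together with their structural maps. *)

Definition is_subring (D E : nzRingType) (f : {rmorphism D -> E}) (S : set E) :
    Prop :=
  injective f /\ range f = S.

Definition in_ideal (E : comNzRingType) (t x : E) : Prop := exists y, x = t * y.

Definition is_quotient (E F : comNzRingType) (t : E) (f : {rmorphism E -> F}) :
    Prop :=
  range f = setT /\ (forall x, f x = 0 <-> in_ideal t x).

(** [F] is the inverse limit of the rings [E / t^N E]. *)
Definition is_adic_completion (E F : comNzRingType) (t : E)
    (j : {rmorphism E -> F}) : Prop :=
  [/\ forall x : F, (forall N, in_ideal (j t ^+ N) x) -> x = 0,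
      forall u : nat -> F, (forall N, in_ideal (j t ^+ N) (u N.+1 - u N)) ->
        exists l, forall N, in_ideal (j t ^+ N) (l - u N),
      forall N (x : F), exists a, in_ideal (j t ^+ N) (x - j a)
    & forall N (a : E), in_ideal (j t ^+ N) (j a) -> in_ideal (t ^+ N) a].

(** [F] is the ring of fractions [E[1/t]]. *)
Definition is_localization (E : comNzRingType) (F : comUnitRingType) (t : E)
    (j : {rmorphism E -> F}) : Prop :=
  [/\ j t \is a GRing.unit,
      forall y : F, exists N x, y = j x / j t ^+ N
    & forall x : E, j x = 0 -> exists N, t ^+ N * x = 0].

Definition bilinear_map (R : comNzRingType) (M N P : lmodType R)
    (b : M -> N -> P) : Prop :=
  (forall x, linear (b x)) /\ (forall y, linear (b^~ y)).

Definition is_tensor_product (R : comNzRingType) (M N T : lmodType R)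
    (b : M -> N -> T) : Prop :=
  bilinear_map b /\
  forall (P : lmodType R) (c : M -> N -> P), bilinear_map c ->
    exists h : {linear T -> P}, (forall x y, h (b x y) = c x y) /\
      forall h' : {linear T -> P}, (forall x y, h' (b x y) = c x y) -> h' =1 h.

Definition flat_module (R : comNzRingType) (A : lmodType R) : Prop :=
  forall (M N TM TN : lmodType R) (bM : A -> M -> TM) (bN : A -> N -> TN)
    (u : {linear M -> N}) (h : {linear TM -> TN}),
  is_tensor_product bM -> is_tensor_product bN -> injective u ->
  (forall a x, h (bM a x) = bN a (u x)) -> injective h.

Definition free_module (A : comNzRingType) (M : lmodType A) : Prop :=
  exists (X : choiceType) (f : {linear malg X A -> M}), bijective f.

(** [A] is free of rank [N] as a module over the subring [s A]. *)
Definition finite_free_over_image (A : comNzRingType) (s : {rmorphism A -> A})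
    (N : nat) : Prop :=
  exists x : 'I_N -> A,
    (forall a, exists c, a = \sum_i s (c i) * x i) /\
    (forall c, \sum_i s (c i) * x i = 0 -> forall i, s (c i) = 0).

Definition adically_separated (A : comNzRingType) (M : lmodType A) (t : A) :
    Prop :=
  forall x : M, (forall N, exists y, x = t ^+ N *: y) -> x = 0.

Definition derivation (R : comNzRingType) (A : comAlgType R) (M : lmodType A)
    (d : A -> M) : Prop :=
  [/\ forall a b, d (a + b) = d a + d b,
      forall a b, d (a * b) = a *: d b + b *: d a
    & forall r : R, d r%:A = 0].

Definition is_separated_differentials (R : comNzRingType) (A : comAlgType R)
    (p : nat) (Om : lmodType A) (d : A -> Om) : Prop :=
  [/\ adically_separated Om p%:R, derivation d
    & forall (M : lmodType A) (d' : A -> M),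
        adically_separated M p%:R -> derivation d' ->
        exists h : {linear Om -> M}, (forall a, h (d a) = d' a) /\
          forall h' : {linear Om -> M}, (forall a, h' (d a) = d' a) -> h' =1 h].

Definition prime_ideal (A : comNzRingType) (P : set A) : Prop :=
  [/\ P 0, forall x y, P x -> P y -> P (x + y), forall a x, P x -> P (a * x),
      ~ P 1 & forall x y, P (x * y) -> P x \/ P y].

Definition Spec (A : comNzRingType) : set (set A) := [set P | prime_ideal P].
Arguments Spec : clear implicits.

Definition zariski_closed (A : comNzRingType) (Z : set (set A)) : Prop :=
  exists E : set A, Z = [set P | prime_ideal P /\ E `<=` P].

Definition connected_spectrum (A : comNzRingType) : Prop :=
  Spec A !=set0 /\
  forall Z1 Z2 : set (set A), zariski_closed Z1 -> zariski_closed Z2 ->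
    Z1 `|` Z2 = Spec A -> Z1 `&` Z2 = set0 -> Z1 = set0 \/ Z2 = set0.

Definition prime_chain (A : comNzRingType) (l : nat) : Prop :=
  exists P : nat -> set A,
    (forall i, (i <= l)%N -> prime_ideal (P i)) /\
    (forall i, (i < l)%N -> P i `<` P i.+1).

Definition has_krull_dimension (A : comNzRingType) (d : nat) : Prop :=
  prime_chain A d /\ (forall l, prime_chain A l -> (l <= d)%N).

Definition finitely_presented (k : comNzRingType) (A : comAlgType k) : Prop :=
  exists (n m : nat) (f : {lrmorphism polynomials n k -> A})
         (h : 'I_m -> polynomials n k),
    range f = setT /\
    (forall x, f x = 0 <-> exists c, x = \sum_i c i * h i).

Definition formally_smooth (k : comNzRingType) (A : comAlgType k) : Prop :=
  forall (C D : comAlgType k) (f : {lrmorphism C -> D}), range f = setT ->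
    (forall x y, f x = 0 -> f y = 0 -> x * y = 0) ->
  forall g : {lrmorphism A -> D}, exists h : {lrmorphism A -> C},
    forall a, f (h a) = g a.

Definition smooth_algebra (k : comNzRingType) (A : comAlgType k) : Prop :=
  finitely_presented A /\ formally_smooth A.

Definition is_Zp (p : nat) (Zp : idomainType) : Prop :=
  is_adic_completion (p%:R : int) (intmul 1 : {rmorphism int -> Zp}).

Definition is_ring_of_integers (Zp R : idomainType)
    (K : fieldExtType {fraction Zp}) (iota : {rmorphism R -> K}) : Prop :=
  is_subring iota [set x | integralOver (in_alg K \o @tofrac Zp) x].

Definition is_uniformizer (R : idomainType) (pi : R) : Prop :=
  pi \isn't a GRing.unit /\
  forall x : R, x != 0 ->
    exists (n : nat) (u : R), u \is a GRing.unit /\ x = pi ^+ n * u.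

(** [ord_pi] is [ord] with [t = pi], and [ord_p] is [ord] with [t = p]. *)
Definition ord (RR : realType) (E : comNzRingType) (t x : E) : \bar RR :=
  ereal_sup [set z | exists n m : nat,
    [/\ (0 < m)%N, in_ideal (t ^+ n) (x ^+ m) & z = (n%:R / m%:R)%:E]].

(** The extension of [ord_p] from [R] to [K]: here [n] may be negative. *)
Definition ordK (RR : realType) (R : comNzRingType) (K : fieldType)
    (iota : R -> K) (p : nat) (x : K) : \bar RR :=
  ereal_sup [set z | exists (n : int) (m : nat),
    [/\ (0 < m)%N, exists a, x ^+ m = p%:R ^ n * iota a
      & z = (n%:~R / m%:R)%:E]].

(** The union over [m] and [c] of the sets [[m, c]]; the series [\sum_j pi^j p_j] converges
    [pi]-adically, coefficient by coefficient. *)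
Definition dagger_series (R : comNzRingType) (pi : R) (n : nat) :
    set (pseries 'I_n R) :=
  [set f | exists m c : nat, [/\ (0 < m)%N, (0 < c)%N &
     exists P : nat -> polynomials n R,
       (forall j, degree_le (P j) (m + c * j)) /\
       (forall q N, in_ideal (pi ^+ N)
          (f q - \sum_(j < N) pi ^+ j * mcoeff q (P j)))]].

(** [phi] identifies [A] with the quotient of the dagger algebra [D] by the
    ideal generated by the polynomials [g_j]. *)
Definition is_dagger_quotient (R : comNzRingType) (n s : nat)
    (D A : comAlgType R) (jD : {lrmorphism D -> pseries 'I_n R})
    (g : 'I_s -> polynomials n R) (phi : {lrmorphism D -> A}) : Prop :=
  range phi = setT /\
  forall x, phi x = 0 <->
    exists c : 'I_s -> D, jD x = \sum_j jD (c j) * ps_of_poly (g j).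

Definition B_series (RR : realType) (R : comNzRingType) (K : fieldType)
    (iota : R -> K) (p : nat) (nu : rat) : set (pseries unit K) :=
  [set f |
    (forall q, 0 <= ordK RR iota p (f q) + (ratr nu * (mdeg q)%:R)%:E)%E /\
    (forall M : RR, exists N : nat, forall q, (N <= mdeg q)%N ->
       (M%:E <= ordK RR iota p (f q) + (ratr nu * (mdeg q)%:R)%:E)%E)].

Definition imatrix (I1 I2 : Type) (E : Type) := I1 -> I2 -> E.

Section Matrices.
Variables (RR : realType) (E : comNzRingType) (t : E).

Definition adic_sum (X : choiceType) (u : X -> E) (l : E) : Prop :=
  forall N, exists F0 : {fset X}, forall F : {fset X}, (F0 `<=` F)%fset ->
    in_ideal (t ^+ N) (\sum_(x <- F) u x - l).

Definition is_mx_product (I1 I2 I3 : choiceType) (S : imatrix I1 I2 E)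
    (S' : imatrix I2 I3 E) (P : imatrix I1 I3 E) : Prop :=
  forall i j, adic_sum (fun k => S i k * S' k j) (P i j).

Definition mx_identity (I : eqType) : imatrix I I E := fun i j => (i == j)%:R.

Definition mx_map (s : E -> E) (I1 I2 : Type) (M : imatrix I1 I2 E) :
  imatrix I1 I2 E := fun i j => s (M i j).

(** All the products occurring in [S' M1 S^s] are required to converge; [P]
    and [Q] are its two partial products. *)
Definition sigma_similar (s : E -> E) (I1 I2 : choiceType)
    (M1 : imatrix I1 I1 E) (M2 : imatrix I2 I2 E) : Prop :=
  exists (S : imatrix I1 I2 E) (S' : imatrix I2 I1 E)
         (P : imatrix I2 I1 E) (Q : imatrix I1 I2 E),
    [/\ is_mx_product S S' (@mx_identity I1),
        is_mx_product S' S (@mx_identity I2),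
        is_mx_product S' M1 P /\ is_mx_product P (mx_map s S) M2
      & is_mx_product M1 (mx_map s S) Q /\ is_mx_product S' Q M2].

Definition nuclear (I1 I2 : choiceType) (M : imatrix I1 I2 E) : Prop :=
  forall C : RR, 0 < C ->
    finite_set [set i2 |
      (ereal_inf [set ord RR t (M i1 i2) | i1 in setT] < C%:E)%E].

Definition one_normal (I : eqType) (i0 : I) (M : imatrix I I E) : Prop :=
  in_ideal t (1 - M i0 i0) /\
  forall i1 i2, (i1, i2) != (i0, i0) -> in_ideal t (M i1 i2).

End Matrices.

Definition mu_of (RR : realType) (E : comNzRingType) (p : nat) (I : eqType)
    (i0 : I) (M : imatrix I I E) : \bar RR :=
  ereal_inf ([set ord RR p%:R (M i0 i0 - 1)] `|`
    [set ord RR p%:R (M i.1 i.2) | i in [set i | i != (i0, i0)]]).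

(** The two cases exclude each other: when [mu > 1 / (p - 1)], the bounds [nu > b]
    of the second one would be needlessly strong. *)
Definition admissible (RR : realType) (p : nat) (mu : \bar RR) (nu : rat) :
    Prop :=
  let c : RR := (p.-1)%:R^-1 in
  ((c%:E < mu)%E /\ (c%:E - mu < (ratr nu)%:E)%E) \/
  ((mu <= c%:E)%E /\
   exists b : nat, (((p ^ b)%:R^-1 * c)%:E <= mu)%E /\ b%:R < nu).

(** Logarithm, exponential and [V]-th powers.  [T] is torsion free and
    [iK : T -> TK] is its localization [T[1/pi]], in which all the
    denominators are invertible; its topology has the [pi^N T] as neighborhoods
    of [0], and power series over [TK] converge coefficientwise. *)
Section ExpLog.
Variables (T : comNzRingType) (TK : comUnitRingType) (iK : {rmorphism T -> TK}).
Variables (t : T) (I : choiceType).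

Definition limK (u : nat -> TK) : TK :=
  xget 0 [set l | forall N, exists n0, forall n, (n0 <= n)%N ->
    exists y : T, u n - l = iK (t ^+ N * y)].

Definition ps_log (x : pseries I TK) : pseries I TK :=
  fun q => limK (fun N =>
    (\sum_(1 <= n < N) ((-1) ^+ n.+1 / n%:R) *: (x - 1) ^+ n) q).

Definition ps_exp (x : pseries I TK) : pseries I TK :=
  fun q => limK (fun N => (\sum_(0 <= n < N) (n`!%:R)^-1 *: x ^+ n) q).

Definition ps_power (v : TK) (x : pseries I T) : pseries I T :=
  xget 0 [set y | ps_map iK y = ps_exp (v *: ps_log (ps_map iK x))].

End ExpLog.

Section BMatrix.
Variables (Ah T : comNzRingType) (TK : comUnitRingType).
Variables (jAh : {rmorphism Ah -> T}) (iK : {rmorphism T -> TK}) (t : T).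
Variables (I : choiceType) (i0 : I).

Definition complement1 := {i : I | i != i0}.

Definition lambda (a : I -> Ah) : pseries complement1 T :=
  fun q => (if q == onecm _ then jAh (a i0) else 0)
         + \sum_(i <- finsupp q | q == ucm i) jAh (a (val i)).

(** The column of index [q2] is the power series in parentheses; [v] is [V] for
    [B^r(M)] and [-V] for [B^r_-(M)]. *)
Definition Bmatrix (v : TK) (r : int) (M : imatrix I I Ah) :
    imatrix (cmonom complement1) (cmonom complement1) T :=
  fun q1 q2 =>
    let lam i := lambda (M^~ i) in
    (ps_power iK t v (lam i0) * lam i0 ^ r *
       (\prod_(i <- finsupp q2) lam (val i) ^+ q2 i) / lam i0 ^+ mdeg q2) q1.

End BMatrix.

Arguments lambda {Ah T} jAh {I} i0 a.
Arguments Bmatrix {Ah T TK} jAh iK t {I} i0 v r M.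

(* Main.v *)
Require Import Defs.
From HB Require Import structures.
From mathcomp Require Import all_boot all_order all_algebra all_field.
From mathcomp Require Import finmap.
From mathcomp Require Import boolp classical_sets functions cardinality fsbigop.
From mathcomp Require Import reals constructive_ereal ereal.
From mathcomp Require Import -(notations) monalg.
From mathcomp Require Import ring lra zify.

Set Implicit Arguments.
Unset Strict Implicit.
Unset Printing Implicit Defensive.

Import Order.TTheory GRing.Theory Num.Theory.
Local Open Scope classical_set_scope.
Local Open Scope ring_scope.

(** For a matrix X write x_i for the power series attached to its i-th column and
    x_0 for that of i_0.  The column q of B^r(X) is x_0^(V+r) times the value at
    the monomial q of the substitution i |-> x_i / x_0.  This substitution is a
    ring homomorphism wherever it converges, so B^r is functorial: XY = Z implies
    B^r(X) B^r(Y) = B^r(Z).  What has to be controlled is x_0^V = exp(V log x_0):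
    it makes sense, and is multiplicative, for x_0 = 1 + pi^m z when pi^m is
    compatible with nu, and for a column congruent modulo pi^m to a constant c
    times the unit vector one uses (x_0 / c)^V instead.

    The special fibre is reduced, since it is smooth over a finite field; hence
    ord_p >= m / e means divisibility by pi^m, and admissibility of nu gives an m
    such that M and M' are congruent to the elementary matrix E_00 modulo pi^m.
    Reading S' M' S^sigma = M and S S' = 1 modulo pi^m shows that the columns of
    index i_0 of S and S' are multiples of the unit vector modulo pi^m and that
    S_00 is fixed by sigma modulo pi^m.  As the special fibre is connected, the
    elements fixed by the q-th power Frobenius are constants, so S_00 is congruent
    to some c in R; sigma fixes c, so the constants c and 1/c attached to S^sigma
    and S' cancel and B^r of S and S' realizes the similarity. *)

(** * Adic topologies *)

(** All computations with log and exp take place in T, without denominators. For small mu the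
    logarithm of x_0 need not have coefficients in T, and for negative nu the element V is not in B.
    Two exponents [l1] and [l2] therefore move a factor pi^(l1 - l2), possibly with a negative
    exponent, from the logarithm into the argument of the exponential; admissibility of nu is what
    makes such a choice possible. Additivity of the logarithm is the limit, along P = p^k, of the
    exact identity x^P y^P - 1 = (x^P - 1) y^P + (y^P - 1) divided by P. Substitution is a relation
    between series rather than a map, since convergence is known only for the series built from
    columns. The relation is stable under ring operations and adic limits, hence under inverses, log
    and exp. Reducedness of the special fibre comes from infinitesimal lifting alone: a presentation
    P -> A with kernel (h_i) acquires a section modulo (h_i^q), and a Frobenius splitting of the
    polynomial ring brings (h_i^q) back to (h_i). *)

Section InIdeal.
Variables (E : comNzRingType) (t : E).
Implicit Types (x y a : E).

Lemma in_ideal0 : in_ideal t 0.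
Proof. by exists 0; rewrite mulr0. Qed.

Lemma in_idealD x y : in_ideal t x -> in_ideal t y -> in_ideal t (x + y).
Proof. by move=> [a ->] [b ->]; exists (a + b); rewrite mulrDr. Qed.

Lemma in_idealN x : in_ideal t x -> in_ideal t (- x).
Proof. by move=> [a ->]; exists (- a); rewrite mulrN. Qed.

Lemma in_idealB x y : in_ideal t x -> in_ideal t y -> in_ideal t (x - y).
Proof. by move=> ? /in_idealN; apply: in_idealD. Qed.

Lemma in_idealM a x : in_ideal t x -> in_ideal t (a * x).
Proof. by move=> [b ->]; exists (a * b); rewrite mulrCA. Qed.

Lemma in_idealMr a x : in_ideal t x -> in_ideal t (x * a).
Proof. by rewrite mulrC; apply: in_idealM. Qed.

Lemma in_ideal_sum (X : eqType) (r : seq X) (P : pred X) (F : X -> E) :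
  (forall i, i \in r -> P i -> in_ideal t (F i)) -> in_ideal t (\sum_(i <- r | P i) F i).
Proof.
move=> tF; rewrite big_seq_cond; elim/big_ind: _ => [|x y|i /andP[]].
- exact: in_ideal0.
- exact: in_idealD.
exact: tF.
Qed.

Lemma in_ideal_trans y x z : in_ideal t (x - y) -> in_ideal t (y - z) -> in_ideal t (x - z).
Proof. by move=> xy yz; rewrite -(subrK y x) -addrA; apply: in_idealD. Qed.

Lemma in_ideal_sym x y : in_ideal t (x - y) -> in_ideal t (y - x).
Proof. by rewrite -opprB => /in_idealN; rewrite opprK. Qed.

Lemma in_ideal_subl1 x y : in_ideal t (x - y) -> in_ideal t y -> in_ideal t x.
Proof. by move=> xy y0; rewrite -(subrK y x); apply: in_idealD. Qed.

Lemma in_ideal_congM x y x' y' : in_ideal t (x - x') -> in_ideal t (y - y') ->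
  in_ideal t (x * y - x' * y').
Proof.
move=> xx yy; rewrite (_ : _ - _ = (x - x') * y + x' * (y - y')); last by ring.
by apply: in_idealD; [apply: in_idealMr|apply: in_idealM].
Qed.

Lemma in_ideal_congX n x x' : in_ideal t (x - x') -> in_ideal t (x ^+ n - x' ^+ n).
Proof. by move=> xx; rewrite subrXX; apply: in_idealMr. Qed.
End InIdeal.

Section Adic.
Variables (E : comNzRingType) (t : E).
Implicit Types (x y a : E) (u v : nat -> E).

Lemma in_ideal_expr0 x : in_ideal (t ^+ 0) x.
Proof. by exists x; rewrite mul1r. Qed.

Lemma in_ideal_le M N x : (M <= N)%N -> in_ideal (t ^+ N) x -> in_ideal (t ^+ M) x.
Proof.
move=> MN [y ->]; exists (t ^+ (N - M) * y).
by rewrite mulrA -exprD subnKC.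
Qed.

Lemma in_ideal_mul M N x y :
  in_ideal (t ^+ M) x -> in_ideal (t ^+ N) y -> in_ideal (t ^+ (M + N)) (x * y).
Proof. by move=> [a ->] [b ->]; exists (a * b); rewrite exprD mulrACA. Qed.

Definition adic_cvg u l :=
  forall N, exists n0, forall n, (n0 <= n)%N -> in_ideal (t ^+ N) (u n - l).

Definition adic_null u :=
  forall N, exists n0, forall n, (n0 <= n)%N -> in_ideal (t ^+ N) (u n).

Definition adic_separated := forall x, (forall N, in_ideal (t ^+ N) x) -> x = 0.

Definition adic_complete := adic_separated /\
  forall u, (forall N, in_ideal (t ^+ N) (u N.+1 - u N)) ->
    exists l, forall N, in_ideal (t ^+ N) (l - u N).

Lemma adic_cvg_unique u l l' :
  adic_separated -> adic_cvg u l -> adic_cvg u l' -> l = l'.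
Proof.
move=> sep ul ul'; apply/eqP; rewrite -subr_eq0; apply/eqP/sep => N.
have [[n1 H1] [n2 H2]] := (ul N, ul' N); pose n := maxn n1 n2.
apply: (@in_ideal_trans _ _ (u n)); last by apply: H2; rewrite leq_maxr.
by apply: in_ideal_sym; apply: H1; rewrite leq_maxl.
Qed.

Lemma adic_cvg_cst l : adic_cvg (fun=> l) l.
Proof. by move=> N; exists 0%N => n _; rewrite subrr; exact: in_ideal0. Qed.

Lemma adic_cvgD u v l l' :
  adic_cvg u l -> adic_cvg v l' -> adic_cvg (fun n => u n + v n) (l + l').
Proof.
move=> ul vl N; have [[n1 H1] [n2 H2]] := (ul N, vl N); exists (maxn n1 n2) => n.
rewrite geq_max opprD addrACA => /andP[? ?].
by apply: in_idealD; [apply: H1|apply: H2].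
Qed.

Lemma adic_cvgM u v l l' :
  adic_cvg u l -> adic_cvg v l' -> adic_cvg (fun n => u n * v n) (l * l').
Proof.
move=> ul vl N; have [[n1 H1] [n2 H2]] := (ul N, vl N); exists (maxn n1 n2) => n.
rewrite geq_max => /andP[? ?].
by apply: in_ideal_congM; [apply: H1|apply: H2].
Qed.

Lemma adic_nullMl u v : adic_null u -> adic_null (fun n => u n * v n).
Proof.
by move=> u0 N; have [n0 H] := u0 N; exists n0 => n /H; apply: in_idealMr.
Qed.

(** [adic_complete] only accepts sequences whose N-th step lies in t^N, so the partial sums are
    sampled along the nondecreasing cut-offs [g N]. *)
Lemma adic_series_cvg u : adic_complete -> adic_null u ->
  exists l, adic_cvg (fun n => \sum_(i < n) u i) l.
Proof.
move=> [_ cplt] /choice [f fP].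
pose g N := (\max_(M < N.+1) f M)%N.
have fg N : (f N <= g N)%N by apply: (@leq_bigmax _ (fun M : 'I_N.+1 => f M) ord_max).
have gS N : (g N <= g N.+1)%N by rewrite /g [X in (_ <= X)%N]big_ord_recr leq_maxl.
have diff N n n' : (f N <= n <= n')%N ->
    in_ideal (t ^+ N) (\sum_(i < n') u i - \sum_(i < n) u i).
  move=> /andP[fn nn']; rewrite -!(big_mkord xpredT u) (@big_cat_nat _ _ _ n) //=.
  rewrite addrAC subrr add0r big_nat; apply: in_ideal_sum => i _ /andP[ni _].
  by apply: fP; apply: leq_trans ni.
have [l lP] := cplt (fun N => \sum_(i < g N) u i)
  (fun N => diff _ _ _ (introT andP (conj (fg N) (gS N)))).
exists l => N; exists (g N) => n gn.
apply: (@in_ideal_trans _ _ (\sum_(i < g N) u i)); last exact: in_ideal_sym.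
by apply: diff; rewrite fg.
Qed.

Definition adic_series u : E := xget 0 [set l | adic_cvg (fun n => \sum_(i < n) u i) l].

Lemma adic_seriesP u : adic_complete -> adic_null u ->
  adic_cvg (fun n => \sum_(i < n) u i) (adic_series u).
Proof.
by move=> cplt /(adic_series_cvg cplt) [l lP]; rewrite /adic_series; case: xgetP => [x ->|/(_ l)].
Qed.

Lemma adic_series_eq u l : adic_complete ->
  adic_cvg (fun n => \sum_(i < n) u i) l -> adic_series u = l.
Proof.
move=> [sep _] ul; rewrite /adic_series; case: xgetP => [x -> xP|/(_ l)//].
exact: adic_cvg_unique ul.
Qed.

Lemma adic_series_trunc u N n0 : adic_complete ->
  (forall n, (n0 <= n)%N -> in_ideal (t ^+ N) (u n)) -> adic_null u ->
  in_ideal (t ^+ N) (adic_series u - \sum_(i < n0) u i).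
Proof.
move=> cplt un0 u0; have [n1 n1P] := adic_seriesP cplt u0 N.
have := n1P (maxn n0 n1) (leq_maxr _ _) => /in_ideal_sym H.
apply: (in_ideal_trans H).
rewrite -!(big_mkord xpredT u) (@big_cat_nat _ _ _ n0) ?leq_maxl //=.
rewrite addrAC subrr add0r big_nat; apply: in_ideal_sum => i _ /andP[ni _].
exact: un0.
Qed.
End Adic.

Lemma adic_cvg_morph (E F : comNzRingType) (t : E) (t' : F) (s : {rmorphism E -> F})
  (u : nat -> E) (l : E) : s t = t' -> adic_cvg t u l -> adic_cvg t' (s \o u) (s l).
Proof.
move=> st ul N; have [n0 H] := ul N; exists n0 => n /H [y yE].
by exists (s y); rewrite /= -rmorphB yE rmorphM rmorphXn /= st.
Qed.

Lemma adic_series_morph (E F : comNzRingType) (t : E) (t' : F) (s : {rmorphism E -> F})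
  (u : nat -> E) : s t = t' -> adic_complete t -> adic_complete t' -> adic_null t u ->
  s (adic_series t u) = adic_series t' (s \o u).
Proof.
move=> st ct ct' u0; apply/esym/adic_series_eq => //.
have := adic_cvg_morph st (adic_seriesP ct u0).
congr adic_cvg; apply/funext => n /=; exact: rmorph_sum.
Qed.

(** * Logarithm, exponential and V-th powers of 1 + t^m z without denominators *)

Section PowerSeries.
Variables (E : comNzRingType) (t : E).
Hypothesis t_reg : GRing.lreg t.
Hypothesis E_complete : adic_complete t.
Variable p : nat.
Hypothesis p_prime : prime p.
Hypothesis p_t : in_ideal t (p%:R : E).
Hypothesis nat_reg : forall n, (0 < n)%N -> GRing.lreg (n%:R : E).
Variables (m l1 l2 : nat) (delta gamma : nat -> E).
Hypothesis m_gt0 : (0 < m)%N.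
Hypothesis delta0 : delta 0 = 0.
Hypothesis deltaE : forall n, (0 < n)%N ->
  n%:R * t ^+ l1 * delta n = (-1) ^+ n.+1 * t ^+ (m * n + l2).
Hypothesis delta_null : adic_null t delta.
Hypothesis gamma0 : gamma 0 = 1.
Hypothesis gammaM : forall i j, gamma i * gamma j = 'C(i + j, i)%:R * gamma (i + j).
Hypothesis gamma_null : adic_null t gamma.

(* [t ^ (l1 - l2) ell z] is [log (1 + t ^ m z)], and [pw z] is [(1 + t ^ m z) ^ V]
   when [gamma j = V ^ j t ^ (j (l1 - l2)) / j!]. *)
Definition ell z : E := adic_series t (fun n => delta n * z ^+ n).
Definition pexp a : E := adic_series t (fun n => gamma n * a ^+ n).
Definition pw z : E := pexp (ell z).

(** Modulo t^N all three series become finite sums. In the product of the last two, the terms of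
    degree below [n0] add up by the binomial formula, and by the divided power relation [gammaM]
    each term of higher degree contains a [gamma n] with n at least [n0]. *)
Lemma pexpD a b : pexp (a + b) = pexp a * pexp b.
Proof.
have [sep _] := E_complete.
apply/eqP; rewrite -subr_eq0; apply/eqP/sep => N.
have [n0 n0P] := gamma_null N.
have tr c : in_ideal (t ^+ N) (pexp c - \sum_(i < n0) gamma i * c ^+ i).
  apply: adic_series_trunc => //; last exact: adic_nullMl.
  by move=> n /n0P; apply: in_idealMr.
apply: (in_ideal_trans (tr _)); apply: in_ideal_sym.
apply: (in_ideal_trans (in_ideal_congM (tr a) (tr b))).
(* The truncations are values at 1 of polynomials, so that [coefM] supplies the Cauchy product. *)
pose P c := \poly_(i < n0) (gamma i * c ^+ i).
have PE c : \sum_(i < n0) gamma i * c ^+ i = (P c).[1].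
  by rewrite horner_poly; apply: eq_bigr => i _; rewrite expr1n mulr1.
rewrite (PE a) (PE b) -hornerM.
have sz : (size (P a * P b)%R <= n0 + n0)%N.
  apply: leq_trans (size_polyMleq _ _) _; apply: leq_trans (leq_pred _) _.
  by apply: leq_add; apply: size_poly.
rewrite (horner_coef_wide _ sz) big_split_ord /= addrAC; apply: in_idealD; last first.
  apply: in_ideal_sum => i _ _; apply: in_idealMr; rewrite coefM.
  apply: in_ideal_sum => j _ _; rewrite !coef_poly.
  case: ifP => _; last by rewrite mul0r; exact: in_ideal0.
  case: ifP => _; last by rewrite mulr0; exact: in_ideal0.
  rewrite mulrACA gammaM subnKC; last by rewrite -ltnS.
  by apply: in_idealMr; apply: in_idealM; apply: n0P; rewrite leq_addr.
rewrite -sumrB; apply: in_ideal_sum => n _ _.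
rewrite (_ : _ - _ = 0); first exact: in_ideal0.
apply/eqP; rewrite subr_eq0 expr1n mulr1 coefM addrC exprDn mulr_sumr; apply/eqP.
apply: eq_bigr => i _; have le_in : (i <= n)%N by rewrite -ltnS.
rewrite !coef_poly !ifT; last 2 first.
- by apply: leq_ltn_trans (ltn_ord n); exact: leq_subr.
- exact: leq_ltn_trans (ltn_ord n).
by rewrite mulrACA gammaM subnKC // -mulr_natl (mulrC (b ^+ _)); ring.
Qed.

Lemma pexp0 : pexp 0 = 1.
Proof.
apply: adic_series_eq => // N; exists 1%N => -[//|n] _.
rewrite big_ord_recl /= gamma0 mulr1 big1 ?addr0 ?subrr; first exact: in_ideal0.
by move=> i _; rewrite exprS mul0r mulr0.
Qed.

Lemma ell0 : ell 0 = 0.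
Proof.
apply: adic_series_eq => // N; exists 0%N => n _.
rewrite big1 ?subr0; first exact: in_ideal0.
by move=> [[|i] lt_in] _ /=; rewrite ?delta0 ?mul0r // exprS mul0r mulr0.
Qed.

Lemma pw0 : pw 0 = 1.
Proof. by rewrite /pw ell0 pexp0. Qed.

(* [(x ^ P - 1) / P] tends to [log x] along [P = p ^ k], which makes [log] additive. *)
Definition log_approx P z : E :=
  \sum_(i < P) (-1) ^+ i * 'C(P.-1, i)%:R * delta i.+1 * z ^+ i.+1.

Lemma lregXt n : GRing.lreg (t ^+ n).
Proof. exact: lregX. Qed.

(** The binomial expansion is compared term by term after multiplication by the regular element i +
    1; [mul_bin_diag] turns (i + 1) C(P, i + 1) into P C(P - 1, i), which exhibits the division by
    P. *)
Lemma log_approxE P z :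
  t ^+ l2 * ((1 + t ^+ m * z) ^+ P - 1) = P%:R * t ^+ l1 * log_approx P z.
Proof.
rewrite exprDn big_ord_recl /= bin0 expr1n mulr1 mulr1n addrAC subrr add0r.
rewrite !mulr_sumr; apply: eq_bigr => i _.
have i1 : (0 < i.+1)%N by [].
apply: (nat_reg i1); rewrite /bump leq0n add1n expr1n mul1r exprMn -exprM.
rewrite -[_ *+ 'C(P, _)]mulr_natl.
have dE := deltaE i1.
transitivity ((i.+1 * 'C(P, i.+1))%:R * (t ^+ (m * i.+1 + l2)) * z ^+ i.+1).
  by rewrite natrM exprD; ring.
transitivity (P%:R * ((-1) ^+ i * 'C(P.-1, i)%:R) * (i.+1%:R * t ^+ l1 * delta i.+1) * z ^+ i.+1);
  last by ring.
rewrite dE -mul_bin_diag natrM.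
have -> : (-1) ^+ i.+2 = (-1) ^+ i :> E by rewrite !exprS !mulN1r opprK.
have s2 : (-1) ^+ i * (-1) ^+ i = 1 :> E by rewrite -expr2 sqrr_sign.
transitivity (P%:R * 'C(P.-1, i)%:R * ((-1) ^+ i * (-1) ^+ i) * t ^+ (m * i.+1 + l2) * z ^+ i.+1).
  by rewrite s2 mulr1.
by ring.
Qed.

Lemma natr_in_ideal N n : (p ^ N %| n)%N -> in_ideal (t ^+ N) (n%:R : E).
Proof.
move=> /dvdnP[d ->]; rewrite natrM natrX; apply: in_idealM.
have [y ->] := p_t; rewrite exprMn; apply: in_idealMr.
by exists 1; rewrite mulr1.
Qed.

(** By Pascal's rule the errors at i and i + 1 are opposite up to C(p^k, i + 1), which is divisible
    by p^(k - v_p(i + 1)) or zero, because (i + 1) C(p^k, i + 1) is a multiple of p^k. *)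
Lemma bin_pred_cvg i : adic_cvg t (fun k => 'C((p ^ k).-1, i)%:R) ((-1) ^+ i).
Proof.
elim: i => [|i IH] N.
  by exists 0%N => n _; rewrite bin0 subrr; exact: in_ideal0.
have [n0 n0P] := IH N; exists (maxn n0 (N + logn p i.+1)).+1 => n.
rewrite gtn_max => /andP[/ltnW n0n Nn].
have pn0 : (0 < p ^ n)%N by rewrite expn_gt0 prime_gt0.
have binE : ('C((p ^ n), i.+1) = 'C((p ^ n).-1, i.+1) + 'C((p ^ n).-1, i))%N.
  by rewrite -[X in 'C(X, _) = _](prednK pn0) binS.
have -> : 'C((p ^ n).-1, i.+1)%:R - (-1) ^+ i.+1 =
   'C(p ^ n, i.+1)%:R - ('C((p ^ n).-1, i)%:R - (-1) ^+ i) :> E.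
  by rewrite binE natrD exprS; ring.
apply: in_idealB; last exact: n0P.
apply: natr_in_ideal; have [->|bin_gt0] := posnP 'C(p ^ n, i.+1); first exact: dvdn0.
rewrite pfactor_dvdn //.
have : (n <= logn p (i.+1 * 'C(p ^ n, i.+1)))%N.
  by rewrite -pfactor_dvdn ?muln_gt0 // -mul_bin_diag dvdn_mulr.
by rewrite lognM //; lia.
Qed.

(** The tails are small uniformly in k because [delta] tends to 0; only finitely many binomial
    coefficients then have to be close to their limits. *)
Lemma log_approx_cvg z : adic_cvg t (fun k => log_approx (p ^ k) z) (ell z).
Proof.
move=> N; have [n0 n0P] := delta_null N.
have dn : adic_null t (fun n => delta n * z ^+ n) by exact: adic_nullMl.
have dn0 n : (n0 <= n)%N -> in_ideal (t ^+ N) (delta n * z ^+ n).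
  by move=> /n0P; apply: in_idealMr.
have /choice [f fP] i := bin_pred_cvg i N.
exists (maxn n0 (\max_(i < n0) f i)) => k; rewrite geq_max => /andP[n0k fk].
have kP : (n0.+1 <= p ^ k)%N.
  by apply: (leq_ltn_trans n0k); apply: ltn_expl; apply: prime_gt1.
have dn1 n : (n0.+1 <= n)%N -> in_ideal (t ^+ N) (delta n * z ^+ n).
  by move=> n0n; apply: dn0; apply: ltnW.
apply: in_ideal_trans (in_ideal_sym (adic_series_trunc E_complete dn1 dn)).
rewrite big_ord_recl /= delta0 mul0r add0r /log_approx.
pose F i := (-1) ^+ i * 'C((p ^ k).-1, i)%:R * delta i.+1 * z ^+ i.+1.
rewrite -(big_mkord xpredT F) (@big_cat_nat _ _ _ n0) //=; last exact: ltnW.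
rewrite big_mkord addrAC; apply: in_idealD; last first.
  rewrite big_nat; apply: in_ideal_sum => i _ /andP[n0i _].
  by rewrite /F -mulrA; apply: in_idealM; apply: dn1.
rewrite -sumrB; apply: in_ideal_sum => i _ _; rewrite /bump leq0n add1n /F.
have s2 : (-1) ^+ i * (-1) ^+ i = 1 :> E by rewrite -expr2 sqrr_sign.
rewrite (_ : _ - _ = (-1) ^+ i * delta i.+1 * z ^+ i.+1 * ('C((p ^ k).-1, i)%:R - (-1) ^+ i));
  last first.
  transitivity ((-1) ^+ i * 'C((p ^ k).-1, i)%:R * delta i.+1 * z ^+ i.+1 -
    ((-1) ^+ i * (-1) ^+ i) * (delta i.+1 * z ^+ i.+1)); last by ring.
  by rewrite s2 mul1r.
apply: in_idealM; apply: fP; apply: leq_trans fk.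
exact: (@leq_bigmax _ (fun i : 'I_n0 => f i)).
Qed.

(** Each p-th power gains one factor t: y^p - 1 is y - 1 times the sum of the y^i for i < p, and
    this sum is congruent to p, hence to 0, modulo t. *)
Lemma powX_cvg1 z : adic_cvg t (fun k => (1 + t ^+ m * z) ^+ (p ^ k)) 1.
Proof.
have H k : in_ideal (t ^+ k.+1) ((1 + t ^+ m * z) ^+ (p ^ k) - 1).
  elim: k => [|k IH].
    rewrite expn0 expr1 addrAC subrr add0r; apply: in_idealMr.
    by apply: in_ideal_le m_gt0 _; exists 1; rewrite mulr1.
  rewrite expnSr exprM; set y := (X in X ^+ p) in IH *.
  rewrite subrX1 -addn1; apply: in_ideal_mul => //.
  have -> : \sum_(i < p) y ^+ i = \sum_(i < p) (y ^+ i - 1 ^+ i) + p%:R.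
    rewrite sumrB -[X in _ = _ - X + _]/(\sum_(i < p) 1 ^+ i).
    under [X in _ - X]eq_bigr do rewrite expr1n.
    by rewrite sumr_const card_ord subrK.
  apply: in_idealD => //; apply: in_ideal_sum => i _ _.
  by apply: in_ideal_congX; apply: in_ideal_le IH.
move=> N; exists N => k Nk; apply: in_ideal_le (H k); exact: leqW.
Qed.

(** The approximations satisfy the same relation up to the factor (1 + t^m z')^P, which tends to 1
    along P = p^k. *)
Lemma ellD z z' z'' : 1 + t ^+ m * z'' = (1 + t ^+ m * z) * (1 + t ^+ m * z') ->
  ell z'' = ell z + ell z'.
Proof.
move=> zz; have [sep _] := E_complete.
have E1 P : log_approx P z'' = log_approx P z * (1 + t ^+ m * z') ^+ P + log_approx P z'.
  have [->|P0] := posnP P; first by rewrite /log_approx !big_ord0 mul0r addr0.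
  apply: (nat_reg P0); apply: (lregXt (n := l1)).
  have H x : t ^+ l1 * (P%:R * log_approx P x) = t ^+ l2 * ((1 + t ^+ m * x) ^+ P - 1).
    by rewrite log_approxE; ring.
  rewrite H zz exprMn; set X := _ ^+ P; set Y := _ ^+ P.
  transitivity (t ^+ l1 * (P%:R * log_approx P z) * Y
     + t ^+ l1 * (P%:R * log_approx P z')); last by ring.
  by rewrite !H -/X -/Y; ring.
apply: (adic_cvg_unique sep (log_approx_cvg z'')).
under [X in adic_cvg _ X]eq_fun do rewrite E1.
apply: adic_cvgD (log_approx_cvg z'); rewrite -[X in adic_cvg _ _ X]mulr1.
exact: adic_cvgM (log_approx_cvg z) (powX_cvg1 z').
Qed.

Lemma pwM z z' z'' : 1 + t ^+ m * z'' = (1 + t ^+ m * z) * (1 + t ^+ m * z') ->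
  pw z'' = pw z * pw z'.
Proof. by move=> /ellD; rewrite /pw => ->; rewrite pexpD. Qed.

End PowerSeries.

(** * Power series in infinitely many variables *)

Section PSeriesBasics.
Variables (I : choiceType) (R : comNzRingType).
Implicit Types (f g : pseries I R) (q : cmonom I).

Lemma ps_coefD f g q : (f + g) q = f q + g q. Proof. by []. Qed.
Lemma ps_coefB f g q : (f - g) q = f q - g q. Proof. by []. Qed.
Lemma ps_coef0 q : (0 : pseries I R) q = 0. Proof. by []. Qed.
Lemma ps_coef1 q : (1 : pseries I R) q = (q == onecm I)%:R. Proof. by []. Qed.
Lemma ps_coefZ c f q : (c *: f) q = c * f q. Proof. by []. Qed.

Lemma ps_coef_sum (X : Type) (r : seq X) (P : pred X) (F : X -> pseries I R) q :
  (\sum_(i <- r | P i) F i) q = \sum_(i <- r | P i) F i q.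
Proof. by elim/big_ind2: _ => // f a g b <- <-. Qed.

Definition splits q := fset_set (ps_splits q).

Lemma mem_splits q x : (x \in splits q) = (mulcm x.1 x.2 == q).
Proof.
rewrite in_fset_set; last exact: ps_splits_finite.
by apply/idP/eqP => [/set_mem|?]; [|apply/mem_set].
Qed.

Lemma ps_coefM f g q : (f * g) q = \sum_(x <- splits q) f x.1 * g x.2.
Proof.
by rewrite /splits -(fsbig_finite _ _ (ps_splits_finite q)).
Qed.

Definition ps_mon (a : cmonom I) : pseries I R := fun q => (q == a)%:R.

Lemma ps_monM a b : ps_mon (mulcm a b) = ps_mon a * ps_mon b.
Proof.
apply/funext => q; rewrite ps_coefM /ps_mon.
have [->|qab] := eqVneq q (mulcm a b); last first.
  rewrite big_seq big1 // => -[c d]; rewrite mem_splits /= => /eqP cd.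
  have [ca|] := eqVneq c a; last by rewrite mul0r.
  have [db|] := eqVneq d b; last by rewrite mulr0.
  by move: qab; rewrite -cd ca db eqxx.
rewrite (big_fsetD1 (a, b)) /=; last by rewrite mem_splits.
rewrite !eqxx mulr1 big_seq big1 ?addr0 // => -[c d]; rewrite in_fsetD1 mem_splits /=.
move=> /andP[ncd _]; have [ca|] := eqVneq c a; last by rewrite mul0r.
have [db|] := eqVneq d b; last by rewrite mulr0.
by rewrite ca db eqxx in ncd.
Qed.

Lemma ps_monX a n : ps_mon a ^+ n = ps_mon (iter n (mulcm a) (onecm I)).
Proof.
elim: n => [|n IH]; first by [].
by rewrite exprS IH; exact: (esym (ps_monM _ _)).
Qed.

Lemma iter_mulcmE (a : cmonom I) n i : iter n (mulcm a) (onecm I) i = (n * a i)%N.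
Proof.
elim: n => [|n IH]; first by rewrite onecmE.
by rewrite [LHS]mulcmE IH mulSn.
Qed.

Lemma ps_scalerA (c : R) f : c%:A * f = c *: f.
Proof. by rewrite -scalerAl mul1r. Qed.

Lemma ps_algX (c : R) n : (c%:A : pseries I R) ^+ n = (c ^+ n)%:A.
Proof. by rewrite exprZn expr1n. Qed.
End PSeriesBasics.

Section PSeriesAdic.
Variables (I : choiceType) (T : comNzRingType) (t : T).
Local Notation C := (pseries I T).
Local Notation tC := (t%:A : C).
Implicit Types (f g : C) (q : cmonom I).

Lemma ps_in_ideal N f : in_ideal (tC ^+ N) f <-> forall q, in_ideal (t ^+ N) (f q).
Proof.
split=> [[y ->] q|/choice [y yE]]; rewrite ps_algX.
  by exists (y q); rewrite ps_scalerA ps_coefZ.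
by exists y; apply/funext => q; rewrite ps_scalerA ps_coefZ -yE.
Qed.

Lemma ps_adic_complete : adic_complete t -> adic_complete tC.
Proof.
move=> [sep cplt]; split=> [f f0|u u0].
  by apply/funext => q; apply: sep => N; move/ps_in_ideal: (f0 N); apply.
have /choice [l lP] q : exists l, forall N, in_ideal (t ^+ N) (l - u N q).
  by apply: cplt => N; have /ps_in_ideal := u0 N; apply.
by exists l => N; apply/ps_in_ideal => q; apply: lP.
Qed.

Lemma ps_lreg (c : T) : GRing.lreg c -> GRing.lreg (c%:A : C).
Proof.
move=> c_reg f g; rewrite !ps_scalerA => fg; apply/funext => q; apply: c_reg.
by rewrite -!ps_coefZ fg.
Qed.

Lemma ps_in_ideal_alg N (c : T) : in_ideal (t ^+ N) c -> in_ideal (tC ^+ N) (c%:A).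
Proof. by move=> [y ->]; exists (y%:A); rewrite ps_algX ps_scalerA scalerA. Qed.

Lemma ps_adic_null (c : nat -> T) : adic_null t c -> adic_null tC (fun n => (c n)%:A).
Proof. by move=> c0 N; have [n0 n0P] := c0 N; exists n0 => n /n0P /ps_in_ideal_alg. Qed.

(* The ideals of C that define the topology of coefficientwise t-adic convergence. *)
Definition coef_ideal N q f :=
  forall q1 q2, mulcm q1 q2 = q -> in_ideal (t ^+ N) (f q1).

Lemma coef_ideal0 N q : coef_ideal N q 0.
Proof. by move=> q1 q2 _; exact: in_ideal0. Qed.

Lemma coef_idealD N q f g : coef_ideal N q f -> coef_ideal N q g -> coef_ideal N q (f + g).
Proof. by move=> fN gN q1 q2 q12; apply: in_idealD; [apply: fN q12|apply: gN q12]. Qed.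

Lemma coef_idealN N q f : coef_ideal N q f -> coef_ideal N q (- f).
Proof. by move=> fN q1 q2 q12; apply: in_idealN; apply: fN q12. Qed.

Lemma coef_idealB N q f g : coef_ideal N q f -> coef_ideal N q g -> coef_ideal N q (f - g).
Proof. by move=> fN /coef_idealN; apply: coef_idealD. Qed.

(** A coefficient of a product at a divisor of q involves only divisors of q; this is why
    [coef_ideal] looks at all of them and not at q alone. *)
Lemma coef_idealM N q f g : coef_ideal N q g -> coef_ideal N q (f * g).
Proof.
move=> gN q1 q2 q12; rewrite ps_coefM; apply: in_ideal_sum => -[a b].
rewrite mem_splits /= => /eqP ab _; apply: in_idealM.
by apply: (gN b (mulcm a q2)); rewrite mulcmA (mulcmC b) ab.
Qed.

Lemma coef_idealMr N q f g : coef_ideal N q f -> coef_ideal N q (f * g).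
Proof. by rewrite mulrC; apply: coef_idealM. Qed.

Lemma coef_ideal_sum N q (X : eqType) (r : seq X) (P : pred X) (F : X -> C) :
  (forall i, i \in r -> P i -> coef_ideal N q (F i)) ->
  coef_ideal N q (\sum_(i <- r | P i) F i).
Proof.
move=> tF; rewrite big_seq_cond; elim/big_ind: _ => [|x y|i /andP[]].
- exact: coef_ideal0.
- exact: coef_idealD.
exact: tF.
Qed.

Lemma in_coef_ideal N q f : in_ideal (tC ^+ N) f -> coef_ideal N q f.
Proof. by move=> /ps_in_ideal fN q1 _ _; apply: fN. Qed.

Lemma coef_ideal_self N q f : coef_ideal N q f -> in_ideal (t ^+ N) (f q).
Proof. by move=> /(_ q (onecm I)); apply; rewrite mulcm0. Qed.

(** Unconditional coefficientwise summability. Asking the terms outside [F0] to be small one by one,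
    instead of quantifying over larger finite sets, makes products and regroupings easy. *)
Definition usum (X : choiceType) (u : X -> C) (l : C) := forall N q,
  exists F0 : {fset X}, (forall x, x \notin F0 -> coef_ideal N q (u x)) /\
    coef_ideal N q (\sum_(x <- F0) u x - l).

Lemma coef_ideal_fsetS N q (X : choiceType) (u : X -> C) (F0 F : {fset X}) l :
  (F0 `<=` F)%fset -> (forall x, x \notin F0 -> coef_ideal N q (u x)) ->
  coef_ideal N q (\sum_(x <- F0) u x - l) -> coef_ideal N q (\sum_(x <- F) u x - l).
Proof.
move=> F0F out lim.
have -> : \sum_(x <- F) u x - l = (\sum_(x <- F0) u x - l) + \sum_(x <- (F `\` F0)%fset) u x.
  rewrite addrAC; congr (_ - l).
  rewrite -big_cat; apply: perm_big; apply: uniq_perm; rewrite ?fset_uniq //.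
    rewrite cat_uniq !fset_uniq andbT /=; apply/hasPn => x.
    by rewrite inE => /andP[].
  move=> x; rewrite mem_cat !inE; case: (boolP (x \in F0)) => //= xF0.
  exact: (fsubsetP F0F).
apply: coef_idealD => //; apply: coef_ideal_sum => x; rewrite inE => /andP[xF0 _] _.
exact: out.
Qed.

Lemma usum_adic_sum (X : choiceType) (u : X -> C) l q :
  usum u l -> adic_sum t (fun x => u x q) (l q).
Proof.
move=> ul N; have [F0 [out lim]] := ul N q; exists F0 => F F0F.
rewrite -ps_coef_sum -ps_coefB; apply: coef_ideal_self.
exact: coef_ideal_fsetS F0F out lim.
Qed.

Lemma usumMl (X : choiceType) (u : X -> C) l a : usum u l -> usum (fun x => a * u x) (a * l).
Proof.
move=> ul N q; have [F0 [out lim]] := ul N q; exists F0; split=> [x /out|].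
  exact: coef_idealM.
by rewrite -mulr_sumr -mulrBr; apply: coef_idealM.
Qed.

Lemma usumD (X : choiceType) (u v : X -> C) l l' :
  usum u l -> usum v l' -> usum (fun x => u x + v x) (l + l').
Proof.
move=> ul vl N q; have [F [oF lF]] := ul N q; have [G [oG lG]] := vl N q.
exists (F `|` G)%fset; split=> [x|].
  by rewrite inE negb_or => /andP[/oF ? /oG]; apply: coef_idealD.
rewrite big_split opprD addrACA; apply: coef_idealD.
  by apply: coef_ideal_fsetS oF lF; exact: fsubsetUl.
by apply: coef_ideal_fsetS oG lG; exact: fsubsetUr.
Qed.

Lemma usum_prod (X Y : choiceType) (u : X -> C) (v : Y -> C) l l' :
  usum u l -> usum v l' -> usum (fun x : X * Y => u x.1 * v x.2) (l * l').
Proof.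
move=> ul vl N q; have [F [oF lF]] := ul N q; have [G [oG lG]] := vl N q.
exists (F `*` G)%fset; split=> [[x y]|].
  rewrite in_fsetM negb_and /= => /orP[/oF|/oG]; first exact: coef_idealMr.
  exact: coef_idealM.
have -> : \sum_(x <- (F `*` G)%fset) u x.1 * v x.2 = (\sum_(x <- F) u x) * (\sum_(y <- G) v y).
  transitivity (\sum_(x <- [seq (x, y) | x <- F, y <- G]) u x.1 * v x.2).
    apply: perm_big; apply: uniq_perm; rewrite ?fset_uniq //.
      by apply: allpairs_uniq; rewrite ?fset_uniq // => -[a b] [c d] _ _ [-> ->].
    move=> [a b]; rewrite in_fsetM; apply/andP/allpairsP => [[aF bG]|[[c d] /= [cF dG [-> ->]]]//].
    by exists (a, b).
  rewrite big_allpairs mulr_suml; apply: eq_bigr => x _.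
  by rewrite mulr_sumr.
rewrite (_ : _ - _ = (\sum_(x <- F) u x - l) * (\sum_(y <- G) v y)
   + l * (\sum_(y <- G) v y - l')); last by ring.
by apply: coef_idealD; [apply: coef_idealMr|apply: coef_idealM].
Qed.

(** The fibres over the image of a good finite set F contain F, and their remaining terms are small
    individually. *)
Lemma usum_regroup (X Z : choiceType) (h : X -> Z) (fib : Z -> {fset X}) (u : X -> C) l :
  (forall x z, (x \in fib z) = (h x == z)) -> usum u l ->
  usum (fun z => \sum_(x <- fib z) u x) l.
Proof.
move=> fibE ul N q; have [F [oF lF]] := ul N q.
exists [fset h x | x in F]%fset; split=> [z zF|].
  apply: coef_ideal_sum => x; rewrite fibE => /eqP hx _; apply: oF.
  by apply/negP => xF; move/negP: zF; apply; apply/imfsetP; exists x.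
have -> : \sum_(z <- [fset h x | x in F]%fset) \sum_(x <- fib z) u x - l =
    \sum_(z <- [fset h x | x in F]%fset) \sum_(x <- fib z | x \notin F) u x
    + (\sum_(x <- F) u x - l).
  rewrite addrA -[X in _ = _ + X - _](_ : \sum_(z <- [fset h x | x in F]%fset)
      \sum_(x <- fib z | x \in F) u x = _).
    rewrite -big_split /=; congr (_ - _); apply: eq_bigr => z _.
    by rewrite addrC (bigID (fun x => x \in F)).
  have -> : \sum_(x <- F) u x =
      \sum_(x <- F) \sum_(z <- [fset h x | x in F]%fset | h x == z) u x.
    rewrite big_seq [RHS]big_seq; apply: eq_bigr => x xF.
    rewrite -big_filter (_ : [seq z <- _ | _] = [:: h x]); first by rewrite big_seq1.
    apply: perm_small_eq => //; apply: uniq_perm; rewrite ?filter_uniq ?fset_uniq // => z.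
    rewrite mem_filter mem_seq1; apply/andP/eqP => [[/eqP <-]//|->].
    have hxF : h x \in [fset h x | x in F]%fset by apply/imfsetP; exists x.
    by split=> //; apply: eqxx.
  rewrite [RHS](exchange_big_dep xpredT) //=; apply: eq_bigr => z _.
  rewrite -big_filter -[RHS]big_filter; apply: perm_big.
  apply: uniq_perm; rewrite ?filter_uniq ?fset_uniq // => x.
  by rewrite !mem_filter fibE andbC.
apply: coef_idealD => //; apply: coef_ideal_sum => z _ _.
by apply: coef_ideal_sum => x _ xF; apply: oF.
Qed.
End PSeriesAdic.

(** * Continuous substitution in power series *)

Section Substitution.
Variables (I : choiceType) (T : comNzRingType) (t : T).
Local Notation C := (pseries I T).
Local Notation tC := (t%:A : C).
Variable mon : cmonom I -> C.
Hypothesis mon1 : mon (onecm I) = 1.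
Hypothesis monM : forall a b, mon (mulcm a b) = mon a * mon b.
Implicit Types (f g : C) (q : cmonom I).

(* [g] is the value at [f] of the continuous substitution [q |-> mon q]; the
   substitution is defined only on those [f] for which the sum converges. *)
Definition subst_to f g := usum t (fun q => f q *: mon q) g.

Lemma eq_usum (X : choiceType) (u v : X -> C) l : (forall x, u x = v x) ->
  usum t u l -> usum t v l.
Proof. by move=> /funext ->. Qed.

Lemma subst_to1 : subst_to 1 1.
Proof.
move=> N q; exists [fset onecm I]%fset; split=> [x|].
  rewrite inE => /negbTE x1; rewrite ps_coef1 x1 scale0r; exact: coef_ideal0.
rewrite big_seq_fset1 ps_coef1 eqxx scale1r mon1 subrr; exact: coef_ideal0.
Qed.

Lemma subst_toD f g f' g' : subst_to f g -> subst_to f' g' -> subst_to (f + f') (g + g').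
Proof.
move=> fg fg'; apply: eq_usum (usumD fg fg') => q.
by rewrite ps_coefD scalerDl.
Qed.

Lemma subst_toZ c f g : subst_to f g -> subst_to (c *: f) (c *: g).
Proof.
move=> fg; have := usumMl c%:A fg; rewrite ps_scalerA; apply: eq_usum => q.
by rewrite ps_scalerA ps_coefZ scalerA.
Qed.

(** The product family indexed by pairs of exponents is summable; grouping it along [mulcm], whose
    fibres are the finite sets [splits q], gives the Cauchy product. *)
Lemma subst_toM f g f' g' : subst_to f g -> subst_to f' g' -> subst_to (f * f') (g * g').
Proof.
move=> fg fg'; have H := usum_prod fg fg'.
have := @usum_regroup _ _ _ _ _ (fun x => mulcm x.1 x.2) (@splits I) _ _ (fun x z => mem_splits z x) H.
apply: eq_usum => q; rewrite ps_coefM scaler_suml.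
rewrite big_seq [RHS]big_seq; apply: eq_bigr => x; rewrite mem_splits => /eqP <-.
by rewrite monM -scalerAl -scalerAr scalerA.
Qed.

Lemma subst_toX n f g : subst_to f g -> subst_to (f ^+ n) (g ^+ n).
Proof.
move=> fg; elim: n => [|n IH]; first exact: subst_to1.
by rewrite !exprS; apply: subst_toM.
Qed.

Lemma subst_to_prod (X : Type) (r : seq X) (F G : X -> C) :
  (forall i, subst_to (F i) (G i)) -> subst_to (\prod_(i <- r) F i) (\prod_(i <- r) G i).
Proof.
move=> FG; elim/big_ind2: _ => //; first exact: subst_to1.
by move=> ? ? ? ?; apply: subst_toM.
Qed.

Lemma subst_to_sum (X : Type) (r : seq X) (F G : X -> C) :
  (forall i, subst_to (F i) (G i)) -> subst_to (\sum_(i <- r) F i) (\sum_(i <- r) G i).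
Proof.
move=> FG; elim/big_ind2: _ => //.
  by have := subst_toZ 0 subst_to1; rewrite !scale0r.
by move=> ? ? ? ?; apply: subst_toD.
Qed.

(** Convergence for [tC] is uniform in the coefficients, so replacing [u n] by f changes every term
    by a multiple of t^N and the finite set found for [u n] still works. *)
Lemma subst_to_cvg (u v : nat -> C) f g : adic_cvg tC u f -> adic_cvg tC v g ->
  (forall n, subst_to (u n) (v n)) -> subst_to f g.
Proof.
move=> uf vg uv N q; have [n0 n0P] := uf N; have [n1 n1P] := vg N.
pose n := maxn n0 n1; have un := n0P n (leq_maxl _ _); have vn := n1P n (leq_maxr _ _).
have cong x : coef_ideal t N q ((u n - f) x *: mon x).
  rewrite -ps_scalerA; apply: coef_idealMr; apply: in_coef_ideal.
  by apply: ps_in_ideal_alg; have /ps_in_ideal := un; apply.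
have [F [oF lF]] := uv n N q; exists F; split=> [x /oF|].
  have -> : f x *: mon x = u n x *: mon x - (u n - f) x *: mon x.
    by rewrite -scalerBl ps_coefB subKr.
  by move=> ux; apply: coef_idealB.
have -> : \sum_(x <- F) f x *: mon x - g = (\sum_(x <- F) u n x *: mon x - v n)
   + (v n - g) - \sum_(x <- F) (u n - f) x *: mon x.
  rewrite addrA subrK addrAC -sumrB; congr (_ - g); apply: eq_bigr => x _.
  by rewrite -scalerBl ps_coefB subKr.
apply: coef_idealB; last by apply: coef_ideal_sum.
by apply: coef_idealD => //; apply: in_coef_ideal.
Qed.

Lemma subst_to_series (c : nat -> T) f g : adic_complete t -> adic_null t c ->
  subst_to f g ->
  subst_to (adic_series tC (fun n => (c n)%:A * f ^+ n))
           (adic_series tC (fun n => (c n)%:A * g ^+ n)).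
Proof.
move=> cplt c0 fg; have Ccplt := ps_adic_complete I cplt.
have cC := ps_adic_null I c0.
apply: (subst_to_cvg (adic_seriesP Ccplt (adic_nullMl _ cC)) (adic_seriesP Ccplt (adic_nullMl _ cC))).
move=> n; apply: subst_to_sum => i; rewrite !ps_scalerA.
by apply: subst_toZ; apply: subst_toX.
Qed.

(** Division by t^m costs m digits, so the summation is read at precision m + N. It serves to pass
    from 1 + t^m z to z. *)
Lemma subst_to_div c m f g : GRing.lreg t -> c = t ^+ m ->
  subst_to (c *: f) (c *: g) -> subst_to f g.
Proof.
move=> t_reg -> fg N q; have [F [oF lF]] := fg (m + N)%N q.
have div h : coef_ideal t (m + N)%N q (t ^+ m *: h) -> coef_ideal t N q h.
  move=> H q1 q2 /H [y]; rewrite ps_coefZ exprD -mulrA => /(lregX t_reg) ->.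
  by exists y.
exists F; split=> [x /oF|]; first by rewrite ps_coefZ -scalerA => /div.
apply: div; move: lF; rewrite scalerBr scaler_sumr.
by under eq_bigr do rewrite ps_coefZ -scalerA.
Qed.
End Substitution.

Section Monomials.
Variables (I : choiceType) (C : comNzRingType).

Definition mon_eval (y : I -> C) (q : cmonom I) : C := \prod_(i <- finsupp q) y i ^+ q i.

Lemma mon_evalE y (q : cmonom I) (F : {fset I}) : (finsupp q `<=` F)%fset ->
  mon_eval y q = \prod_(i <- F) y i ^+ q i.
Proof.
move=> qF; apply: (big_fset_incl _ qF) => i _ iq.
by rewrite fsfun_dflt.
Qed.

Lemma mon_eval1 y : mon_eval y (onecm I) = 1.
Proof.
rewrite /mon_eval big_seq big1 // => i.
by rewrite mem_finsupp onecmE eqxx.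
Qed.

Lemma mon_evalU y i : mon_eval y (ucm i) = y i.
Proof.
rewrite (@mon_evalE _ _ [fset i]%fset) ?big_seq_fset1 ?ucmE ?eqxx ?expr1 //.
by apply/fsubsetP => j; rewrite mem_finsupp ucmE inE; case: (eqVneq i j).
Qed.

Lemma mon_evalM y a b : mon_eval y (mulcm a b) = mon_eval y a * mon_eval y b.
Proof.
pose F := (finsupp a `|` finsupp b)%fset.
rewrite (@mon_evalE _ (mulcm a b) F); last first.
  by apply/fsubsetP => i; rewrite inE !mem_finsupp mulcmE addn_eq0 negb_and.
rewrite (@mon_evalE _ a F) ?fsubsetUl // (@mon_evalE _ b F) ?fsubsetUr // -big_split.
by apply: eq_bigr => i _; rewrite mulcmE exprD.
Qed.

Lemma mon_eval_scale (y : I -> C) c q :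
  mon_eval (fun i => y i * c) q = mon_eval y q * c ^+ mdeg q.
Proof.
rewrite /mon_eval mdegE; elim/big_rec3: _ => [|i u v w _ ->]; first by rewrite expr0 mulr1.
by rewrite exprMn exprD mulrACA.
Qed.
End Monomials.

Section USumCoef.
Variables (I : choiceType) (T : comNzRingType) (t : T).
Local Notation C := (pseries I T).

(** An exponent q has finitely many divisors, so the finite sets found for them can be united.
    Comparing the sums over F and over F with x added shows that the term at x is small. *)
Lemma usum_coef (X : choiceType) (u : X -> C) l :
  (forall q, adic_sum t (fun x => u x q) (l q)) -> usum t u l.
Proof.
move=> ul N q.
have H q' : exists F : {fset X}, (forall x, x \notin F -> in_ideal (t ^+ N) (u x q')) /\
    forall G : {fset X}, (F `<=` G)%fset -> in_ideal (t ^+ N) ((\sum_(x <- G) u x - l) q').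
  have [F FP] := ul q' N; exists F; split=> [x xF|G /FP]; last first.
    by rewrite -ps_coef_sum.
  have := in_idealB (FP (x |` F)%fset (fsubsetUr _ _)) (FP F (fsubset_refl _)).
  by rewrite big_fsetU1 //= opprB addrA subrK addrK.
have /choice [F FP] := H.
pose G := (\bigcup_(x <- splits q) F x.1)%fset.
have FG q1 q2 : mulcm q1 q2 = q -> (F q1 `<=` G)%fset.
  by move=> q12; apply: (bigfcup_sup (j := (q1, q2))); rewrite ?mem_splits //= q12.
exists G; split=> [x xG|] q1 q2 /FG q1G.
  by have [out _] := FP q1; apply: out; apply: contra xG; apply: (fsubsetP q1G).
by have [_ lim] := FP q1; apply: lim.
Qed.

Lemma usum_reindex (X Z : choiceType) (h : X -> Z) (u : X -> C) (v : Z -> C) l :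
  injective h -> (forall x, v (h x) = u x) -> (forall z, (forall x, z <> h x) -> v z = 0) ->
  usum t u l -> usum t v l.
Proof.
move=> h_inj vh v0 ul N q; have [F [oF lF]] := ul N q.
exists [fset h x | x in F]%fset; split=> [z zF|].
  have [[x zx]|no] := pselect (exists x, z = h x); last first.
    rewrite v0; first exact: coef_ideal0.
    by move=> x zx; apply: no; exists x.
  rewrite zx vh; apply: oF; apply: contra zF => xF.
  by rewrite zx; apply/imfsetP; exists x.
rewrite big_imfset /=; last by move=> ? ? _ _ /h_inj.
by under eq_bigr do rewrite vh.
Qed.
End USumCoef.

Section Lambda.
Variables (T : comNzRingType) (t : T) (I : choiceType) (i0 : I).
Local Notation J1 := (complement1 i0).
Local Notation C := (pseries J1 T).
Local Notation lam := (lambda (idfun : {rmorphism T -> T}) i0).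

(** Identifies I with the exponents of degree at most 1, the index i0 corresponding to the constant
    term; these are the only exponents carrying coefficients of [lambda]. *)
Definition emb (i : I) : cmonom J1 :=
  if insub i is Some j then ucm (j : J1) else onecm J1.

Lemma emb0 : emb i0 = onecm J1.
Proof. by rewrite /emb insubF // eqxx. Qed.

Lemma emb_val (j : J1) : emb (val j) = ucm j.
Proof. by rewrite /emb valK. Qed.

Lemma ucm_neq1 (X : choiceType) (j : X) : (ucm j == onecm X) = false.
Proof. by apply/cmP => /(_ j); rewrite ucmE onecmE eqxx. Qed.

Lemma ucm_inj (X : choiceType) : injective (@ucm X).
Proof. by move=> i j /eqP/cmP/(_ i); rewrite !ucmE eqxx; case: eqP. Qed.

Lemma embP i : (i = i0) + {j : J1 | i = val j}.
Proof.
have [->|ii0] := eqVneq i i0; first by left.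
by right; exists (exist _ i ii0).
Qed.

Lemma emb_inj : injective emb.
Proof.
move=> i i'; have [->|[j ->]] := embP i; have [->|[j' ->]] := embP i' => //.
- by rewrite emb0 emb_val => /esym/eqP; rewrite ucm_neq1.
- by rewrite emb0 emb_val => /eqP; rewrite ucm_neq1.
by rewrite !emb_val => /ucm_inj ->.
Qed.

Lemma finsupp_ucm (X : choiceType) (j : X) : finsupp (ucm j) = [fset j]%fset.
Proof.
by apply/fsetP => l; rewrite mem_finsupp ucmE inE; case: (eqVneq j l).
Qed.

Lemma lam_emb a i : lam a (emb i) = a i.
Proof.
have [->|[j ->]] := embP i.
  rewrite emb0 /lambda eqxx /= big1 ?addr0 // => j.
  by rewrite eq_sym ucm_neq1.
rewrite emb_val /lambda ucm_neq1 add0r finsupp_ucm.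
by rewrite big_mkcond big_seq_fset1 eqxx.
Qed.

Lemma lam_out a q : (forall i, q <> emb i) -> lam a q = 0.
Proof.
move=> qN; rewrite /lambda ifF; last by apply/eqP; rewrite -emb0; apply: qN.
by rewrite add0r big1 // => j /eqP; rewrite -emb_val => /qN.
Qed.

Lemma lamP a b (f : T -> T) : f 0 = 0 -> (forall i, b i = f (a i)) ->
  forall q, lam b q = f (lam a q).
Proof.
move=> f0 ab q; have [[i ->]|no] := pselect (exists i, q = emb i).
  by rewrite !lam_emb.
by rewrite !lam_out ?f0 // => i qi; apply: no; exists i.
Qed.

(** XY = Z says that z_j is the sum of the Y_kj x_k. Multiplied by w = 1 / x_0 this becomes the
    value at y_j of i |-> x_i / x_0, the index i0 giving x_0 / x_0 = 1. *)
Lemma subst_to_lam (X Y Z : imatrix I I T) (w : C) j :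
  lam (X^~ i0) * w = 1 -> is_mx_product t X Y Z ->
  subst_to t (mon_eval (fun i : J1 => lam (X^~ (val i)) * w)) (lam (Y^~ j)) (lam (Z^~ j) * w).
Proof.
move=> xw XYZ.
have H : usum t (fun k => Y k j *: lam (X^~ k)) (lam (Z^~ j)).
  apply: usum_coef => q; have [[i ->]|no] := pselect (exists i, q = emb i).
    rewrite lam_emb => N; have [F FP] := XYZ i j N; exists F => G /FP.
    by under eq_bigr do rewrite mulrC; under [in X in _ -> X]eq_bigr do rewrite ps_coefZ lam_emb.
  move=> N; exists fset0 => G _; rewrite lam_out ?subr0; last by move=> i qi; apply: no; exists i.
  rewrite big1 => [|k _]; first exact: in_ideal0.
  by rewrite ps_coefZ lam_out ?mulr0 // => i qi; apply: no; exists i.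
have := usumMl w H; rewrite mulrC; apply: usum_reindex emb_inj _ _ => [k|q qN].
  rewrite lam_emb -scalerAr mulrC; congr (_ *: _).
  have [->|[l ->]] := embP k; first by rewrite emb0 mon_eval1.
  by rewrite emb_val mon_evalU.
by rewrite lam_out // scale0r.
Qed.
End Lambda.

(** * Functoriality of the matrices B^r *)

Lemma adic_null_geom (E : comNzRingType) (t : E) m : (0 < m)%N ->
  adic_null t (fun n => (- t ^+ m) ^+ n).
Proof.
move=> m0 N; exists N => n Nn; rewrite exprNn -exprM; apply: in_idealM.
apply: (@in_ideal_le _ _ _ (m * n)); first by apply: leq_trans Nn _; rewrite leq_pmull.
by exists 1; rewrite mulr1.
Qed.

Lemma geometric_series (E : comNzRingType) (t z : E) m : adic_complete t -> (0 < m)%N ->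
  (1 + t ^+ m * z) * adic_series t (fun n => (- t ^+ m) ^+ n * z ^+ n) = 1.
Proof.
move=> cplt m0; have c0 := adic_null_geom t m0; have [sep _] := cplt.
have := adic_cvgM (adic_cvg_cst t (1 + t ^+ m * z)) (adic_seriesP cplt (adic_nullMl (fun n => z ^+ n) c0)).
move=> /(adic_cvg_unique sep); apply => N; have [n0 n0P] := c0 N; exists n0 => n /n0P H.
rewrite (eq_bigr (fun i : 'I_n => (- t ^+ m * z) ^+ i)) => [|i _]; last by rewrite exprMn.
have := subrX1 (- t ^+ m * z) n; set S := \sum_(i < n) _ => E1.
have -> : (1 + t ^+ m * z) * S = 1 - (- t ^+ m * z) ^+ n.
  by rewrite -[X in 1 - X](subrK 1) E1; ring.
by rewrite addrAC subrr add0r; apply: in_idealN; rewrite exprMn; apply: in_idealMr.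
Qed.

Lemma mulr_shuffle (S : comNzRingType) (a b c d e f g : S) :
  a * b * (c * d * (e * f) * g) = a * c * (b * d) * e * (f * g).
Proof. by ring. Qed.

Section Functoriality.
Variables (T : comNzRingType) (t : T).
Hypothesis t_reg : GRing.lreg t.
Hypothesis T_complete : adic_complete t.
Variable p : nat.
Hypothesis p_prime : prime p.
Hypothesis p_t : in_ideal t (p%:R : T).
Hypothesis nat_reg : forall n, (0 < n)%N -> GRing.lreg (n%:R : T).
Variables (m l1 l2 : nat) (delta gamma : nat -> T).
Hypothesis m_gt0 : (0 < m)%N.
Hypothesis delta0 : delta 0 = 0.
Hypothesis deltaE : forall n, (0 < n)%N ->
  n%:R * t ^+ l1 * delta n = (-1) ^+ n.+1 * t ^+ (m * n + l2).
Hypothesis delta_null : adic_null t delta.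
Hypothesis gamma0 : gamma 0 = 1.
Hypothesis gammaM : forall i j, gamma i * gamma j = 'C(i + j, i)%:R * gamma (i + j).
Hypothesis gamma_null : adic_null t gamma.
Variables (I : choiceType) (i0 : I).
Local Notation J1 := (complement1 i0).
Local Notation C := (pseries J1 T).
Local Notation tC := (t%:A : C).
Local Notation lam := (lambda (idfun : {rmorphism T -> T}) i0).

Let C_complete : adic_complete tC := ps_adic_complete J1 T_complete.

Definition pwC (z : C) : C :=
  pw tC (fun n => (delta n)%:A) (fun n => (gamma n)%:A) z.

Lemma natr_alg n : (n%:R : C) = (n%:R : T)%:A.
Proof. by rewrite scaler_nat. Qed.

Lemma scaletX n (x : C) : t ^+ n *: x = tC ^+ n * x.
Proof. by rewrite ps_algX ps_scalerA. Qed.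

Lemma pwCM z z' z'' : 1 + t ^+ m *: z'' = (1 + t ^+ m *: z) * (1 + t ^+ m *: z') ->
  pwC z'' = pwC z * pwC z'.
Proof.
rewrite !scaletX; apply: (@pwM _ _ _ _ p _ _ _ m l1 l2) => //.
- exact: ps_lreg.
- by have [y pE] := p_t; exists y%:A; rewrite natr_alg pE ps_scalerA scalerA.
- by move=> n n0; rewrite natr_alg; apply: ps_lreg; apply: nat_reg.
- by rewrite delta0 scale0r.
- move=> n n0; have := congr1 (in_alg C) (deltaE n0).
  by rewrite !rmorphM !rmorphXn rmorphN1 rmorph_nat.
- exact: ps_adic_null.
- by move=> i j; rewrite natr_alg !ps_scalerA !scalerA gammaM.
exact: ps_adic_null.
Qed.

Lemma pwC0 : pwC 0 = 1.
Proof. by apply: pw0 => //; rewrite ?delta0 ?gamma0 ?scale0r ?scale1r. Qed.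

Section Subst.
Variable mon : cmonom J1 -> C.
Hypothesis mon1 : mon (onecm J1) = 1.
Hypothesis monM : forall a b, mon (mulcm a b) = mon a * mon b.
Local Notation sub := (subst_to t mon).

Lemma subst_to_pw z z' : sub z z' -> sub (pwC z) (pwC z').
Proof. by move=> zz; do 2!apply: subst_to_series => //. Qed.

(** The inverse is a geometric series, and substitution passes through series. *)
Lemma subst_to_inv z z' : sub z z' -> sub (1 + t ^+ m *: z)^-1 (1 + t ^+ m *: z')^-1.
Proof.
have H x : (1 + t ^+ m *: x)^-1 = adic_series tC (fun n => ((- t ^+ m) ^+ n)%:A * x ^+ n).
  apply: mulr1_eq; rewrite scaletX.
  rewrite -[RHS](geometric_series x C_complete m_gt0); congr (_ * adic_series _ _).
  apply/funext => n; rewrite -[LHS]/(((- t ^+ m) ^+ n)%:A * x ^+ n).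
  by rewrite ps_algX -scaleNr ps_algX.
by move=> zz; rewrite !H; apply: subst_to_series => //; apply: adic_null_geom.
Qed.
End Subst.

(** W stands for x_0^V. It is left free because for a column with constant c it has to be (x_0 /
    c)^V. *)
Definition bcol (W : C) (X : imatrix I I T) (r : int) (q : cmonom J1) : C :=
  W * lam (X^~ i0) ^ r * (\prod_(i <- finsupp q) lam (X^~ (val i)) ^+ q i)
    / lam (X^~ i0) ^+ mdeg q.

Definition bmat W X r : imatrix (cmonom J1) (cmonom J1) T := fun q1 q2 => bcol W X r q2 q1.

Lemma bcolE W X r q : bcol W X r q =
  W * lam (X^~ i0) ^ r *
    mon_eval (fun i : J1 => lam (X^~ (val i)) * (lam (X^~ i0))^-1) q.
Proof. by rewrite mon_eval_scale exprVn mulrA. Qed.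

Definition normalized (X : imatrix I I T) (c : T) (z : C) :=
  (exists c', c * c' = 1) /\ lam (X^~ i0) = c *: (1 + t ^+ m *: z).

Lemma one_plus_unit (z : C) : 1 + t ^+ m *: z \is a GRing.unit.
Proof.
apply/unitrPr; exists (adic_series tC (fun n => (- tC ^+ m) ^+ n * z ^+ n)).
by rewrite scaletX; apply: geometric_series.
Qed.

Lemma alg_unit (c : T) : (exists c', c * c' = 1) -> (c%:A : C) \is a GRing.unit.
Proof.
move=> [c' cc']; apply/unitrPr; exists c'%:A.
by rewrite ps_scalerA scalerA cc' scale1r.
Qed.

Lemma normalized_unit X c z : normalized X c z -> lam (X^~ i0) \is a GRing.unit.
Proof.
move=> [cU ->]; rewrite -(ps_scalerA c) unitrM one_plus_unit andbT.
exact: alg_unit.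
Qed.

(** The substitution attached to X carries each factor of the column q3 of Y to the factor formed
    with z_i / x_0. Multiplying the resulting sum by (x_0 / c)^V x_0^r turns its terms into the
    columns of X ([bcolE]) and its value into the column q3 of Z. *)
Theorem bmatM X Y Z c d zX zY zZ r : is_mx_product t X Y Z ->
  normalized X c zX -> normalized Y d zY -> normalized Z (c * d) zZ ->
  is_mx_product t (bmat (pwC zX) X r) (bmat (pwC zY) Y r) (bmat (pwC zZ) Z r).
Proof.
move=> XYZ nX nY nZ q1 q3.
have xU := normalized_unit nX; have yU := normalized_unit nY; have zU := normalized_unit nZ.
set x0 := lam (X^~ i0) in xU; set y0 := lam (Y^~ i0) in yU; set z0 := lam (Z^~ i0) in zU.
pose mon := mon_eval (fun i : J1 => lam (X^~ (val i)) * x0^-1).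
have mon1 : mon (onecm J1) = 1 := mon_eval1 _.
have monM a b : mon (mulcm a b) = mon a * mon b := mon_evalM _ a b.
have subY j : subst_to t mon (lam (Y^~ j)) (lam (Z^~ j) * x0^-1).
  by apply: subst_to_lam XYZ; rewrite mulrV.
have [[c' cc'] xE] := nX; have [[d' dd'] yE] := nY; have [_ zE] := nZ.
(* Chosen so that z_0 / x_0 = d (1 + t^m z'); the constants c, d and c d of X, Y and Z drop out
   here. *)
pose z' := (zZ - zX) * (1 + t ^+ m *: zX)^-1.
have z'E : 1 + t ^+ m *: zZ = (1 + t ^+ m *: zX) * (1 + t ^+ m *: z').
  rewrite mulrDr mulr1 -scalerAr /z' mulrCA divrr ?one_plus_unit // mulr1.
  by rewrite scalerBr -addrA (addrC (t ^+ m *: zX)) subrK.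
have y'E : z0 * x0^-1 = d *: (1 + t ^+ m *: z').
  apply: (mulrI xU); rewrite mulrCA divrr // mulr1 /z0 zE z'E /x0 xE.
  by rewrite -scalerAl -scalerAr scalerA.
(* y_0 goes to z_0 / x_0; removing the constant d, the 1 and the factor t^m gives the image of [zY]
   itself, to which log and exp apply. *)
have subz : subst_to t mon zY z'.
  apply: (subst_to_div (c := t ^+ m) (m := m) t_reg) => //.
  have := subst_toZ d' (subY i0); rewrite -/y0 -/z0 y'E /y0 yE !scalerA mulrC dd' !scale1r.
  move=> H; have := subst_toD H (subst_toZ (-1) (subst_to1 t mon1)).
  by rewrite !scaleN1r !(addrC 1) !addrK.
have sub_inv : subst_to t mon y0^-1 (z0 * x0^-1)^-1.
  have invE (w : C) : (d *: (1 + t ^+ m *: w))^-1 = d' *: (1 + t ^+ m *: w)^-1.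
    apply: mulr1_eq; rewrite -scalerAl -scalerAr scalerA dd' scale1r.
    by rewrite divrr ?one_plus_unit.
  rewrite y'E /y0 yE !invE; apply: subst_toZ.
  have H := subst_to_inv mon1 monM; exact: H subz.
have sub_exp : subst_to t mon (y0 ^ r) ((z0 * x0^-1) ^ r).
  case: r => n; first exact: (subst_toX mon1 monM _ (subY i0)).
  by rewrite !NegzE -!exprnN -!exprVn; apply: (subst_toX mon1 monM).
have sub_mon : subst_to t mon
    (\prod_(i <- finsupp q3) lam (Y^~ (val i)) ^+ q3 i)
    (\prod_(i <- finsupp q3) (lam (Z^~ (val i)) * x0^-1) ^+ q3 i).
  by apply: (subst_to_prod mon1 monM) => i; apply: (subst_toX mon1 monM).
have sub_deg : subst_to t mon (y0 ^+ mdeg q3)^-1 ((z0 * x0^-1) ^+ mdeg q3)^-1.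
  by rewrite -!exprVn; apply: (subst_toX mon1 monM).
have := subst_toM monM (subst_toM monM (subst_toM monM (subst_to_pw mon1 monM subz) sub_exp) sub_mon) sub_deg.
rewrite -/(bcol (pwC zY) Y r q3) => H.
have := usum_adic_sum q1 (usumMl (pwC zX * x0 ^ r) H).
rewrite /bmat; congr adic_sum.
  by apply/funext => q; rewrite -scalerAr ps_coefZ -bcolE mulrC.
congr (_ q1); rewrite /bcol -/z0.
rewrite (pwCM z'E).
have -> : z0 ^ r = x0 ^ r * (z0 * x0^-1) ^ r.
  rewrite -exprMz_comm ?unitrM ?unitrV ?xU ?zU //; last exact: mulrC.
  by rewrite mulrCA divrr // mulr1.
have -> : \prod_(i <- finsupp q3) (lam (Z^~ (val i)) * x0^-1) ^+ q3 i =
   (\prod_(i <- finsupp q3) lam (Z^~ (val i)) ^+ q3 i) * x0^-1 ^+ mdeg q3.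
  exact: mon_eval_scale.
have -> : (z0 ^+ mdeg q3)^-1 = x0^-1 ^+ mdeg q3 * ((z0 * x0^-1) ^+ mdeg q3)^-1.
  by rewrite -!exprVn -exprMn invrM ?unitrV // invrK mulrA mulVr // mul1r.
exact: (@mulr_shuffle C).
Qed.
End Functoriality.

Section PSMap.
Variables (I : choiceType) (T S : comNzRingType) (s : {rmorphism T -> S}).
Local Notation psm := (@ps_map I T S s).

Fact ps_map_zmod : zmod_morphism psm.
Proof. by move=> f g; apply/funext => q; rewrite ps_coefB /ps_map ps_coefB rmorphB. Qed.

Fact ps_map_monoid : monoid_morphism psm.
Proof.
split=> [|f g]; apply/funext => q; rewrite /ps_map.
  by rewrite !ps_coef1 rmorph_nat.
rewrite !ps_coefM rmorph_sum; apply: eq_bigr => x _; exact: rmorphM.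
Qed.

HB.instance Definition _ := GRing.isZmodMorphism.Build _ _ psm ps_map_zmod.
HB.instance Definition _ := GRing.isMonoidMorphism.Build _ _ psm ps_map_monoid.

Lemma ps_mapZ c f : psm (c *: f) = s c *: psm f.
Proof. by apply/funext => q; rewrite /ps_map !ps_coefZ rmorphM. Qed.

Lemma ps_map_alg c : psm c%:A = (s c)%:A.
Proof. by rewrite ps_mapZ rmorph1. Qed.
End PSMap.

Section SigmaMatrix.
Variables (T : comNzRingType) (t : T) (s : {rmorphism T -> T}).
Hypothesis st : s t = t.
Hypothesis T_complete : adic_complete t.
Variables (delta gamma : nat -> T).
Hypothesis delta_null : adic_null t delta.
Hypothesis gamma_null : adic_null t gamma.
Hypothesis s_delta : forall n, s (delta n) = delta n.
Hypothesis s_gamma : forall n, s (gamma n) = gamma n.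
Variables (I : choiceType) (i0 : I).
Local Notation J1 := (complement1 i0).
Local Notation C := (pseries J1 T).
Local Notation lam := (lambda (idfun : {rmorphism T -> T}) i0).

(** s fixes t, hence is continuous, and it fixes the coefficients of both series. *)
Lemma ps_map_pw (z : C) : ps_map s (pwC t delta gamma z) = pwC t delta gamma (ps_map s z).
Proof.
have sC : ps_map s (t%:A : C) = t%:A by rewrite ps_map_alg st.
have Ccplt := ps_adic_complete J1 T_complete.
have series (c : nat -> T) f : adic_null t c -> (forall n, s (c n) = c n) ->
    ps_map s (adic_series (t%:A : C) (fun n => (c n)%:A * f ^+ n)) =
    adic_series (t%:A : C) (fun n => (c n)%:A * ps_map s f ^+ n).
  move=> c0 sc.
  have H := adic_series_morph (s := ps_map s : {rmorphism C -> C}) sC Ccplt Ccplt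
     (adic_nullMl _ (ps_adic_null J1 c0)).
  rewrite [LHS]H; congr adic_series; apply/funext => n.
  by rewrite /= rmorphM rmorphXn /= ps_map_alg sc.
have E : ps_map s (ell (t%:A : C) (fun n => (delta n)%:A) z) =
    ell (t%:A : C) (fun n => (delta n)%:A) (ps_map s z) by exact: series.
by rewrite /pwC /pw -E; apply: series.
Qed.

Lemma ps_map_lam a : ps_map s (lam a) = lam (s \o a).
Proof.
by apply/funext => q; rewrite /ps_map; apply/esym/lamP => //; exact: rmorph0.
Qed.

Lemma mx_map_bmat (W : C) (X : imatrix I I T) r : lam (X^~ i0) \is a GRing.unit ->
  mx_map s (bmat W X r) = bmat (ps_map s W) (mx_map s X) r.
Proof.
move=> xU; apply/funext => q1; apply/funext => q2.
rewrite /bmat -[LHS]/(ps_map s (bcol W X r q2) q1) /bcol; congr (_ q1).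
have E i : lam ((mx_map s X)^~ i) = ps_map s (lam (X^~ i)).
  by rewrite ps_map_lam.
rewrite !rmorphM rmorphV ?unitrX // rmorphXn rmorphXz // rmorph_prod /= E.
rewrite (eq_bigr (fun i : J1 => lam ((mx_map s X)^~ (val i)) ^+ q2 i)) // => i _.
by rewrite E; exact: rmorphXn.
Qed.

(** The columns of the identity are 1 and the variables, so the attached substitution is the
    identity and column q is the monomial q. *)
Lemma bmat_identity r : bmat (1 : C) (@mx_identity T I) r = @mx_identity T (cmonom J1).
Proof.
have lamE i : lam ((@mx_identity T I)^~ i) = fun q => (q == emb i0 i)%:R.
  apply/funext => q; have [[i' ->]|no] := pselect (exists i', q = emb i0 i').
    by rewrite lam_emb (inj_eq (@emb_inj _ i0)).
  rewrite lam_out => [|i' qi]; last by apply: no; exists i'.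
  by case: eqP => // qi; case: no; exists i.
have lam1 : lam ((@mx_identity T I)^~ i0) = 1 by rewrite lamE emb0.
apply/funext => q1; apply/funext => q2; rewrite /bmat bcolE lam1 exp1rz !mul1r.
have -> : mon_eval (fun i : J1 => lam ((@mx_identity T I)^~ (val i)) * 1^-1) q2 = ps_mon T q2; last by [].
rewrite [in RHS](_ : q2 = \big[@mulcm J1/onecm J1]_(i <- finsupp q2)
    iter (q2 i) (mulcm (ucm i)) (onecm J1)).
  rewrite (big_morph (@ps_mon J1 T) (@ps_monM J1 T) (erefl (ps_mon T (onecm J1)))).
  apply: eq_bigr => i _; rewrite -ps_monX; congr (_ ^+ _).
  rewrite -emb_val; transitivity (lam ((@mx_identity T I)^~ (val i))); last exact: lamE.
  by rewrite invr1; exact: mulr1.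
apply/eqP/cmP => j.
have -> (r1 : seq J1) (F : J1 -> cmonom J1) :
    (\big[@mulcm J1/onecm J1]_(i <- r1) F i) j = (\sum_(i <- r1) F i j)%N.
  elim/big_rec2: _ => [|i u v _ <-]; first exact: onecmE.
  by rewrite mulcmE.
under eq_bigr do rewrite iter_mulcmE ucmE.
have [jq|jq] := boolP (j \in finsupp q2); last first.
  rewrite (fsfun_dflt jq) big_seq big1 // => i iq; case: eqP => [ij|]; last by rewrite muln0.
  by rewrite -ij iq in jq.
rewrite (big_fsetD1 j) //= eqxx muln1 big_seq big1 ?addn0 // => i.
by rewrite in_fsetD1 => /andP[/negbTE -> _]; rewrite muln0.
Qed.
End SigmaMatrix.

(** * Comparison of the denominator-free powers with [ps_power] *)

Section Power.
Variables (T : comNzRingType) (TK : comUnitRingType) (iK : {rmorphism T -> TK}) (t : T).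
Hypothesis iK_inj : injective iK.
Hypothesis tU : iK t \is a GRing.unit.
Hypothesis natU : forall n, (0 < n)%N -> (n%:R : TK) \is a GRing.unit.
Hypothesis T_complete : adic_complete t.
Variables (m l1 l2 : nat) (delta gamma : nat -> T) (v : TK).
Hypothesis delta0 : delta 0 = 0.
Hypothesis deltaE : forall n, (0 < n)%N ->
  n%:R * t ^+ l1 * delta n = (-1) ^+ n.+1 * t ^+ (m * n + l2).
Hypothesis delta_null : adic_null t delta.
Hypothesis gammaE : forall j, (j`!)%:R * iK t ^+ (l2 * j) * iK (gamma j) = v ^+ j * iK t ^+ (l1 * j).
Hypothesis gamma_null : adic_null t gamma.
Variables (I : choiceType) (i0 : I).
Local Notation J := (complement1 i0).
Local Notation C := (pseries J T).
Local Notation tC := (t%:A : C).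

Definition is_limK (u : nat -> TK) (l : TK) := forall N, exists n0,
  forall n, (n0 <= n)%N -> exists y : T, u n - l = iK (t ^+ N * y).

(** Two limits differ by an element of iK (t^N T) for every N. The case N = 0 gives one element of
    T, which by injectivity of [iK] lies in all t^N T and vanishes. *)
Lemma limK_eq (u : nat -> TK) l : is_limK u l -> limK iK t u = l.
Proof.
move=> ul; have l'P : is_limK u (limK iK t u) by apply: (@xgetPex _ 0 (is_limK u)); exists l.
move: (limK _ _ _) l'P => l' l'P.
have [sep _] := T_complete.
have H N : exists y, l' - l = iK (t ^+ N * y).
  have [[n1 H1] [n2 H2]] := (ul N, l'P N); pose n := maxn n1 n2.
  have [y1 E1] := H1 n (leq_maxl _ _); have [y2 E2] := H2 n (leq_maxr _ _).
  exists (y1 - y2); rewrite mulrBr rmorphB -E1 -E2; ring.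
have [y0 E0] := H 0%N.
have y00 : y0 = 0.
  apply: sep => N; have [y E] := H N; exists y; apply: iK_inj.
  by rewrite -E E0 mul1r.
by apply/eqP; rewrite -subr_eq0 E0 y00 mulr0 rmorph0.
Qed.

(** The factor c = t^(k1 - k2) may have a denominator; convergence modulo t^(N + k2) compensates for
    it. *)
Lemma limK_series (c : TK) (k1 k2 : nat) (a : nat -> T) (z : C) (u : nat -> TK) q :
  c * iK t ^+ k2 = iK t ^+ k1 -> adic_null t a ->
  (forall N, u N = c * iK ((\sum_(i < N) (a i)%:A * z ^+ i) q)) ->
  limK iK t u = c * iK (adic_series tC (fun n => (a n)%:A * z ^+ n) q).
Proof.
move=> cE a0 uE; apply: limK_eq => N.
have aC := adic_nullMl (fun n => z ^+ n) (ps_adic_null J a0).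
have [n0 n0P] := adic_seriesP (ps_adic_complete J T_complete) aC (N + k2)%N.
exists n0 => n /n0P /ps_in_ideal /(_ q) [y yE]; exists (t ^+ k1 * y).
rewrite uE -mulrBr -rmorphB -ps_coefB yE !rmorphM !rmorphXn /= exprD.
by rewrite -cE !mulrA (mulrC c).
Qed.

(** Over T[1/pi] the logarithm is c times [ell] with c = t^(l1 - l2), and the powers of c are
    absorbed by [gamma]. The exponential thus comes from a series over T, and injectivity of [iK]
    forces the choice made in [ps_power]. *)
Lemma ps_powerE (z : C) : ps_power iK t v (1 + t ^+ m *: z) = pwC t delta gamma z.
Proof.
pose ell0 := ell tC (fun n => (delta n)%:A) z.
pose c := iK t ^+ l1 / iK t ^+ l2.
have tkU k : iK t ^+ k \is a GRing.unit by rewrite unitrX.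
have cE : c * iK t ^+ l2 = iK t ^+ l1 by rewrite /c divrK.
have logE : ps_log iK t (ps_map iK (1 + t ^+ m *: z)) = c *: ps_map iK ell0.
  apply/funext => q; rewrite ps_coefZ; apply: (limK_series cE delta_null) => N.
  have -> : ps_map iK (1 + t ^+ m *: z) - 1 = ps_map iK (t ^+ m *: z).
    by rewrite rmorphD rmorph1 addrAC subrr add0r.
  rewrite ps_coef_sum -[RHS]/(c * ps_map iK (\sum_(i < N) (delta i)%:A * z ^+ i) q).
  rewrite rmorph_sum ps_coef_sum mulr_sumr -(big_mkord xpredT (fun i => c * ps_map iK ((delta i)%:A * z ^+ i) q)).
  case: N => [|N]; first by rewrite !big_geq.
  rewrite [RHS]big_ltn // /= [X in X + _](_ : _ = 0) ?add0r; last first.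
    by rewrite delta0 scale0r mul0r /ps_map ps_coef0 rmorph0 mulr0.
  apply: eq_big_nat => n /andP[n0 _].
  have nU := natU n0.
  rewrite ps_coefZ -rmorphXn /= /ps_map exprZn ps_scalerA !ps_coefZ !rmorphM [LHS]mulrA [RHS]mulrA.
  congr (_ * _); rewrite -exprM rmorphXn.
  have := congr1 iK (deltaE n0); rewrite !rmorphM !rmorphXn rmorphN1 rmorph_nat exprD => E.
  apply: (mulrI nU); apply: (mulIr (tkU l2)).
  transitivity (n%:R * n%:R^-1 * ((-1) ^+ n.+1 * (iK t ^+ (m * n) * iK t ^+ l2))); first by ring.
  rewrite mulrV // mul1r -E -cE; ring.
have expE : ps_exp iK t (v *: ps_log iK t (ps_map iK (1 + t ^+ m *: z)))
    = ps_map iK (pwC t delta gamma z).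
  apply/funext => q; rewrite logE -[RHS]mul1r.
  apply: (@limK_series 1 0 0 gamma ell0) => // [|N]; first by rewrite mulr1.
  rewrite mul1r ps_coef_sum.
  rewrite -[RHS]/(ps_map iK (\sum_(i < N) (gamma i)%:A * ell0 ^+ i) q).
  rewrite rmorph_sum ps_coef_sum big_mkord; apply: eq_bigr => n _.
  rewrite ps_coefZ scalerA exprZn ps_coefZ -rmorphXn /= /ps_map ps_scalerA ps_coefZ rmorphM mulrA.
  congr (_ * _).
  have nU : (n`!%:R : TK) \is a GRing.unit by apply: natU; apply: fact_gt0.
  apply: (mulrI nU); rewrite mulrA mulrV // mul1r; apply: (mulIr (tkU (l2 * n))).
  have := gammaE n; rewrite exprMn => E.
  transitivity (v ^+ n * (c ^+ n * iK t ^+ (l2 * n))); first by ring.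
  by rewrite exprM -exprMn cE -!exprM -E mulrAC.
pose P := [set y | ps_map iK y = ps_exp iK t (v *: ps_log iK t (ps_map iK (1 + t ^+ m *: z)))].
have yP : P (ps_power iK t v (1 + t ^+ m *: z)).
  by apply: (@xgetPex _ 0 P); exists (pwC t delta gamma z); rewrite /P /= expE.
move: yP; rewrite /P /= expE => yE; apply/funext => q; apply: iK_inj.
by have := congr1 (fun f => f q) yE.
Qed.
End Power.

(** * The ring of integers and the coefficients of exp and log *)

Section RingOfIntegers.
Variables (p : nat) (p_prime : prime p).
Variables (Zp : idomainType) (Zp_padic : is_Zp p Zp).
Variables (K : fieldExtType {fraction Zp}) (R : idomainType) (iota : {rmorphism R -> K}).
Hypothesis R_integers : is_ring_of_integers iota.
Variables (pi : R) (pi_uniformizer : is_uniformizer pi).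

Lemma Zp_in_ideal N (a : int) :
  in_ideal ((p%:R : Zp) ^+ N) (a%:~R : Zp) -> in_ideal ((p%:R : int) ^+ N) a.
Proof.
have [_ _ _ H] := Zp_padic => pa; apply: H.
by rewrite rmorph_nat.
Qed.

Lemma in_ideal_int N (n : nat) : in_ideal ((p%:R : int) ^+ N) (n%:Z) -> (p ^ N %| n)%N.
Proof.
move=> [y]; rewrite -natrX => E; apply/dvdnP; exists `|y|%N.
by have := congr1 absz E; rewrite abszM natz !absz_nat mulnC.
Qed.

(** If n were 0 in Z_p, then p^n would divide n in the integers, against n < p^n. *)
Lemma Zp_natr_neq0 n : (0 < n)%N -> (n%:R : Zp) != 0.
Proof.
move=> n0; apply/eqP => nz.
have /in_ideal_int/dvdn_leq-/(_ n0) : in_ideal ((p%:R : int) ^+ n) n%:Z.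
  by apply: Zp_in_ideal; rewrite -pmulrn nz; exact: in_ideal0.
by rewrite leqNgt ltn_expl ?prime_gt1.
Qed.

Lemma Zp_p_nonunit (y : Zp) : p%:R * y != 1.
Proof.
apply/eqP => py.
have /in_ideal_int : in_ideal ((p%:R : int) ^+ 1) 1%N.
  by apply: Zp_in_ideal; exists y; rewrite expr1 py.
by rewrite expn1 dvdn1; move: p_prime => /prime_gt1; case: p => [|[|]].
Qed.

Local Notation f := (in_alg K \o @tofrac Zp).

Lemma alg_tofrac_eq0 (x : Zp) : (f x == 0) = (x == 0).
Proof. by rewrite /= scaler_eq0 oner_eq0 orbF tofrac_eq0. Qed.

Lemma K_natr_neq0 n : (0 < n)%N -> (n%:R : K) != 0.
Proof. by move=> /Zp_natr_neq0; rewrite -alg_tofrac_eq0 rmorph_nat. Qed.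

Lemma iota_inj : injective iota. Proof. by case: R_integers. Qed.

Lemma iota_eq0 x : (iota x == 0) = (x == 0).
Proof. by rewrite -(rmorph0 iota) (inj_eq iota_inj). Qed.

Lemma R_natr_neq0 n : (0 < n)%N -> (n%:R : R) != 0.
Proof. by move=> /K_natr_neq0; rewrite -(rmorph_nat iota) iota_eq0. Qed.

(** A monic equation for 1/p over Z_p, multiplied by p^n for n its degree, would write 1 as a
    multiple of p in Z_p. *)
Lemma R_p_nonunit : (p%:R : R) \isn't a GRing.unit.
Proof.
apply/negP => pU; have [_ rangeI] := R_integers.
have : range iota (iota (p%:R)^-1) by exists (p%:R)^-1.
rewrite rangeI => -[q q_monic q_root].
have p0 : (p%:R : K) != 0 by apply: K_natr_neq0; apply: prime_gt0.
have iE : iota (p%:R)^-1 = (p%:R)^-1 by rewrite rmorphV // rmorph_nat.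
rewrite iE in q_root.
have sq : (0 < size q)%N by rewrite size_poly_gt0 monic_neq0.
pose n := (size q).-1; have sE : size q = n.+1 by rewrite prednK.
have : \sum_(i < n.+1) q`_i * (p%:R) ^+ (n - i) = 0 :> Zp.
  apply/eqP; rewrite -alg_tofrac_eq0; apply/eqP.
  have szf : (size (map_poly f q) <= n.+1)%N by rewrite -sE; apply: size_poly.
  have /rootP := q_root; rewrite (horner_coef_wide _ szf) => H.
  rewrite rmorph_sum; transitivity ((p%:R : K) ^+ n *
    \sum_(i < n.+1) (map_poly f q)`_i * (p%:R)^-1 ^+ i); last by rewrite H mulr0.
  rewrite mulr_sumr; apply: eq_bigr => i _.
  rewrite rmorphM rmorphXn rmorph_nat coef_map mulrCA; congr (_ * _).
  by rewrite exprVn expfB_cond // (negbTE p0) add0n -ltnS ltn_ord.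
rewrite big_ord_recr /= subnn expr0 mulr1.
have -> : q`_n = 1 by have /monicP := q_monic; rewrite /lead_coef.
have -> : \sum_(i < n) q`_i * p%:R ^+ (n - i) = p%:R * \sum_(i < n) q`_i * p%:R ^+ (n - i).-1.
  rewrite mulr_sumr; apply: eq_bigr => i _.
  by rewrite mulrCA -exprS prednK // subn_gt0.
move=> /eqP; rewrite addr_eq0 => /eqP E.
have := Zp_p_nonunit (- \sum_(i < n) q`_i * p%:R ^+ (n - i).-1).
by rewrite mulrN E opprK eqxx.
Qed.

Lemma pi_nonunit : pi \isn't a GRing.unit. Proof. by case: pi_uniformizer. Qed.

Lemma R_p_decomp : exists e u, [/\ (0 < e)%N, u \is a GRing.unit & (p%:R : R) = pi ^+ e * u].
Proof.
have [_ dec] := pi_uniformizer.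
have [e [u [uU pE]]] := dec _ (R_natr_neq0 (prime_gt0 p_prime)).
exists e, u; split=> //; rewrite lt0n; apply/eqP => e0.
by move: R_p_nonunit; rewrite pE e0 mul1r uU.
Qed.

Lemma pi_neq0 : pi != 0.
Proof.
have [e [u [e0 uU pE]]] := R_p_decomp.
apply/eqP => pi0; have := R_natr_neq0 (prime_gt0 p_prime).
by rewrite pE pi0 expr0n gtn_eqF // mul0r eqxx.
Qed.

(** Integers prime to p are units of R. *)
Lemma R_nat_decomp e u n : (0 < e)%N -> u \is a GRing.unit -> (p%:R : R) = pi ^+ e * u ->
  (0 < n)%N -> exists2 w, w \is a GRing.unit & (n%:R : R) = pi ^+ (e * logn p n) * w.
Proof.
move=> e0 uU pE n0; have [_ dec] := pi_uniformizer.
have [n' pn' nE] := pfactor_coprime p_prime n0.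
have n'0 : (0 < n')%N by move: n0; rewrite nE muln_gt0 => /andP[].
have [j [w [wU n'E]]] := dec _ (R_natr_neq0 n'0).
have j0 : j = 0%N.
  case: j n'E => // j n'E; case/negP: pi_nonunit.
  (* Bezout: a p = b n' + 1. If pi divided n' as well as p, it would be invertible. *)
  have [a b abE _] := egcdnP n' (prime_gt0 p_prime).
  rewrite (eqP pn') in abE.
  have := congr1 (fun x : nat => x%:R : R) abE; rewrite natrD !natrM n'E pE => E.
  apply/unitrPr; exists (a%:R * (pi ^+ e.-1 * u) - b%:R * (pi ^+ j * w)).
  rewrite mulrBr; apply/eqP; rewrite subr_eq addrC; apply/eqP.
  have pe : pi ^+ e = pi * pi ^+ e.-1 by rewrite -exprS prednK.
  transitivity (a%:R * (pi ^+ e * u)); first by rewrite pe; ring.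
  by rewrite E exprS; ring.
exists (w * u ^+ logn p n); first by rewrite unitrM wU unitrX.
rewrite {1}nE natrM natrX n'E j0 expr0 mul1r pE exprMn -exprM; ring.
Qed.
End RingOfIntegers.

Lemma sqr_le_exp2 v : (4 <= v)%N -> (v ^ 2 <= 2 ^ v)%N.
Proof.
elim: v => // v IH; rewrite leq_eqVlt => /orP[/eqP <-//|]; rewrite ltnS => v4.
by have := IH v4; rewrite -!mulnn expnS; nia.
Qed.

(** With v = v_p(n) one has 2^v <= n. Either v <= 2e + 4 and the threshold is large enough, or v^2
    <= 2^v <= n and e v is at most n / 2, as is c. *)
Lemma logn_sublinear p e c : prime p ->
  exists n0, forall n, (n0 <= n)%N -> (c + e * logn p n <= n)%N.
Proof.
move=> p_pr; exists (2 * c + 2 * (e * (2 * e + 4)) + 1)%N => n n0.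
have ngt0 : (0 < n)%N by lia.
have le_pn : (p ^ logn p n <= n)%N by apply: dvdn_leq => //; apply: pfactor_dvdnn.
set v := logn p n in le_pn *.
have le2 : (2 ^ v <= n)%N.
  apply: leq_trans le_pn; have [->//|v0] := posnP v.
  by rewrite leq_exp2r // prime_gt1.
have [vle|vgt] := leqP v (2 * e + 4).
  have : (e * v <= e * (2 * e + 4))%N by rewrite leq_mul2l vle orbT.
  lia.
have v4 : (4 <= v)%N by lia.
by have := leq_trans (sqr_le_exp2 v4) le2; rewrite -mulnn; nia.
Qed.

(** Legendre's formula. Keeping the last quotient n / p^N as a summand makes the sum telescope,
    because p times the next quotient is at most the current one. *)
Lemma logn_fact_le p n : prime p -> (p.-1 * logn p n`! <= n)%N.
Proof.
move=> p_pr; have p1 := prime_gt1 p_pr.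
suff H N : (p.-1 * \sum_(1 <= k < N.+1) n %/ p ^ k + n %/ p ^ N <= n)%N.
  by rewrite logn_fact //; apply: leq_trans (H n); apply: leq_addr.
elim: N => [|N IH]; first by rewrite big_geq // muln0 expn0 divn1.
apply: leq_trans IH; rewrite big_nat_recr //= mulnDr -addnA leq_add2l.
rewrite -[X in (_ + X <= _)%N]mul1n -mulnDl addn1 prednK ?prime_gt0 //.
by rewrite expnSr divnMA mulnC leq_divM.
Qed.

Section Coefficients.
Variables (p : nat) (p_prime : prime p) (R : idomainType) (pi : R) (e : nat).
Hypothesis e_gt0 : (0 < e)%N.
Hypothesis natE : forall n, (0 < n)%N ->
  exists2 w, w \is a GRing.unit & (n%:R : R) = pi ^+ (e * logn p n) * w.

(** [delta n] is, up to sign, pi^(mn + l2 - l1) / n: the assumption makes the exponent left after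
    dividing by n nonnegative, and it tends to infinity since v_p(n) grows more slowly than n. *)
Lemma log_coefs (m l1 l2 : nat) : (0 < m)%N ->
  (forall n, (0 < n)%N -> (l1 + e * logn p n <= m * n + l2)%N) ->
  exists delta : nat -> R, [/\ delta 0 = 0,
    forall n, (0 < n)%N -> n%:R * pi ^+ l1 * delta n = (-1) ^+ n.+1 * pi ^+ (m * n + l2)
    & adic_null pi delta].
Proof.
move=> m0 lm; have /choice [w wP] n : exists w : R, (0 < n)%N ->
    w \is a GRing.unit /\ (n%:R : R) = pi ^+ (e * logn p n) * w.
  case: n => [|n]; first by exists 0.
  by have [//|w wU E] := natE (n := n.+1); exists w.
pose d n := (m * n + l2 - (l1 + e * logn p n))%N.
exists (fun n => if n is 0 then 0 else (-1) ^+ n.+1 * pi ^+ d n * (w n)^-1); split=> //.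
  case=> // n n0; have [wU ->] := wP _ n0.
  have -> : pi ^+ (m * n.+1 + l2) = pi ^+ l1 * pi ^+ (e * logn p n.+1) * pi ^+ d n.+1.
    by rewrite -!exprD subnKC // lm.
  transitivity ((-1) ^+ n.+2 * (pi ^+ l1 * pi ^+ (e * logn p n.+1) * pi ^+ d n.+1) *
    (w n.+1 / w n.+1)); last by rewrite divrr // mulr1.
  by ring.
move=> N; have [n0 n0P] := logn_sublinear e (N + l1) p_prime.
exists n0 => -[|n] n0n; first exact: in_ideal0.
have := n0P _ n0n => H; apply: in_idealMr; apply: in_idealM.
apply: (@in_ideal_le _ _ _ (d n.+1)); last by exists 1; rewrite mulr1.
have : (n.+1 <= m * n.+1)%N by rewrite leq_pmull.
rewrite /d; clear e_gt0; lia.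
Qed.

Variables (RR : realType) (K : fieldType) (iota : {rmorphism R -> K}).
Hypothesis iota_inj : injective iota.
Hypothesis pi_neq0 : pi != 0.
Variables (u : R) (uU : u \is a GRing.unit).
Hypothesis pE : p%:R = pi ^+ e * u.
Variable nu : rat.

Let iota_pi : iota pi != 0.
Proof. by rewrite -(rmorph0 iota) (inj_eq iota_inj). Qed.

(** The supremum is tested on the e-th power: (pi^d w)^e = p^d w^e u^(-d). *)
Lemma ordK_ge (d : int) (w : R) :
  ((d%:~R / e%:R : RR)%:E <= ordK RR iota p (iota pi ^ d * iota w))%E.
Proof.
apply: ereal_sup_ubound; exists d, e; split=> //.
exists (w ^+ e * u ^ (- d)).
have -> : (p%:R : K) = iota pi ^+ e * iota u by rewrite -(rmorph_nat iota) pE rmorphM rmorphXn.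
have iuU : iota u \is a GRing.unit by rewrite rmorph_unit.
have iu0 : iota u != 0 by rewrite -unitfE.
rewrite exprMn rmorphM rmorphXn rmorphXz // expfzMl mulrCA !mulrA.
rewrite -[RHS]mulrA -expfzDr // subrr mulr1.
by rewrite -[_ ^+ e in RHS]/(_ ^ e%:Z) -[_ ^+ e]/(_ ^ e%:Z) exprzAC mulrC.
Qed.

Lemma ordK0 : ordK RR iota p 0 = +oo%E.
Proof.
apply: eq_infty => r; apply: le_trans (_ : ((Num.Def.archi_bound `|r|)%:R%:E <= _)%E).
  by rewrite lee_fin; apply: le_trans (ler_norm r) (ltW (archi_boundP _)).
apply: ereal_sup_ubound; exists (Num.Def.archi_bound `|r|)%:Z, 1%N; split=> //; last by rewrite divr1.
by exists 0; rewrite rmorph0 mulr0 expr1.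
Qed.

Lemma B_series_monomial (d : int) (j : nat) (w : R) : 0 <= d%:~R / e%:R + nu * j%:R ->
  B_series RR iota p nu ((iota pi ^ d * iota w) *: ps_var K tt ^+ j).
Proof.
move=> dj; set c := _ * _; pose a := iter j (mulcm (ucm tt)) (onecm unit).
have E q : (c *: ps_var K tt ^+ j) q = if q == a then c else 0.
  rewrite ps_coefZ [ps_var K tt ^+ j](ps_monX K (ucm tt)) /ps_mon -/a.
  by case: eqP => _; rewrite ?mulr1 ?mulr0.
have dega : mdeg a = j.
  rewrite /a; elim: j {dj c E a} => [|j IH]; first exact: mdeg1.
  by rewrite /= (mdegM (ucm tt)) IH mdegU.
split=> [q|M].
  rewrite E; case: eqP => [->|_]; last by rewrite ordK0 addye.
  rewrite dega; apply: le_trans (leeD2r _ (ordK_ge d w)).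
  rewrite -EFinD lee_fin; move: dj; rewrite -(ler0q RR).
  by rewrite rmorphD !rmorphM fmorphV rmorph_int !rmorph_nat.
exists j.+1 => q jq; rewrite E ifF; first by rewrite ordK0 addye // leey.
by apply/eqP => qa; move: jq; rewrite qa dega ltnn.
Qed.

Variables (B : comAlgType R) (jB : {rmorphism B -> pseries unit K}).
Hypothesis jB_scale : forall (x : R) (b : B), jB (x *: b) = iota x *: jB b.
Hypothesis B_subring : is_subring jB (B_series RR iota p nu).

Let jB_inj : injective jB. Proof. by case: B_subring. Qed.

Let jB_surj f : B_series RR iota p nu f -> exists b, jB b = f.
Proof.
move=> fB; have [_ rB] := B_subring; have [b _ <-] : range jB f by rewrite rB.
by exists b.
Qed.

(** [b j] is pi^((l1 - l2) j) V^j / j!. As v_p(j!) <= j / (p - 1), the order of its coefficient plus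
    nu j is at least theta j, so [b j] lies in B and becomes divisible by growing powers of pi. *)
Lemma exp_coefs (l1 l2 : nat) :
  0 < (l1%:R - l2%:R) / e%:R + nu - (p.-1)%:R^-1 ->
  exists (b : nat -> B) (s : nat) (beta : B),
    [/\ jB beta = iota pi ^+ s *: ps_var K tt,
      forall j, (j`!%:R * pi ^+ (l2 * j) * pi ^+ (s * j)) *: b j = pi ^+ (l1 * j) *: beta ^+ j
    & forall N, exists j0, forall j, (j0 <= j)%N -> exists b', b j = pi ^+ N *: b'].
Proof.
set theta := (X in 0 < X) => theta0.
have e0 : 0 < e%:R :> rat by rewrite ltr0n.
have p10 : 0 < (p.-1)%:R :> rat by rewrite ltr0n -subn1 subn_gt0 prime_gt1.
have /choice [w wP] j : exists w : R,
    w \is a GRing.unit /\ (j`!%:R : R) = pi ^+ (e * logn p j`!) * w.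
  by have [w wU E] := natE (fact_gt0 j); exists w.
pose d (j : nat) : int := (l1 * j)%:Z - (l2 * j)%:Z - (e * logn p j`!)%:Z.
have dP j : j%:R * theta <= (d j)%:~R / e%:R + nu * j%:R.
  have : (p.-1)%:R * (logn p j`!)%:R <= j%:R :> rat.
    by rewrite -natrM ler_nat logn_fact_le.
  rewrite -ler_pdivlMl // => H.
  rewrite /theta /d !rmorphB /= -!pmulrn !natrM.
  rewrite [X in _ <= X](_ : _ = (l1%:R - l2%:R) / e%:R * j%:R + nu * j%:R - (logn p j`!)%:R); last first.
    by field; rewrite gt_eqF.
  by rewrite mulrDr mulrDr mulrN (mulrC _ (_ / _)) (mulrC _ nu) lerD2l lerN2 mulrC.
have coef j N : 0 <= (d j - N%:Z)%:~R / e%:R + nu * j%:R ->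
    exists b, jB b = (iota pi ^ (d j - N%:Z) * iota (w j)^-1) *: ps_var K tt ^+ j.
  by move=> H; apply: jB_surj; apply: B_series_monomial.
have dj0 j : 0 <= (d j - 0%:Z)%:~R / e%:R + nu * j%:R.
  by rewrite subr0; apply: le_trans (dP j); rewrite mulr_ge0 ?ler0n // ltW.
have /choice [b bP] j := coef j 0%N (dj0 j).
(* For negative nu the series V is not in B; pi^s V is, because s / e is at least |nu|. *)
pose s := (e * Num.Def.archi_bound `|nu|)%N.
have [beta betaE] : exists beta, jB beta = iota pi ^+ s *: ps_var K tt.
  apply: jB_surj; have H : 0 <= s%:Z%:~R / e%:R + nu * 1%:R.
    rewrite mulr1 -pmulrn natrM mulrAC divff ?gt_eqF // mul1r.
    have /ltW := archi_boundP (normr_ge0 nu); have := ler_norm (- nu); rewrite normrN; lra.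
  by have := B_series_monomial 1 H; rewrite rmorph1 mulr1 expr1.
exists b, s, beta; split=> // [j|N].
  apply: jB_inj; rewrite !jB_scale (rmorphXn jB) /= betaE bP exprZn !scalerA; congr (_ *: _).
  have [wU jE] := wP j; have iw : iota (w j) != 0 by rewrite -unitfE rmorph_unit.
  have ip := iota_pi; rewrite subr0 jE !rmorphM !rmorphXn /= rmorphV // -exprM.
  have -> : iota pi ^ d j = iota pi ^+ (l1 * j) / iota pi ^+ (l2 * j) / iota pi ^+ (e * logn p j`!).
    by rewrite /d !expfzDr // -!exprnN.
  have A k : iota pi ^+ k != 0 by rewrite expf_neq0.
  move: (iota (w j)) (iota pi ^+ (l1 * j)) iw (A (l2 * j)%N) (A (e * logn p j`!)%N).
  move: (iota pi ^+ (l2 * j)) (iota pi ^+ (e * logn p j`!)) (iota pi ^+ (s * j)).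
  by move=> X Y Z W L W0 X0 Y0; field; rewrite W0 X0 Y0.
(* From j0 on, N / e <= theta j, so a factor pi^N can be split off inside B. *)
pose j0 := Num.Def.archi_bound (`|N%:R / e%:R / theta|).
exists j0 => j jj0.
have Hj : 0 <= (d j - N%:Z)%:~R / e%:R + nu * j%:R.
  rewrite rmorphB /= -!pmulrn mulrBl addrAC subr_ge0; apply: le_trans (dP j).
  rewrite -ler_pdivrMr //; apply: le_trans (ler_norm _) _.
  by apply: le_trans (ltW (archi_boundP (normr_ge0 _))) _; rewrite ler_nat.
have [b' b'E] := coef j N Hj; exists b'; apply: jB_inj.
rewrite jB_scale bP b'E scalerA rmorphXn /= subr0 mulrA (exprnP _ N) -expfzDr //.
by rewrite addrC subrK.
Qed.
End Coefficients.

(** * Torsion-freeness and orders *)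

Section Completion.
Variables (E F : comNzRingType) (t : E) (j : {rmorphism E -> F}).
Hypothesis comp : is_adic_completion t j.

Lemma completion_adic_complete : adic_complete (j t).
Proof. by case: comp. Qed.

(** If t kills x and a approximates x modulo t^N, then t a lies in t^(N+1) F, hence in t^(N+1) E;
    cancelling t there shows that x lies in t^N F for every N. *)
Lemma completion_lreg : GRing.lreg t -> GRing.lreg (j t).
Proof.
move=> t_reg; have [sep _ dense closed] := comp.
apply: mulrI0_lreg => x tx; apply: sep => N.
have [a [y xE]] := dense N x.
have /closed [b ab] : in_ideal (j t ^+ N.+1) (j (t * a)).
  exists (- y); apply/eqP; rewrite mulrN -addr_eq0 rmorphM exprS -mulrA -mulrDr.
  by rewrite -xE addrC subrK tx.
move: ab; rewrite exprS -mulrA => /t_reg ab.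
rewrite -(subrK (j a) x) xE; apply: in_idealD; first by exists y.
by exists (j b); rewrite ab rmorphM rmorphXn.
Qed.

Lemma completion_dense N x : exists a, in_ideal (j t ^+ N) (x - j a).
Proof. by case: comp. Qed.

Lemma completion_in_ideal N a : in_ideal (j t ^+ N) (j a) -> in_ideal (t ^+ N) a.
Proof. by case: comp => _ _ _; apply. Qed.
End Completion.

Section FlatTorsion.
Variables (R : idomainType) (A : comAlgType R) (pi : R).
Hypothesis A_flat : flat_module A.
Hypothesis pi_neq0 : pi != 0.

Lemma flat_tensor_lreg (B AB : comAlgType R) (iA : {lrmorphism A -> AB})
    (iB : {lrmorphism B -> AB}) :
  is_tensor_product (fun (a : A) (b : B) => (iA a * iB b : AB)) ->
  injective (fun b : B => pi *: b) -> GRing.lreg (pi%:A : AB).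
Proof.
move=> tens pi_inj.
pose uB : {linear B -> B} := *:%R pi.
pose uT : {linear AB -> AB} := *:%R pi.
have H : injective uT.
  apply: (A_flat (u := uB) tens tens) => // a b /=.
  by rewrite linearZ scalerAr.
by move=> x y; rewrite -!scalerAl !mul1r => /H.
Qed.

(** Flatness speaks of tensor products given by their universal property, so A is exhibited as the
    tensor product of A and R before multiplication by pi on R is used. *)
Lemma flat_lreg : GRing.lreg (pi%:A : A).
Proof.
pose b (a : A) (x : R^o) : A := (x : R) *: a.
have tens : is_tensor_product b.
  split; first split.
  - by move=> a c x y; rewrite /b scalerDl scalerA.
  - by move=> x c a a'; rewrite /b scalerDr !scalerA mulrC.
  move=> P c [cl cr].
  have hlin : linear (fun a => c a (1 : R^o)) by move=> r x y; apply: cr.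
  pose h : {linear A -> P} := HB.pack (fun a => c a (1 : R^o))
    (GRing.isLinear.Build R A P *:%R (fun a => c a (1 : R^o)) hlin).
  exists h; split=> [a x|h' h'E a]; last by rewrite -[a in LHS]scale1r h'E.
  have xE : x = x *: (1 : R^o) + 0 by rewrite addr0 -[RHS]/(x * 1) mulr1.
  have cZ z y : c a (z *: y) = z *: c a y.
    have c0 : c a 0 = 0.
      have := cl a 1 0 0; rewrite !scale1r addr0 => /eqP.
      by rewrite -subr_eq subrr => /eqP <-.
    by have := cl a z y 0; rewrite addr0 c0 addr0.
  rewrite -[h _]/(c (x *: a) 1); have -> : c a x = x *: c a 1 by rewrite -cZ -[_ *: _]/(x * 1) mulr1.
  have c0 : c 0 1 = 0.
    have := cr 1 1 0 0; rewrite !scale1r addr0 => /eqP.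
    by rewrite -subr_eq subrr => /eqP <-.
  by have := cr 1 x a 0; rewrite addr0 c0 addr0.
pose uR : {linear R^o -> R^o} := *:%R pi.
pose uA : {linear A -> A} := *:%R pi.
have H : injective uA.
  apply: (A_flat (u := uR) tens tens) => [x y /(mulfI pi_neq0) //|a x /=].
  by rewrite /b scalerA.
by move=> x y; rewrite -!scalerAl !mul1r => /H.
Qed.
End FlatTorsion.

Lemma expn_bernoulli p v : (0 < p)%N -> (1 + v * p.-1 <= p ^ v)%N.
Proof.
move=> p0; elim: v => [|v IH]; first by rewrite expn0.
rewrite expnS; move: IH; set x := (p ^ v)%N; case: p p0 @x => // p _ x /=; nia.
Qed.

Lemma ceil_nat (RR : realType) (x : RR) : 0 < x ->
  exists m : nat, [/\ (0 < m)%N, (m.-1)%:R < x & x <= m%:R].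
Proof.
move=> x0; have c0 : 0 < Num.ceil x by rewrite ceil_gt0.
have /andP[] := ceil_itv x; case: (Num.ceil x) c0 => // -[//|m] _.
by rewrite -pmulrn => lt_x x_le; exists m.+1; split=> //; move: lt_x; rewrite rmorphB /= -pmulrn -natr1 addrK.
Qed.

Section Order.
Variables (RR : realType) (E : comNzRingType) (t : E) (p e : nat) (u : E).
Hypothesis p_prime : prime p.
Hypothesis e_gt0 : (0 < e)%N.
Hypothesis pE : p%:R = t ^+ e * u.
Hypothesis t_reg : GRing.lreg t.
Hypothesis t_reduced : forall y j, in_ideal t (y ^+ j) -> in_ideal t y.

(** Write x = t^a y with a < m and y not divisible by t. If p^n divided x^j with e n > a j, then t
    would divide y^j, against reducedness; so n / j <= a / e. *)
Lemma ord_le m x : ~ in_ideal (t ^+ m) x -> (ord RR p%:R x <= ((m.-1)%:R / e%:R : RR)%:E)%E.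
Proof.
move=> xm.
have [a [y [am xE yt]]] : exists a y, [/\ (a < m)%N, x = t ^+ a * y & ~ in_ideal t y].
  elim: m xm => [|m IH] xm; first by case: xm; exact: in_ideal_expr0.
  have [[y xE]|nx] := pselect (in_ideal (t ^+ m) x); last first.
    by have [a [y [am xE yt]]] := IH nx; exists a, y; split=> //; exact: ltnW.
  exists m, y; split=> // -[z yE]; apply: xm; exists z.
  by rewrite xE yE exprSr mulrA.
apply: ge_ereal_sup => _ [n [j [j0 [z xj] ->]]]; rewrite lee_fin.
have le_enaj : (e * n <= a * j)%N.
  rewrite leqNgt; apply/negP => lt; apply: yt; apply: (t_reduced (j := j)).
  have [k kE] : exists k, (e * n = a * j + k.+1)%N.
    by exists (e * n - (a * j).+1)%N; rewrite -addSnnS subnKC.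
  move: xj; rewrite xE pE !exprMn -!exprM kE exprD exprS -!mulrA => /(lregX t_reg) ->.
  by exists (t ^+ k * (u ^+ n * z)).
have ej : (e * n <= m.-1 * j)%N.
  by apply: leq_trans le_enaj _; rewrite leq_mul2r; apply/orP; right; case: (m) am.
rewrite ler_pdivrMr ?ltr0n // mulrAC ler_pdivlMr ?ltr0n // -!natrM ler_nat.
by rewrite mulnC.
Qed.

Variables (I : eqType) (i0 : I) (M : imatrix I I E).

Definition elementary_mod m := in_ideal (t ^+ m) (M i0 i0 - 1) /\
  forall i1 i2, (i1, i2) != (i0, i0) -> in_ideal (t ^+ m) (M i1 i2).

Lemma elementary_mu m : (((m.-1)%:R / e%:R : RR)%:E < mu_of RR p i0 M)%E -> elementary_mod m.
Proof.
move=> lt_mu.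
have H x : (mu_of RR p i0 M <= ord RR p%:R x)%E -> in_ideal (t ^+ m) x.
  move=> le_mu; apply: contrapT => /ord_le le_ord.
  by have := lt_le_trans lt_mu (le_trans le_mu le_ord); rewrite ltxx.
split; first by apply: H; apply: ereal_inf_lbound; left.
by move=> i1 i2 i12; apply: H; apply: ereal_inf_lbound; right; exists (i1, i2).
Qed.

(* The two conditions make the coefficients of [log] after division by [t^(l1 - l2)],
   respectively those of [exp] after multiplication by its powers, integral. *)
Definition good_exponents (nu : rat) m l1 l2 := [/\ (0 < m)%N,
  forall n, (0 < n)%N -> (l1 + e * logn p n <= m * n + l2)%N
  & 0 < (l1%:R - l2%:R) / e%:R + nu - (p.-1)%:R^-1].

Lemma elementary_le m m' : (m <= m')%N -> elementary_mod m' -> elementary_mod m.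
Proof.
move=> mm [M0 Mi]; split; first exact: in_ideal_le M0.
by move=> i1 i2 /Mi; apply: in_ideal_le.
Qed.

(** With x equal to mu, or a real below it, take for m the ceiling of e x: m - 1 < e x gives the
    congruence modulo t^m, and m >= e x the estimates for log and exp. *)
Lemma admissible_good nu : admissible p (mu_of RR p i0 M) nu ->
  exists m l1 l2, good_exponents nu m l1 l2 /\ elementary_mod m.
Proof.
have e0 : 0 < e%:R :> RR by rewrite ltr0n.
have p1 : (0 < p.-1)%N by rewrite -subn1 subn_gt0 prime_gt1.
have p10 : 0 < (p.-1)%:R :> RR by rewrite ltr0n.
pose c : RR := (p.-1)%:R^-1; have c0 : 0 < c by rewrite invr_gt0.
have elem m (x : RR) : (x%:E <= mu_of RR p i0 M)%E -> (m.-1)%:R < e%:R * x -> elementary_mod m.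
  move=> xmu mx; apply: elementary_mu; apply: lt_le_trans xmu.
  by rewrite lte_fin ltr_pdivrMr // mulrC.
have nuP l1 l2 : 0 < (l1%:R - l2%:R) / e%:R + ratr nu - c :> RR ->
    0 < (l1%:R - l2%:R) / e%:R + nu - (p.-1)%:R^-1 :> rat.
  rewrite -(ltr0q RR) rmorphB rmorphD rmorphM !fmorphV rmorphB !rmorph_nat; exact.
have logn_bern n : (0 < n)%N -> (1 + logn p n * p.-1 <= n)%N.
  move=> n0; apply: leq_trans (expn_bernoulli _ (prime_gt0 p_prime)) _.
  by apply: dvdn_leq => //; apply: pfactor_dvdnn.
case=> [[cmu numu]|[muc [b [bmu bnu]]]].
  (* mu may be infinite, in which case any sufficiently large x will do. *)
  have [x [xmu cx nux]] : exists x : RR, [/\ (x%:E <= mu_of RR p i0 M)%E, c < x & c - x < ratr nu].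
    move: (mu_of _ _ _ _) cmu numu => [x||] //= cmu numu.
      by exists x; split=> //; rewrite -?lte_fin // EFinB.
    exists (Num.max c (c - ratr nu) + 1); rewrite leey; split=> //.
      by rewrite ltr_pwDr // le_max lexx.
    by rewrite ltrBlDr -ltrBlDl ltr_pwDr // le_max lexx orbT.
  have ex0 : 0 < e%:R * x by rewrite mulr_gt0 // (lt_trans c0).
  have [m [m0 mlt mge]] := ceil_nat ex0.
  (* Here log (1 + t^m z) is divisible by t^m: for v = v_p(n), the bounds e <= m (p - 1) and 1 + v
     (p - 1) <= n give e v <= m (n - 1). *)
  exists m, m, 0%N; split; last exact: elem mlt.
  split=> // [n n0|]; last first.
    apply: nuP; rewrite subr0; move: nux; rewrite ltrBlDr => nux.
    have : x <= m%:R / e%:R by rewrite ler_pdivlMr // mulrC.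
    by move=> xm; rewrite subr_gt0; apply: lt_le_trans nux _; rewrite addrC lerD2r.
  have emp : (e <= m * p.-1)%N.
    rewrite -(ler_nat RR) natrM; apply: le_trans (_ : e%:R * x * (p.-1)%:R <= _); last first.
      by rewrite ler_pM2r.
    rewrite -mulrA ler_peMr ?ler0n //; move: cx; rewrite /c.
    by rewrite -[_^-1]mul1r ltr_pdivrMr // => /ltW.
  have := logn_bern n n0; rewrite addn0 => H.
  apply: (@leq_trans (m * (1 + logn p n * p.-1))); last by rewrite leq_mul2l H orbT.
  by rewrite mulnDr muln1 leq_add2l (mulnC (logn p n)) mulnA leq_mul2r emp orbT.
have [x muE x0] : exists2 x : RR, mu_of RR p i0 M = x%:E & (p ^ b)%:R^-1 * c <= x.
  move: (mu_of _ _ _ _) muc bmu => [x||] //= _; rewrite lee_fin => ?.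
  by exists x.
have pb0 : 0 < (p ^ b)%:R :> RR by rewrite ltr0n expn_gt0 prime_gt0.
have ex0 : 0 < e%:R * x by rewrite mulr_gt0 //; apply: lt_le_trans x0; rewrite mulr_gt0 ?invr_gt0.
have [m [m0 mlt mge]] := ceil_nat ex0.
have c1 : c <= 1 by rewrite invf_le1 // ler1n.
(* The future l1 - l2, possibly negative. Since l / e >= c - b, the exponential condition reduces to
   nu > b. *)
pose l := Num.ceil (e%:R * (c - b%:R)).
have lP n : (0 < n)%N -> l <= (m * n)%:Z - (e * logn p n)%:Z.
  move=> n0; rewrite ceil_le_int rmorphB /= -!pmulrn !natrM.
  set v := logn p n.
  have pvn : (p ^ v)%:R <= n%:R :> RR.
    by rewrite ler_nat; apply: dvdn_leq => //; apply: pfactor_dvdnn.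
  (* For v >= b this is Bernoulli's inequality for p^(v - b), as c (p - 1) = 1; for v < b it follows
     from c <= 1. *)
  have H : c - b%:R <= (p ^ b)%:R^-1 * c * (p ^ v)%:R - v%:R.
    have [bv|vb] := leqP b v.
      have -> : (p ^ b)%:R^-1 * c * (p ^ v)%:R = c * (p ^ (v - b))%:R.
        rewrite -[in (p ^ v)%N](subnKC bv) expnD natrM mulrAC mulKf ?gt_eqF // mulrC //.
      have := expn_bernoulli (v - b) (prime_gt0 p_prime).
      rewrite -(ler_nat RR) natrD natrM natrB // => H.
      have := ler_wpM2l (ltW c0) H; rewrite mulrDr mulr1 mulrCA mulVf ?gt_eqF // mulr1.
      by lra.
    have : (v%:R + 1 <= b%:R :> RR) by rewrite natr1 ler_nat.
    have : 0 <= (p ^ b)%:R^-1 * c * (p ^ v)%:R.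
      by rewrite !mulr_ge0 ?ler0n ?invr_ge0 // ltW.
    by lra.
  apply: le_trans (ler_wpM2l (ltW e0) H) _.
  rewrite mulrBr lerD2r; apply: le_trans (_ : e%:R * x * n%:R <= _).
    by rewrite -[leRHS]mulrA ler_pM2l // ler_pM // ?mulr_ge0 ?ler0n ?invr_ge0 // ltW.
  by rewrite ler_wpM2r ?ler0n.
have [l1 [l2 lE]] : exists l1 l2 : nat, l = l1%:Z - l2%:Z.
  by case: (l) => k; [exists k, 0%N|exists 0%N, k.+1]; rewrite ?subr0 // NegzE sub0r.
exists m, l1, l2; split; last by apply: elem mlt; rewrite muE.
split=> // [n /lP|].
  by rewrite lE lerBrDr addrAC lerBlDr -!PoszD lez_nat.
apply: nuP; have -> : (l1%:R - l2%:R : RR) = l%:~R by rewrite lE rmorphB /= -!pmulrn.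
have : e%:R * (c - b%:R) <= l%:~R := ceil_ge _.
rewrite mulrC -ler_pdivlMr // => H.
have : b%:R < ratr nu :> RR by rewrite -(ratr_nat RR) ltr_rat.
by lra.
Qed.
End Order.

(** * The special fibre *)

Lemma mulr_congl (S : comNzRingType) (u v w z r : S) :
  u * v = w * z -> u * (v * r) = w * (z * r).
Proof. by move=> E; rewrite !mulrA E. Qed.

(** Properness is included because the quotients must be non-zero rings. *)
Record proper_ideal_set (P : comNzRingType) := ProperIdealSet {
  ideal_set : set P;
  ideal_set0 : ideal_set 0;
  ideal_setD : forall x y, ideal_set x -> ideal_set y -> ideal_set (x + y);
  ideal_setM : forall a x, ideal_set x -> ideal_set (a * x);
  ideal_set1 : ~ ideal_set 1 }.

Section QuotientAlgebra.
Variables (k : comNzRingType) (P : comAlgType k) (J : proper_ideal_set P).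

Definition ideal_pred : {pred P} := fun x => `[< ideal_set J x >].

Fact ideal_pred_closed : idealr_closed ideal_pred.
Proof.
split; first by apply/asboolP; apply: ideal_set0.
  by apply/asboolP; apply: ideal_set1.
move=> a x y /asboolP Jx /asboolP Jy; apply/asboolP.
by apply: ideal_setD => //; apply: ideal_setM.
Qed.

HB.instance Definition _ := isIdealr.Build P ideal_pred ideal_pred_closed.

Definition alg_quot := {ideal_quot ideal_pred}.
HB.instance Definition _ := GRing.ComNzRing.on alg_quot.

Definition alg_pi : P -> alg_quot := \pi_{ideal_quot ideal_pred}%qT.

Fact alg_pi_zmod : zmod_morphism alg_pi.
Proof. exact: raddfB. Qed.
Fact alg_pi_monoid : monoid_morphism alg_pi.
Proof. by split; [exact: rmorph1|exact: rmorphM]. Qed.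
HB.instance Definition _ := GRing.isZmodMorphism.Build P alg_quot alg_pi alg_pi_zmod.
HB.instance Definition _ := GRing.isMonoidMorphism.Build P alg_quot alg_pi alg_pi_monoid.

Lemma alg_piB x y : alg_pi (x - y) = alg_pi x - alg_pi y.
Proof. exact: rmorphB. Qed.
Lemma alg_piM x y : alg_pi (x * y) = alg_pi x * alg_pi y.
Proof. exact: rmorphM. Qed.
Lemma alg_pi1 : alg_pi 1 = 1.
Proof. exact: rmorph1. Qed.

Lemma alg_piP (x : P) : alg_pi x = 0 <-> ideal_set J x.
Proof.
rewrite -(rmorph0 alg_pi); split.
  move=> /eqP; rewrite /alg_pi -Quotient.idealrBE subr0.
  by move/asboolP.
by move=> Jx; apply/eqP; rewrite /alg_pi -Quotient.idealrBE subr0; apply/asboolP.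
Qed.

Lemma alg_pi_eq (x y : P) : alg_pi x = alg_pi y <-> ideal_set J (x - y).
Proof.
rewrite -alg_piP alg_piB; split=> [->|/eqP]; first by rewrite subrr.
by rewrite subr_eq0 => /eqP.
Qed.

Lemma alg_pi_surj (y : alg_quot) : exists x, alg_pi x = y.
Proof. by exists (repr y); rewrite /alg_pi reprK. Qed.

Definition quot_scale (c : k) (y : alg_quot) : alg_quot := alg_pi c%:A * y.

Fact quot_scaleA a b y : quot_scale a (quot_scale b y) = quot_scale (a * b) y.
Proof. by rewrite /quot_scale mulrA -rmorphM -scalerAl mul1r scalerA. Qed.
Fact quot_scale1 : left_id 1 quot_scale.
Proof. by move=> y; rewrite /quot_scale scale1r rmorph1 mul1r. Qed.
Fact quot_scaleDr : right_distributive quot_scale +%R.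
Proof. by move=> c x y; rewrite /quot_scale mulrDr. Qed.
Fact quot_scaleDl y : {morph quot_scale^~ y : a b / a + b}.
Proof. by move=> a b; rewrite /quot_scale scalerDl rmorphD mulrDl. Qed.
HB.instance Definition _ := GRing.Zmodule_isLmodule.Build k alg_quot
  quot_scaleA quot_scale1 quot_scaleDr quot_scaleDl.
Fact quot_scaleAl (c : k) (x y : alg_quot) : c *: (x * y) = c *: x * y.
Proof. exact: mulrA. Qed.
HB.instance Definition _ := GRing.Lmodule_isLalgebra.Build k alg_quot quot_scaleAl.
HB.instance Definition _ := GRing.Lalgebra_isComAlgebra.Build k alg_quot.

Lemma alg_piZ c x : alg_pi (c *: x) = c *: alg_pi x.
Proof. by rewrite -[x in LHS]mul1r scalerAl alg_piM. Qed.

End QuotientAlgebra.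

(** * Formally smooth algebras over a finite field are reduced *)

Section Reducedness.
Variables (k : comNzRingType) (X : choiceType) (A : comAlgType k).
Local Notation P := (malg (cmonom X) k).
Variable f : {lrmorphism P -> A}.

(** Representatives of an algebra morphism from A to P / J that is a section of f; working with
    representatives keeps the induction on ideals inside P. *)
Definition section_mod (J : set P) (s : A -> P) : Prop :=
  [/\ forall a, f (s a) = a,
      forall a b, J (s (a - b) - (s a - s b)),
      forall a b, J (s (a * b) - s a * s b),
      J (s 1 - 1)
    & forall c a, J (s (c *: a) - c *: s a)].

(** P / I -> P / J is surjective with kernel of square zero, so formal smoothness lifts A -> P / J
    to P / I. The lift is still a section of f because it agrees with s modulo J, which f kills. *)
Lemma section_mod_lift (I J : proper_ideal_set P) (s : A -> P) :
  formally_smooth A ->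
  (forall x, ideal_set I x -> ideal_set J x) ->
  (forall x y, ideal_set J x -> ideal_set J y -> ideal_set I (x * y)) ->
  (forall x, ideal_set J x -> f x = 0) ->
  section_mod (ideal_set J) s -> exists s', section_mod (ideal_set I) s'.
Proof.
move=> smA IJ JJ Jf [fs sB sM s1 sZ].
pose F (y : alg_quot I) : alg_quot J := alg_pi J (repr y).
have FE x : F (alg_pi I x) = alg_pi J x.
  apply/alg_pi_eq/IJ/alg_pi_eq.
  by rewrite /alg_pi reprK.
have FB : zmod_morphism F.
  move=> y z; have [[u <-] [v <-]] := (alg_pi_surj y, alg_pi_surj z).
  by rewrite -alg_piB !FE alg_piB.
have FM : monoid_morphism F.
  split; first by rewrite -(alg_pi1 I) FE alg_pi1.
  move=> y z; have [[u <-] [v <-]] := (alg_pi_surj y, alg_pi_surj z).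
  by rewrite -alg_piM !FE alg_piM.
have FZ : scalable F.
  by move=> c y; have [u <-] := alg_pi_surj y; rewrite -alg_piZ !FE alg_piZ.
pose FL : {lrmorphism alg_quot I -> alg_quot J} := HB.pack F
  (GRing.isZmodMorphism.Build _ _ F FB) (GRing.isMonoidMorphism.Build _ _ F FM)
  (GRing.isScalable.Build k _ _ *:%R F FZ).
pose G (a : A) : alg_quot J := alg_pi J (s a).
have GB : zmod_morphism G by move=> a b; rewrite /G -alg_piB; apply/alg_pi_eq.
have GM : monoid_morphism G.
  split; first by rewrite -(alg_pi1 J); apply/alg_pi_eq.
  by move=> a b; rewrite /G -alg_piM; apply/alg_pi_eq.
have GZ : scalable G by move=> c a; rewrite /G -alg_piZ; apply/alg_pi_eq.
pose GL : {lrmorphism A -> alg_quot J} := HB.pack G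
  (GRing.isZmodMorphism.Build _ _ G GB) (GRing.isMonoidMorphism.Build _ _ G GM)
  (GRing.isScalable.Build k _ _ *:%R G GZ).
have rangeF : range FL = setT.
  apply/seteqP; split=> // y _; have [u <-] := alg_pi_surj y.
  by exists (alg_pi I u) => //; rewrite [LHS]FE.
have sqF x y : FL x = 0 -> FL y = 0 -> x * y = 0.
  have [[u <-] [v <-]] := (alg_pi_surj x, alg_pi_surj y).
  rewrite [FL _]FE [FL (alg_pi I v)]FE => /alg_piP Ju /alg_piP Jv.
  rewrite -alg_piM.
  by apply/alg_piP/JJ.
have [h hE] := smA _ _ FL rangeF sqF GL.
have piK a : alg_pi I (repr (h a)) = h a by rewrite /alg_pi reprK.
exists (fun a => repr (h a)); split.
- move=> a; rewrite -[RHS]fs.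
  apply/eqP; rewrite -subr_eq0 -rmorphB; apply/eqP/Jf/alg_pi_eq.
  by rewrite -FE piK; exact: hE.
- by move=> a b; apply/alg_pi_eq; rewrite alg_piB !piK rmorphB.
- by move=> a b; apply/alg_pi_eq; rewrite alg_piM !piK rmorphM.
- by apply/alg_pi_eq; rewrite alg_pi1 piK rmorph1.
by move=> c a; apply/alg_pi_eq; rewrite alg_piZ !piK linearZ.
Qed.

Definition gen_ideal (r : nat) (h : 'I_r -> P) : set P :=
  [set x | exists c, x = \sum_i c i * h i].

Variable q : nat.
Hypothesis q_gt1 : (1 < q)%N.
Hypothesis expk_q : forall c : k, c ^+ q = c.
Hypothesis exprDq : forall x y : P, (x + y) ^+ q = x ^+ q + y ^+ q.

Local Notation cm_scale m a := (iter m (mulcm a) (onecm X)).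

Lemma monalgUM (c d : k) (a b : cmonom X) :
  mkmalgU a c * mkmalgU b d = mkmalgU (mulcm a b) (c * d) :> P.
Proof. by rewrite malgM_def fgmulUU. Qed.

Lemma monalgUX m (c : k) (a : cmonom X) :
  mkmalgU a c ^+ m = mkmalgU (cm_scale m a) (c ^+ m) :> P.
Proof.
elim: m => [|m IH]; first by rewrite !expr0.
rewrite exprS IH monalgUM [c ^+ m.+1]exprS; congr mkmalgU.
Qed.

(** Rounded division of the exponents gives the only candidate for a q-th root; the test discards
    monomials that are not q-th powers. *)
Definition cm_root (a : cmonom X) : P :=
  let b : cmonom X := cmonom_of_fsfun cmonom_key
     [fsfun i in finsupp a => (a i %/ q)%N | 0%N] in
  if cm_scale q b == a then mkmalgU b 1 else 0.

Lemma cm_root_scale (a b : cmonom X) :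
  cm_root (mulcm (cm_scale q b) a) = mkmalgU b 1 * cm_root a.
Proof.
have q0 : (0 < q)%N := ltnW q_gt1.
rewrite /cm_root; set u := cmonom_of_fsfun _ _; set v := cmonom_of_fsfun _ _.
have uE i : u i = (mulcm (cm_scale q b) a i %/ q)%N.
  by rewrite /u cmE fsfun_fun; case: finsuppP; rewrite ?div0n.
have vE i : v i = (a i %/ q)%N.
  by rewrite /v cmE fsfun_fun; case: finsuppP; rewrite ?div0n.
have uv : u = mulcm b v.
  apply/eqP/cmP => i; rewrite mulcmE uE vE mulcmE iter_mulcmE.
  by rewrite mulnC divnMDl.
have -> : (cm_scale q u == mulcm (cm_scale q b) a) = (cm_scale q v == a).
  apply/cmP/cmP => H i; have := H i; rewrite ?mulcmE !iter_mulcmE uv mulcmE.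
    by rewrite mulnDr => /addnI.
  by rewrite mulnDr => ->.
by case: eqP => _; rewrite ?mulr0 // monalgUM mulr1 uv.
Qed.

(* The linear map keeping the coefficients of the q-th powers of monomials and
   dividing their exponents by q: a left inverse of x |-> x^q. *)
Definition frob_split (g : P) : P := mmap (@mkmalgU _ k (onecm _)) cm_root g.

Lemma frob_split_sum (T : Type) (r : seq T) (F : T -> P) :
  frob_split (\sum_(i <- r) F i) = \sum_(i <- r) frob_split (F i).
Proof. exact: raddf_sum. Qed.

Lemma frob_splitU (c : k) a : frob_split (mkmalgU a c) = mkmalgU (onecm _) c * cm_root a.
Proof. exact: mmapU. Qed.

(** As q-th powers are additive and c^q = c on coefficients, it suffices to take x to be a single
    term, where [cm_root_scale] applies. *)
Lemma frob_splitM (x y : P) : frob_split (x ^+ q * y) = x * frob_split y.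
Proof.
have := cm_root_scale; have := frob_splitU; have := frob_split_sum.
move: frob_split cm_root => F rt FS FU rtS.
have mon b (c : k) : F (mkmalgU b c ^+ q * y) = mkmalgU b c * F y.
  rewrite [y]monalgE mulr_sumr !FS mulr_sumr; apply: eq_bigr => a _.
  have -> : mkmalgU b c ^+ q = mkmalgU (cm_scale q b) c :> P.
    by rewrite monalgUX expk_q.
  rewrite [X in F X]monalgUM [in RHS]FU [in LHS]FU rtS.
  by apply: mulr_congl; rewrite [LHS]monalgUM [RHS]monalgUM mul0cm mulcm0 mulr1.
rewrite [x]monalgE.
have -> (s : seq (cmonom X)) (G : cmonom X -> P) :
    (\sum_(i <- s) G i) ^+ q = \sum_(i <- s) G i ^+ q.
  apply: (big_morph (fun z : P => z ^+ q)); first exact: exprDq.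
  by rewrite expr0n -[q]prednK // ltnW // q_gt1.
by rewrite !mulr_suml FS; apply: eq_bigr => b _; apply: mon.
Qed.

Lemma frob_split1 : frob_split 1 = 1.
Proof.
rewrite [LHS](frob_splitU 1) /cm_root; set b := cmonom_of_fsfun _ _.
have bE : b = onecm _.
  apply/eqP/cmP => i; rewrite /b cmE fsfun_fun; case: finsuppP; rewrite ?onecmE //.
  by rewrite div0n.
rewrite bE ifT ?mulr1 //.
by apply/cmP => i; rewrite iter_mulcmE !onecmE muln0.
Qed.

Lemma gen_idealD r (h : 'I_r -> P) x y :
  gen_ideal h x -> gen_ideal h y -> gen_ideal h (x + y).
Proof.
move=> [c ->] [d ->]; exists (fun i => c i + d i).
by rewrite -big_split; apply: eq_bigr => i _; rewrite mulrDl.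
Qed.

Lemma gen_idealM r (h : 'I_r -> P) a x : gen_ideal h x -> gen_ideal h (a * x).
Proof.
move=> [c ->]; exists (fun i => a * c i).
by rewrite mulr_sumr; apply: eq_bigr => i _; rewrite mulrA.
Qed.

Lemma gen_ideal0 r (h : 'I_r -> P) : gen_ideal h 0.
Proof. by exists (fun=> 0); rewrite big1 // => i _; rewrite mul0r. Qed.

Lemma gen_ideal_gen r (h : 'I_r -> P) i : gen_ideal h (h i).
Proof.
exists (fun j => (j == i)%:R); rewrite (bigD1 i) //= eqxx mul1r big1 ?addr0 //.
by move=> j /negbTE ->; rewrite mul0r.
Qed.

Lemma gen_ideal_sum r (h : 'I_r -> P) (T : Type) (s : seq T) (F : T -> P) :
  (forall i, gen_ideal h (F i)) -> gen_ideal h (\sum_(i <- s) F i).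
Proof.
move=> hF; elim/big_ind: _ => //; [exact: gen_ideal0|exact: gen_idealD].
Qed.

Lemma gen_ideal_ker r (h : 'I_r -> P) x :
  (forall i, f (h i) = 0) -> gen_ideal h x -> f x = 0.
Proof.
by move=> fh [c ->]; rewrite rmorph_sum big1 // => i _; rewrite rmorphM /= fh mulr0.
Qed.

Lemma gen_ideal_not1 r (h : 'I_r -> P) : (forall i, f (h i) = 0) -> ~ gen_ideal h 1.
Proof. by move=> fh /(gen_ideal_ker fh); rewrite rmorph1 => /eqP; rewrite oner_eq0. Qed.

(* One exponent is raised at a time: (x^a, I)^2 is contained in (x^(a+1), I). *)
Lemma section_mod_powers r (h : 'I_r -> P) (e : 'I_r -> nat) :
  formally_smooth A -> (forall y, exists x, f x = y) ->
  (forall x, f x = 0 <-> gen_ideal h x) -> (forall i, 0 < e i)%N ->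
  exists s, section_mod (gen_ideal (fun i => h i ^+ e i)) s.
Proof.
move=> smA surjf kerf.
have fh i : f (h i) = 0 by apply/kerf/gen_ideal_gen.
have [t le_t] := ubnP (\sum_i e i)%N; elim: t e le_t => // t IH e le_t e_gt0.
have fhe (e' : 'I_r -> nat) : (forall i, 0 < e' i)%N -> forall i, f (h i ^+ e' i) = 0.
  by move=> e'0 i; rewrite rmorphXn /= fh expr0n gtn_eqF.
have [[i ei]|e1] := pselect (exists i, 1 < e i)%N; last first.
  (* All exponents are 1, so the ideal is the kernel of f and any set-theoretic section will do. *)
  have /choice [s sK] : forall y, exists x, f x = y := surjf.
  have kerf' x : f x = 0 -> gen_ideal (fun i => h i ^+ e i) x.
    move=> /kerf [c ->]; exists c; apply: eq_bigr => i _.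
    have -> : e i = 1%N; last by rewrite expr1.
    by apply/eqP; rewrite eqn_leq e_gt0 andbT leqNgt; apply/negP => ?; apply: e1; exists i.
  exists s; split=> [//|a b|a b||c a]; apply: kerf'; apply/eqP;
    rewrite rmorphB subr_eq0 /= sK ?rmorphB ?rmorphM ?rmorph1 ?linearZ //=;
    by rewrite !sK.
pose e' j := (e j - (j == i))%N.
have e'0 j : (0 < e' j)%N by rewrite /e'; case: eqP => [->|_]; have := e_gt0 j; lia.
have e'i : (e i = e' i + 1)%N by rewrite /e' eqxx; lia.
have e'j j : j != i -> e' j = e j by rewrite /e' => /negbTE ->; rewrite subn0.
have lt_t : (\sum_j e' j < t)%N.
  have sE : (\sum_j e j = e i + \sum_(j | j != i) e' j)%N.
    by rewrite (bigD1 i) //=; congr addn; apply: eq_bigr => j /e'j.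
  by move: le_t; rewrite sE e'i [X in _ -> (X < _)%N](bigD1 i) //= addnAC addn1.
have [s sP] := IH _ lt_t e'0.
pose mk (d : 'I_r -> nat) (d0 : forall i, (0 < d i)%N) :=
  ProperIdealSet (gen_ideal0 (fun i => h i ^+ d i))
    (@gen_idealD _ (fun i => h i ^+ d i)) (@gen_idealM _ (fun i => h i ^+ d i))
    (@gen_ideal_not1 _ (fun i => h i ^+ d i) (fhe d d0)).
refine (@section_mod_lift (mk e e_gt0) (mk e' e'0) s smA _ _ _ sP).
- move=> _ [c ->]; apply: gen_ideal_sum => j; apply: gen_idealM.
  have -> : e j = ((j == i) + e' j)%N.
    by rewrite /e'; case: (eqVneq j i) => [->|_]; have := e_gt0 i; lia.
  by rewrite exprD; apply: gen_idealM; exact: (@gen_ideal_gen _ (fun i => h i ^+ e' i)).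
- move=> _ _ [c ->] [d ->]; rewrite mulr_suml; apply: gen_ideal_sum => j.
  rewrite mulr_sumr; apply: gen_ideal_sum => l.
  rewrite mulrACA; apply: gen_idealM; have [ji|ji] := eqVneq j i; last first.
    rewrite (e'j _ ji) mulrC; apply: gen_idealM.
    exact: (@gen_ideal_gen _ (fun i => h i ^+ e i)).
  have [li|li] := eqVneq l i; last first.
    rewrite (e'j _ li); apply: gen_idealM.
    exact: (@gen_ideal_gen _ (fun i => h i ^+ e i)).
  (* The only product needing both factors: h_i occurs with exponent 2 e'_i, and 2 e'_i >= e'_i + 1
     = e_i. *)
  rewrite ji li -exprD; have -> : (e' i + e' i = (e' i).-1 + e i)%N.
    by rewrite e'i; have := e'0 i; lia.
  by rewrite exprD; apply: gen_idealM; exact: (@gen_ideal_gen _ (fun i => h i ^+ e i)).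
by move=> x; apply: gen_ideal_ker => i0; apply: fhe e'0 i0.
Qed.

(** For a section s modulo (h_i^q), a^q = 0 puts s(a)^q in (h_i^q). Applying [frob_split] to s(a)^q
    = sum of c_i h_i^q puts s(a) in (h_i), the kernel of f, so a = f (s a) = 0. *)
Lemma formally_smooth_reduced (a : A) : formally_smooth A -> (forall y, exists x, f x = y) ->
  (exists r (h : 'I_r -> P), forall x, f x = 0 <-> gen_ideal h x) ->
  a ^+ q = 0 -> a = 0.
Proof.
move=> smA surjf [r [h kerf]] aq0.
have [s [fs sB sM s1 sZ]] := section_mod_powers smA surjf kerf (fun=> ltnW q_gt1).
pose J := gen_ideal (fun i => h i ^+ q).
have s0 : J (s 0) by have := sB 0 0; rewrite !subrr subr0.
have sX m : J (s (a ^+ m) - s a ^+ m).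
  elim: m => [|m IH]; first by rewrite !expr0.
  rewrite !exprS (_ : _ - _ = s (a * a ^+ m) - s a * s (a ^+ m)
     + s a * (s (a ^+ m) - s a ^+ m)); last by ring.
  by apply: gen_idealD; [exact: sM|exact: gen_idealM].
have [c cE] : J (s a ^+ q).
  rewrite (_ : s a ^+ q = s 0 + (- 1) * (s (a ^+ q) - s a ^+ q)); last by rewrite aq0; ring.
  apply: gen_idealD; first exact: s0.
  exact: gen_idealM (sX q).
rewrite -(fs a); apply/kerf; exists (fun i => frob_split (c i)).
have := frob_splitM (s a) 1; rewrite mulr1 frob_split1 mulr1 => <-.
rewrite cE frob_split_sum; apply: eq_bigr => i _.
by rewrite mulrC frob_splitM mulrC.
Qed.

End Reducedness.

Lemma finField_exprD (k : finFieldType) (L : comAlgType k) (x y : L) :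
  (x + y) ^+ #|k| = x ^+ #|k| + y ^+ #|k|.
Proof.
have [c _ kc] := finPcharP k; apply: exprDn_pchar.
have -> : #|k| = (c ^ logn c #|k|)%N by exact: (card_pprimeChar kc).
rewrite pnatX; apply/orP; left.
apply: (@sub_in_pnat (pred1 c)); last by rewrite pnat_id // (pcharf_prime kc).
by move=> c' _ /eqP ->; rewrite pchar_lalg.
Qed.

Theorem smooth_reduced (k : finFieldType) (A : comAlgType k) (a : A) :
  smooth_algebra A -> a ^+ #|k| = 0 -> a = 0.
Proof.
move=> [[n [m [f [h [fsurj kerf]]]]] smA].
apply: (@formally_smooth_reduced k _ A f #|k|) => //.
- exact: finNzRing_gt1.
- exact: expf_card.
- exact: finField_exprD.
- move=> y; have [x _ <-] : range f y by rewrite fsurj.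
  by exists x.
by exists m, h.
Qed.

(** An ideal maximal among those whose sum with fA is proper contains f and is prime. *)
Lemma prime_of_nonunit (A : comNzRingType) (f : A) :
  ~ (exists g, f * g = 1) -> exists P, prime_ideal P /\ P f.
Proof.
move=> fN1.
(* Zorn's lemma also asks for the union of the empty chain, so J need not contain 0; the disjunct
   [x = 0] keeps the last condition meaningful for the empty set. *)
pose ok (J : set A) := [/\ forall x y, J x -> J y -> J (x + y),
  forall a x, J x -> J (a * x) & forall x a, J x \/ x = 0 -> x + f * a <> 1].
have [F FP totF|M [[MD MM MN1] maxM]] := @Zorn_bigcup A ok.
  split=> [x y [X FX Xx] [Y FY Yy]|a x [X FX Xx]|x a [[X FX Xx]|->]].
  - have [XY|YX] := totF _ _ FX FY.
      by exists Y => //; have [YD _ _] := FP _ FY; apply: YD => //; apply: XY.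
    by exists X => //; have [XD _ _] := FP _ FX; apply: XD => //; apply: YX.
  - by exists X => //; have [_ XM _] := FP _ FX; apply: XM.
  - by have [_ _ XN] := FP _ FX; apply: XN; left.
  by rewrite add0r => fa1; apply: fN1; exists a.
have [M0 Mf] : M 0 /\ M f.
  pose N := [set x | exists m a, (M m \/ m = 0) /\ x = m + f * a].
  have sMN : M `<=` N by move=> x Mx; exists x, 0; rewrite mulr0 addr0; split; [left|].
  have okN : ok N.
    split=> [_ _ [m [a [Mm ->]]] [m' [a' [Mm' ->]]]|b _ [m [a [Mm ->]]]|x b].
    - exists (m + m'), (a + a'); split; last by ring.
      by case: Mm Mm' => [Mm|->] [Mm'|->]; rewrite ?addr0 ?add0r; auto.
    - exists (b * m), (a * b); split; last by ring.
      by case: Mm => [Mm|->]; rewrite ?mulr0; auto.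
    case=> [[m [a [Mm ->]]]|->]; last by apply: MN1; right.
    by rewrite -addrA -mulrDr; apply: MN1.
  have NM : N `<=` M by apply: contrapT => NM; exact: (maxM N).
  split; apply: NM; first by exists 0, 0; split; [right|rewrite mulr0 addr0].
  by exists 0, 1; split; [right|rewrite mulr1 add0r].
exists M; split=> //; split=> // [M1|x y Mxy]; first by apply: (MN1 1 0); [left|rewrite mulr0 addr0].
apply: contrapT => /not_orP [Mx My].
have ext z : ~ M z -> exists m a, M m /\ m + z * a = 1.
  move=> Mz; apply: contrapT => no.
  pose N := [set x | exists m a, M m /\ x = m + z * a].
  apply: (maxM N).
    split=> [w Mw|NM]; first by exists w, 0; rewrite mulr0 addr0.
    by apply: Mz; apply: NM; exists 0, 1; rewrite add0r mulr1.
  split=> [_ _ [m [a [Mm ->]]] [m' [a' [Mm' ->]]]|b _ [m [a [Mm ->]]]|w b].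
  - by exists (m + m'), (a + a'); split; [apply: MD|ring].
  - by exists (b * m), (a * b); split; [apply: MM|ring].
  case=> [[m [a [Mm ->]]]|->] e; apply: no.
    exists (m + b * f), a; split; first by apply: MD => //; apply: MM.
    by rewrite -e; ring.
  by exists (b * f), 0; split; [apply: MM|rewrite -e; ring].
have [m [a [Mm ma]]] := ext x Mx; have [m' [a' [Mm' ma']]] := ext y My.
apply: (MN1 (m * (m' + y * a') + m' * (x * a) + (a * a') * (x * y)) 0); last first.
  by rewrite -[RHS](mulr1 1) -{1}ma -ma'; ring.
left; apply: (MD); last exact: MM.
by apply: MD; rewrite mulrC; apply: MM.
Qed.

(* X^q - X splits into pairwise comaximal factors over k, and connectedness
   leaves only one of them. *)
Theorem connected_frobenius_fixed (k : finFieldType) (A : comAlgType k) (y : A) :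
  connected_spectrum A -> y ^+ #|k| = y -> exists c : k, y = c%:A.
Proof.
move=> [[P0 P0prime] conn] yq.
have prodE : \prod_(c : k) (y - c%:A) = 0.
  have := congr1 (fun p : {poly k} => (map_poly (in_alg A) p).[y]) (finField_genPoly k).
  rewrite rmorphB /= map_polyXn map_polyX !hornerE yq subrr rmorph_prod horner_prod => E.
  transitivity (\prod_(c : k) (map_poly (in_alg A) ('X - c%:P)).[y]); last exact: esym.
  by apply: eq_bigr => c _; rewrite rmorphB /= map_polyX map_polyC !hornerE.
have prime_prod (P : set A) (F : k -> A) (S : pred k) : prime_ideal P ->
    P (\prod_(c | S c) F c) -> exists2 c, S c & P (F c).
  move=> [_ _ _ P1 PM]; elim/big_rec: _ => // c x Sc IH /PM [?|/IH//].
  by exists c.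
(* A point of the spectrum selects the factor: its zero set is not empty, so that of the
   complementary product [g] is, and [g] is a unit. *)
have [c0 _ Pc0] : exists2 c, true & P0 (y - c%:A).
  by apply: (prime_prod P0) => //; rewrite prodE; case: P0prime.
exists c0; apply/eqP; rewrite -subr_eq0; apply/eqP.
pose g := \prod_(c | c != c0) (y - c%:A).
have gE : (y - c0%:A) * g = 0 by rewrite -prodE [RHS](bigD1 c0).
pose Z1 := [set P | prime_ideal P /\ [set y - c0%:A] `<=` P].
pose Z2 := [set P | prime_ideal P /\ [set g] `<=` P].
have Z12 : Z1 `|` Z2 = Spec A.
  apply/seteqP; split=> [P [[]|[]]//|P primeP].
  have [_ _ _ _ PM] := primeP.
  have [P1|P2] : P (y - c0%:A) \/ P g by apply: PM; rewrite gE; case: primeP.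
    by left; split=> // _ ->.
  by right; split=> // _ ->.
have Z120 : Z1 `&` Z2 = set0.
  apply/seteqP; split=> // P [[primeP P1] [_ P2]].
  have [c cc0 Pc] := prime_prod P (fun c => y - c%:A) _ primeP (P2 _ erefl).
  have [P0' PD PM PN1 _] := primeP; apply: PN1.
  have -> : 1 = (c - c0)^-1%:A * ((y - c0%:A) + (-1) * (y - c%:A)) :> A.
    rewrite (_ : y - c0%:A + -1 * (y - c%:A) = (c - c0)%:A); last by rewrite scalerBl; ring.
    by rewrite -scalerAl mul1r scalerA mulVf ?scale1r // subr_eq0.
  by apply: (PM); apply: PD; [apply: P1|apply: PM].
have [E|E] := conn Z1 Z2 (ex_intro _ _ erefl) (ex_intro _ _ erefl) Z12 Z120.
  have : Z1 P0 by split=> // _ ->.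
  by rewrite E.
have [u gu] : exists u, g * u = 1.
  apply: contrapT => /prime_of_nonunit [P [primeP Pg]].
  have : Z2 P by split=> // _ ->.
  by rewrite E.
by transitivity ((y - c0%:A) * (g * u)); [rewrite gu mulr1|rewrite mulrA gE mul0r].
Qed.

(** * Similar matrices *)

Section MatrixCongruence.
Variables (E : comNzRingType) (t : E) (I : choiceType).
Implicit Types X Y Z : imatrix I I E.

Lemma adic_sum_mod m (u : I -> E) l k0 : (forall k, k != k0 -> in_ideal (t ^+ m) (u k)) ->
  adic_sum t u l -> in_ideal (t ^+ m) (l - u k0).
Proof.
move=> uk /(_ m) [F FP]; apply: (@in_ideal_trans _ _ (\sum_(x <- (k0 |` F)%fset) u x)).
  by apply: in_ideal_sym; apply: FP; exact: fsubsetUr.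
rewrite (big_fsetD1 k0) ?fset1U1 //= addrAC subrr add0r.
by apply: in_ideal_sum => k; rewrite in_fsetD1 => /andP[/uk].
Qed.

Lemma mx_product_modl m X Y Z i j k0 : (forall k, k != k0 -> in_ideal (t ^+ m) (X i k)) ->
  is_mx_product t X Y Z -> in_ideal (t ^+ m) (Z i j - X i k0 * Y k0 j).
Proof.
move=> Xk XYZ; apply: (adic_sum_mod (u := fun k => X i k * Y k j)) (XYZ i j) => k /Xk.
exact: in_idealMr.
Qed.

Lemma mx_product_modr m X Y Z i j k0 : (forall k, k != k0 -> in_ideal (t ^+ m) (Y k j)) ->
  is_mx_product t X Y Z -> in_ideal (t ^+ m) (Z i j - X i k0 * Y k0 j).
Proof.
move=> Yk XYZ; apply: (adic_sum_mod (u := fun k => X i k * Y k j)) (XYZ i j) => k /Yk.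
exact: in_idealM.
Qed.

Definition column_mod m (i0 : I) X (c : E) := in_ideal (t ^+ m) (X i0 i0 - c) /\
  forall i, i != i0 -> in_ideal (t ^+ m) (X i i0).

Variables (s : {rmorphism E -> E}) (i0 : I) (m : nat) (M1 M2 S S' P Q : imatrix I I E).
Hypothesis st : s t = t.
Hypothesis M1_elem : elementary_mod t i0 M1 m.
Hypothesis M2_elem : elementary_mod t i0 M2 m.
Hypothesis SS' : is_mx_product t S S' (@mx_identity E I).
Hypothesis S'M1 : is_mx_product t S' M1 P.
Hypothesis PS : is_mx_product t P (mx_map s S) M2.
Hypothesis M1S : is_mx_product t M1 (mx_map s S) Q.

(** Modulo t^m, [P] has the column i0 of S' and zeros elsewhere, so P S^sigma = M2 gives S'_00
    sigma(S_00) = 1 and S'_i0 sigma(S_00) = 0 for i distinct from i0. The unit sigma(S_00) forces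
    these S'_i0 to vanish. Now S S' = 1 gives S_00 S'_00 = 1, and S_00 = S_00 S'_00 sigma(S_00) =
    sigma(S_00). *)
Lemma similar_columns : [/\ in_ideal (t ^+ m) (s (S i0 i0) - S i0 i0),
  in_ideal (t ^+ m) (S i0 i0 * S' i0 i0 - 1) & forall c c', c * c' = 1 -> in_ideal (t ^+ m) (S i0 i0 - c') ->
  [/\ column_mod m i0 S c', column_mod m i0 S' c, column_mod m i0 P c
    & forall d, s c' = d -> column_mod m i0 Q d]].
Proof.
have [M1_00 M1_ij] := M1_elem; have [M2_00 M2_ij] := M2_elem.
have neq i : i != i0 -> (i, i0) != (i0, i0) by apply: contra => /eqP[->].
have neq' i k : k != i0 -> (i, k) != (i0, i0) by apply: contra => /eqP[_ ->].
have PE i k : in_ideal (t ^+ m) (P i k - S' i i0 * M1 i0 k).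
  have [->|k0] := eqVneq k i0; first by apply: mx_product_modr S'M1 => l /neq; apply: M1_ij.
  by apply: mx_product_modr S'M1 => l _; apply: M1_ij; apply: neq'.
have P0 i : in_ideal (t ^+ m) (P i i0 - S' i i0).
  apply: in_ideal_trans (PE i i0) _; rewrite -[X in _ - X]mulr1 -mulrBr.
  exact: in_idealM.
have Pk i k : k != i0 -> in_ideal (t ^+ m) (P i k).
  move=> k0; apply: in_ideal_subl1 (PE i k) _; apply: in_idealM; apply: M1_ij; exact: neq'.
have M2E i : in_ideal (t ^+ m) (M2 i i0 - S' i i0 * s (S i0 i0)).
  apply: (@in_ideal_trans _ _ (P i i0 * mx_map s S i0 i0)).
    by apply: mx_product_modl PS => k; apply: Pk.
  by rewrite -mulrBl; apply: in_idealMr.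
have S'S : in_ideal (t ^+ m) (S' i0 i0 * s (S i0 i0) - 1).
  by apply: in_ideal_trans (in_ideal_sym (M2E i0)) M2_00.
have S'0 i : i != i0 -> in_ideal (t ^+ m) (S' i i0).
  move=> ii0; have : in_ideal (t ^+ m) (S' i i0 * s (S i0 i0)).
    by apply: in_ideal_subl1 (in_ideal_sym (M2E i)) _; apply: M2_ij; apply: neq.
  move=> /(in_idealM (S' i0 i0)) H.
  apply: in_ideal_subl1 H; apply: in_ideal_sym; rewrite mulrCA.
  by rewrite -[X in _ - X]mulr1 -mulrBr; apply: in_idealM.
have SS'E i : in_ideal (t ^+ m) ((i == i0)%:R - S i i0 * S' i0 i0).
  by apply: (mx_product_modr (Z := @mx_identity E I)) SS' => k; apply: S'0.
have SS'0 : in_ideal (t ^+ m) (S i0 i0 * S' i0 i0 - 1).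
  by apply: in_ideal_sym; have := SS'E i0; rewrite eqxx.
have S0 i : i != i0 -> in_ideal (t ^+ m) (S i i0).
  move=> ii0; have := SS'E i; rewrite (negbTE ii0) sub0r => /in_idealN; rewrite opprK.
  move=> /(in_idealMr (s (S i0 i0))) H.
  apply: in_ideal_subl1 H; apply: in_ideal_sym; rewrite -mulrA.
  by rewrite -[X in _ - X]mulr1 -mulrBr; apply: in_idealM.
split=> [||c c' cc' Sc] //.
  apply: (@in_ideal_trans _ _ (S i0 i0 * S' i0 i0 * s (S i0 i0))).
    rewrite -[X in X - _]mul1r -mulrBl; apply: in_idealMr; exact: in_ideal_sym.
  by rewrite -mulrA -[X in _ - X]mulr1 -mulrBr; apply: in_idealM.
have S'c : in_ideal (t ^+ m) (S' i0 i0 - c).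
  rewrite (_ : _ - _ = c * ((S i0 i0 * S' i0 i0 - 1) - (S i0 i0 - c') * S' i0 i0)
    + (1 - c * c') * S' i0 i0); last by ring.
  rewrite cc' subrr mul0r addr0; apply: in_idealM; apply: in_idealB => //.
  exact: in_idealMr.
have QE i : in_ideal (t ^+ m) (Q i i0 - M1 i i0 * s (S i0 i0)).
  by apply: mx_product_modl M1S => k k0; apply: M1_ij; exact: neq'.
split=> [|||_ <-]; split=> //.
- exact: in_ideal_trans (P0 i0) S'c.
- by move=> i /S'0; apply: in_ideal_subl1.
- apply: in_ideal_trans (QE i0) _; apply: (@in_ideal_trans _ _ (s (S i0 i0))).
    by rewrite -[X in _ - X]mul1r -mulrBl; apply: in_idealMr.
  by have [y yE] := Sc; exists (s y); rewrite -rmorphB yE rmorphM rmorphXn /= st.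
move=> i ii0; apply: in_ideal_subl1 (QE i) _; apply: in_idealMr.
by apply: M1_ij; apply: neq.
Qed.
End MatrixCongruence.

Section SimilarB.
Variables (T : comNzRingType) (t : T).
Hypothesis t_reg : GRing.lreg t.
Hypothesis T_complete : adic_complete t.
Variable p : nat.
Hypothesis p_prime : prime p.
Hypothesis p_t : in_ideal t (p%:R : T).
Hypothesis nat_reg : forall n, (0 < n)%N -> GRing.lreg (n%:R : T).
Variables (m l1 l2 : nat) (delta gamma : nat -> T).
Hypothesis m_gt0 : (0 < m)%N.
Hypothesis delta0 : delta 0 = 0.
Hypothesis deltaE : forall n, (0 < n)%N ->
  n%:R * t ^+ l1 * delta n = (-1) ^+ n.+1 * t ^+ (m * n + l2).
Hypothesis delta_null : adic_null t delta.
Hypothesis gamma0 : gamma 0 = 1.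
Hypothesis gammaM : forall i j, gamma i * gamma j = 'C(i + j, i)%:R * gamma (i + j).
Hypothesis gamma_null : adic_null t gamma.
Variable s : {rmorphism T -> T}.
Hypothesis st : s t = t.
Hypothesis s_delta : forall n, s (delta n) = delta n.
Hypothesis s_gamma : forall n, s (gamma n) = gamma n.
Variables (I : choiceType) (i0 : I).
Local Notation C := (pseries (complement1 i0) T).
Local Notation lam := (lambda (idfun : {rmorphism T -> T}) i0).
Local Notation pw := (pwC t delta gamma).

Lemma normalized_ex X c : column_mod t m i0 X c -> (exists c', c * c' = 1) ->
  exists z : C, normalized t m X c z.
Proof.
move=> [X0 Xi] cU; have [c' cc'] := cU.
have /choice [a aE] i : exists a, X i i0 = c * (i == i0)%:R + t ^+ m * a.
  have [->|/Xi [a ->]] := eqVneq i i0; last by exists a; rewrite mulr0 add0r.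
  by have [a aE] := X0; exists a; rewrite mulr1 -aE addrC subrK.
exists (c' *: lam a); split=> //; apply/funext => q.
rewrite !(ps_coefZ, ps_coefD) ps_coef1.
have [[i ->]|no] := pselect (exists i, q = emb i0 i).
  rewrite !lam_emb -(emb0 i0) (inj_eq (@emb_inj _ i0)) aE mulrDr; congr (_ + _).
  by rewrite mulrCA [c * _]mulrA cc' mul1r.
have qN i : q <> emb i0 i by move=> qi; apply: no; exists i.
rewrite !lam_out // !mulr0 addr0; case: eqP => [q1|]; last by rewrite mulr0.
by case: (qN i0); rewrite emb0.
Qed.

Lemma normalized_map X c z : normalized t m X c z ->
  normalized t m (mx_map s X) (s c) (ps_map s z : C).
Proof.
move=> [[c' cc'] XE]; split; first by exists (s c'); rewrite -rmorphM cc' rmorph1.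
rewrite -[lam _]/(lam (s \o (X^~ i0))) -ps_map_lam XE ps_mapZ rmorphD rmorph1 /=.
by rewrite ps_mapZ rmorphXn /= st.
Qed.

Lemma mx_product_bmat X Y Z c d cd zX zY zZ r : is_mx_product t X Y Z -> c * d = cd ->
  normalized t m X c zX -> normalized t m Y d zY -> normalized t m Z cd zZ ->
  is_mx_product t (bmat (pw zX) X r) (bmat (pw zY) Y r) (bmat (pw zZ : C) Z r).
Proof.
move=> XYZ <- nX nY nZ.
exact: (@bmatM T t t_reg T_complete p p_prime p_t nat_reg m l1 l2 delta gamma
  m_gt0 delta0 deltaE delta_null gammaM gamma_null I i0 X Y Z c d zX zY zZ r).
Qed.

Variables (M1 M2 S S' P Q : imatrix I I T) (c c' : T).
Hypothesis cc' : c * c' = 1.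
Hypothesis sc' : s c' = c'.
Hypothesis M1_col : column_mod t m i0 M1 1.
Hypothesis M2_col : column_mod t m i0 M2 1.
Hypothesis S_col : column_mod t m i0 S c'.
Hypothesis S'_col : column_mod t m i0 S' c.
Hypothesis P_col : column_mod t m i0 P c.
Hypothesis Q_col : column_mod t m i0 Q c'.
Hypothesis SS' : is_mx_product t S S' (@mx_identity T I).
Hypothesis S'S : is_mx_product t S' S (@mx_identity T I).
Hypothesis S'M1 : is_mx_product t S' M1 P.
Hypothesis PS : is_mx_product t P (mx_map s S) M2.
Hypothesis M1S : is_mx_product t M1 (mx_map s S) Q.
Hypothesis S'Q : is_mx_product t S' Q M2.

(** The constants are c' for S, S^sigma and [Q], c for S' and [P], and 1 for the two given matrices,
    so each of the six products satisfies the multiplicativity that [bmatM] requires. W1 and W2 are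
    only constrained through [normalized], which lets them be values of [ps_power]. *)
Theorem similar_bmat r (W1 W2 : C) :
  (forall z, normalized t m M1 1 z -> W1 = pw z) ->
  (forall z, normalized t m M2 1 z -> W2 = pw z) ->
  sigma_similar t s (bmat W1 M1 r) (bmat W2 M2 r).
Proof.
have cU : exists x, c * x = 1 by exists c'.
have c'U : exists x, c' * x = 1 by exists c; rewrite mulrC.
have oneU : exists x : T, 1 * x = 1 by exists 1; rewrite mulr1.
have [z1 n1] := normalized_ex M1_col oneU; have [z2 n2] := normalized_ex M2_col oneU.
have [zS nS] := normalized_ex S_col c'U; have [zS' nS'] := normalized_ex S'_col cU.
have [zP nP] := normalized_ex P_col cU; have [zQ nQ] := normalized_ex Q_col c'U.
move=> /(_ _ n1) -> /(_ _ n2) ->.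
have nsS := normalized_map nS; rewrite sc' in nsS.
have nI : normalized t m (@mx_identity T I) 1 (0 : C).
  split=> //; rewrite scaler0 addr0 scale1r; apply/funext => q; rewrite ps_coef1.
  have [[i ->]|no] := pselect (exists i, q = emb i0 i).
    by rewrite lam_emb -(emb0 i0) (inj_eq (@emb_inj _ i0)).
  rewrite lam_out => [|i qi]; last by apply: no; exists i.
  by case: eqP => // q1; case: no; exists i0; rewrite emb0.
have bI : bmat (pw 0 : C) (@mx_identity T I) r = @mx_identity T _.
  by rewrite pwC0 // bmat_identity.
have sS : mx_map s (bmat (pw zS) S r) = bmat (pw (ps_map s zS)) (mx_map s S) r.
  rewrite mx_map_bmat ?ps_map_pw //.
  exact: (normalized_unit T_complete m_gt0 nS).
exists (bmat (pw zS) S r), (bmat (pw zS') S' r), (bmat (pw zP) P r), (bmat (pw zQ) Q r).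
rewrite sS -bI; split.
- by apply: mx_product_bmat SS' _ nS nS' nI; rewrite mulrC.
- by apply: mx_product_bmat S'S _ nS' nS nI.
- split; first by apply: mx_product_bmat S'M1 _ nS' n1 nP; rewrite mulr1.
  by apply: mx_product_bmat PS _ nP nsS n2.
split; first by apply: mx_product_bmat M1S _ n1 nsS nQ; rewrite mul1r.
by apply: mx_product_bmat S'Q _ nS' nQ n2.
Qed.
End SimilarB.

(** * From the special fibre to the completion of A *)

Section Residue.
Variables (R : idomainType) (pi : R) (k : finFieldType) (redR : {rmorphism R -> k}).
Hypothesis k_residue : is_quotient pi redR.
Variables (A : comAlgType R) (Abar : comAlgType k) (redA : {rmorphism A -> Abar}).
Hypothesis redA_scale : forall (x : R) (a : A), redA (x *: a) = redR x *: redA a.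
Hypothesis Abar_quotient : is_quotient (pi%:A : A) redA.
Hypothesis Abar_smooth : smooth_algebra Abar.
Hypothesis Abar_connected : connected_spectrum Abar.
Variable sigma : {lrmorphism A -> A}.
Hypothesis sigma_frobenius : forall a, redA (sigma a) = redA a ^+ #|k|.
Variables (Ahat : comAlgType R) (jA : {lrmorphism A -> Ahat}).
Hypothesis Ahat_completion : is_adic_completion (pi%:A : A) jA.
Variable sigmah : {lrmorphism Ahat -> Ahat}.
Hypothesis sigmahE : forall a, sigmah (jA a) = jA (sigma a).
Local Notation t := (pi%:A : Ahat).
Hypothesis t_reg : GRing.lreg t.

Let jAt : jA pi%:A = t. Proof. exact: rmorph_alg. Qed.

Lemma hat_lift y : exists a, in_ideal t (y - jA a).
Proof. by have := completion_dense Ahat_completion 1 y; rewrite /= jAt expr1. Qed.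

Lemma hat_in_ideal a : in_ideal t (jA a) <-> redA a = 0.
Proof.
have [_ kerA] := Abar_quotient; rewrite kerA; split=> [H|[b ->]].
  by have := @completion_in_ideal _ _ _ _ Ahat_completion 1 a; rewrite /= jAt !expr1; apply.
by exists (jA b); rewrite rmorphM /= jAt.
Qed.

Lemma Abar_reduced (a : Abar) j : a ^+ j = 0 -> a = 0.
Proof.
have H i : a ^+ (#|k| ^ i) = 0 -> a = 0.
  elim: i => [|i IH]; first by rewrite expn0 expr1.
  by rewrite expnSr exprM => /(smooth_reduced Abar_smooth).
move=> aj; apply: (H j); have ji : (j <= #|k| ^ j)%N.
  by apply/ltnW/ltn_expl; exact: finNzRing_gt1.
by rewrite -(subnK ji) exprD aj mulr0.
Qed.

Lemma hat_reduced y j : in_ideal t (y ^+ j) -> in_ideal t y.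
Proof.
have [a ya] := hat_lift y => yj; apply: (in_ideal_subl1 ya).
apply/hat_in_ideal/(Abar_reduced (j := j)); rewrite -rmorphXn; apply/hat_in_ideal.
rewrite rmorphXn; have := in_ideal_congX j ya => /in_ideal_sym H.
by rewrite -(subrK (y ^+ j) (_ ^+ j)); apply: in_idealD.
Qed.

Lemma hat_proper : ~ in_ideal t (1 : Ahat).
Proof.
move=> H; have /eqP : redA 1 = 0 by apply/hat_in_ideal; rewrite rmorph1.
by rewrite rmorph1 oner_eq0.
Qed.

Lemma sigmah_t : sigmah t = t. Proof. exact: rmorph_alg. Qed.

Lemma hat_fixed1 y : in_ideal t (sigmah y - y) -> exists c : R, in_ideal t (y - c%:A).
Proof.
have [a ya] := hat_lift y => yfix.
have sya : in_ideal t (sigmah y - jA (sigma a)).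
  by have [z zE] := ya; exists (sigmah z); rewrite -sigmahE -rmorphB zE rmorphM /= sigmah_t.
have /hat_in_ideal : in_ideal t (jA (sigma a - a)).
  rewrite rmorphB; apply: (in_ideal_trans (in_ideal_sym sya)).
  exact: (in_ideal_trans yfix ya).
rewrite rmorphB sigma_frobenius => /eqP; rewrite subr_eq0 => /eqP.
move=> /(connected_frobenius_fixed Abar_connected) [c ac].
have [/seteqP [_ surj] _] := k_residue; have [d _ dc] := surj c I.
exists d; apply: (in_ideal_trans ya).
have -> : d%:A = jA d%:A by rewrite rmorph_alg.
rewrite -rmorphB; apply/hat_in_ideal.
by rewrite rmorphB redA_scale rmorph1 dc ac subrr.
Qed.

(** Successive approximation: if y = c + t^i z with c in R, then sigma fixes c and t^i, so z is
    fixed modulo t, hence congruent to a constant d, and c is corrected by pi^i d. *)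
Lemma hat_fixed m y : in_ideal (t ^+ m) (sigmah y - y) ->
  exists c : R, in_ideal (t ^+ m) (y - c%:A).
Proof.
move=> yfix; suff H i : (i <= m)%N -> exists c : R, in_ideal (t ^+ i) (y - c%:A) by exact: H.
elim: i => [|i IH] im; first by exists 0; exact: in_ideal_expr0.
have [c [z yc]] := IH (ltnW im).
have yE : y = c%:A + t ^+ i * z by rewrite -yc addrC subrK.
have : in_ideal (t ^+ i.+1) (sigmah y - y) := in_ideal_le im yfix.
rewrite yE rmorphD rmorphM rmorphXn /= sigmah_t rmorph_alg opprD addrACA subrr add0r -mulrBr.
rewrite exprSr => -[w]; rewrite -mulrA => /(lregX t_reg) wE.
have [d [x zd]] : exists d : R, in_ideal t (z - d%:A) by apply: hat_fixed1; exists w.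
exists (c + pi ^+ i * d); exists x.
rewrite (_ : z = d%:A + t * x); last by rewrite -zd addrC subrK.
rewrite scalerDl -scalerA -[in RHS]exprSr.
have -> : pi ^+ i *: (d%:A : Ahat) = t ^+ i * d%:A.
  by rewrite exprZn expr1n -scalerAl mul1r.
by rewrite exprSr; ring.
Qed.
End Residue.

(** * Transport to T and to its localization *)

Definition imatrix_map (E F I1 I2 : Type) (j : E -> F) (X : imatrix I1 I2 E) :
  imatrix I1 I2 F := fun i k => j (X i k).

Section MatrixMap.
Variables (E F : comNzRingType) (j : {rmorphism E -> F}) (t : E) (t' : F).
Hypothesis jt : j t = t'.

Lemma in_ideal_map m x : in_ideal (t ^+ m) x -> in_ideal (t' ^+ m) (j x).
Proof. by move=> [y ->]; exists (j y); rewrite rmorphM rmorphXn /= jt. Qed.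

Lemma is_mx_product_map (I1 I2 I3 : choiceType) (X : imatrix I1 I2 E) (Y : imatrix I2 I3 E) Z :
  is_mx_product t X Y Z -> is_mx_product t' (imatrix_map j X) (imatrix_map j Y) (imatrix_map j Z).
Proof.
move=> XYZ i k N; have [G GP] := XYZ i k N; exists G => H /GP /in_ideal_map.
by rewrite rmorphB rmorph_sum; under eq_bigr do rewrite rmorphM.
Qed.

Lemma column_mod_map (I : choiceType) (i0 : I) m (X : imatrix I I E) c :
  column_mod t m i0 X c -> column_mod t' m i0 (imatrix_map j X) (j c).
Proof.
move=> [X0 Xi]; split; first by have := in_ideal_map X0; rewrite rmorphB.
by move=> i /Xi /in_ideal_map.
Qed.

Lemma imatrix_map_identity (I : choiceType) : imatrix_map j (@mx_identity E I) = @mx_identity F I.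
Proof. by apply/funext => i; apply/funext => k; exact: rmorph_nat. Qed.
End MatrixMap.

Section DividedPowers.
Variables (T : comNzRingType) (TK : comUnitRingType) (iK : {rmorphism T -> TK}) (t : T).
Hypothesis iK_inj : injective iK.
Hypothesis tU : iK t \is a GRing.unit.
Hypothesis natU : forall n, (0 < n)%N -> (n%:R : TK) \is a GRing.unit.
Variables (l1 l2 : nat) (gamma : nat -> T) (v : TK).
Hypothesis gammaE : forall j, (j`!)%:R * iK t ^+ (l2 * j) * iK (gamma j) = v ^+ j * iK t ^+ (l1 * j).

Lemma divided_power0 : gamma 0 = 1.
Proof.
by apply: iK_inj; have := gammaE 0; rewrite !muln0 !expr0 !mul1r rmorph1.
Qed.

Lemma divided_powerM i j : gamma i * gamma j = 'C(i + j, i)%:R * gamma (i + j).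
Proof.
apply: iK_inj; rewrite !rmorphM rmorph_nat.
have aU : (i`!)%:R * (j`!)%:R * (iK t ^+ (l2 * i) * iK t ^+ (l2 * j)) \is a GRing.unit.
  by rewrite !unitrM !natU ?fact_gt0 // !unitrX.
apply: (mulrI aU).
transitivity (((i`!)%:R * iK t ^+ (l2 * i) * iK (gamma i)) * ((j`!)%:R * iK t ^+ (l2 * j) * iK (gamma j))).
  by move: (iK t ^+ _) (iK t ^+ _) => x y; ring.
rewrite !gammaE mulrACA -!exprD -!mulnDr -gammaE -(bin_fact (leq_addr j i)) addKn !natrM.
by move: (iK t ^+ _) => x; ring.
Qed.

Lemma divided_power_opp : forall j,
  (j`!)%:R * iK t ^+ (l2 * j) * iK ((-1) ^+ j * gamma j) = (- v) ^+ j * iK t ^+ (l1 * j).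
Proof.
move=> j; rewrite rmorphM rmorphXn rmorphN1 (exprNn v) -[RHS]mulrA -gammaE.
by move: (iK t ^+ _) => x; ring.
Qed.
End DividedPowers.

(** V is only reached through [beta], whose image is pi^s V; the extra factor pi^(s j) in the
    relation for [b j] is cancelled once pi is invertible. *)
Lemma exp_coefs_morph (R : idomainType) (pi : R) (K : fieldType)
  (iota : {rmorphism R -> K}) (B T : comAlgType R) (chi : {lrmorphism B -> T})
  (TK : comUnitRingType) (iK : {rmorphism T -> TK}) (V : TK) (jB : {rmorphism B -> pseries unit K})
  (l1 l2 s : nat) (beta : B) (b : nat -> B) :
  iK pi%:A \is a GRing.unit ->
  (forall (m : nat) (b : B), jB b = iota pi ^+ m *: ps_var K tt ->
     iK (chi b) = iK pi%:A ^+ m * V) ->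
  jB beta = iota pi ^+ s *: ps_var K tt ->
  (forall j, (j`!%:R * pi ^+ (l2 * j) * pi ^+ (s * j)) *: b j = pi ^+ (l1 * j) *: beta ^+ j) ->
  forall j, (j`!)%:R * iK pi%:A ^+ (l2 * j) * iK (chi (b j)) = V ^+ j * iK pi%:A ^+ (l1 * j).
Proof.
move=> tU V_var /V_var betaE bE j.
have scE (c : R) (x : B) : iK (chi (c *: x)) = iK c%:A * iK (chi x).
  by rewrite linearZ -rmorphM /= -scalerAl mul1r.
have algX n : iK (pi ^+ n)%:A = iK pi%:A ^+ n.
  by rewrite -rmorphXn /= exprZn expr1n.
have := congr1 (iK \o chi) (bE j); rewrite /= !scE rmorphXn rmorphXn betaE.
have -> : iK (j`!%:R * pi ^+ (l2 * j) * pi ^+ (s * j))%:A =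
    j`!%:R * iK pi%:A ^+ (l2 * j) * iK pi%:A ^+ (s * j).
  rewrite -!algX -(rmorph_nat iK) -!rmorphM; congr (iK _).
  transitivity (in_alg T (j`!%:R * pi ^+ (l2 * j) * pi ^+ (s * j))); first by [].
  by rewrite 2!(rmorphM (in_alg T)) (rmorph_nat (in_alg T)).
rewrite algX exprMn -exprM => E.
have sU : iK pi%:A ^+ (s * j) \is a GRing.unit by rewrite unitrX.
apply: (mulIr sU); rewrite [LHS]mulrAC E.
by move: (iK pi%:A ^+ _) (iK pi%:A ^+ _) (V ^+ j) => x y z; ring.
Qed.

Theorem proposition4p10
  (RR : realType)
  (* K / Q_p finite, its ring of integers R, uniformizer pi, residue field k *)
  (p : nat) (p_prime : prime p)
  (Zp : idomainType) (Zp_padic : is_Zp p Zp)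
  (K : fieldExtType {fraction Zp})
  (R : idomainType) (iota : {rmorphism R -> K})
  (R_integers : is_ring_of_integers iota)
  (pi : R) (pi_uniformizer : is_uniformizer pi)
  (k : finFieldType) (redR : {rmorphism R -> k})
  (k_residue : is_quotient pi redR)
  (* A = R[X]^dagger / (g_1, ..., g_s), flat over R *)
  (n s : nat) (g : 'I_s -> polynomials n R)
  (g_nonzero : forall j, ~ exists h : polynomials n R, g j = pi *: h)
  (D : comAlgType R) (jD : {lrmorphism D -> pseries 'I_n R})
  (D_dagger : is_subring jD (dagger_series pi (n := n)))
  (A : comAlgType R) (phi : {lrmorphism D -> A})
  (A_quotient : is_dagger_quotient jD g phi)
  (A_flat : flat_module A)
  (* Abar = A / pi A, with Spec Abar smooth and connected *)
  (Abar : comAlgType k) (redA : {rmorphism A -> Abar})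
  (redA_scale : forall (x : R) (a : A), redA (x *: a) = redR x *: redA a)
  (Abar_quotient : is_quotient (pi%:A : A) redA)
  (Abar_smooth : smooth_algebra Abar)
  (Abar_connected : connected_spectrum Abar)
  (* the Frobenius lift sigma *)
  (sigma : {lrmorphism A -> A})
  (sigma_frobenius : forall a, redA (sigma a) = redA a ^+ #|k|)
  (dimX : nat) (dimX_dim : has_krull_dimension Abar dimX)
  (A_free : finite_free_over_image sigma (#|k| ^ dimX))
  (Omega_free : exists (Om : lmodType A) (d : A -> Om),
     is_separated_differentials p d /\ free_module Om)
  (* the completion of A, with the extension of sigma *)
  (Ahat : comAlgType R) (jA : {lrmorphism A -> Ahat})
  (Ahat_completion : is_adic_completion (pi%:A : A) jA)
  (sigmah : {lrmorphism Ahat -> Ahat})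
  (sigmahE : forall a, sigmah (jA a) = jA (sigma a))
  (* the algebra B of power series in V *)
  (nu : rat)
  (B : comAlgType R) (jB : {rmorphism B -> pseries unit K})
  (jB_scale : forall (x : R) (b : B), jB (x *: b) = iota x *: jB b)
  (B_subring : is_subring jB (B_series RR iota p nu))
  (* the completed tensor product T of A and B, with sigma (x) 1 *)
  (AB : comAlgType R)
  (iA : {lrmorphism A -> AB}) (iB : {lrmorphism B -> AB})
  (AB_tensor :
     is_tensor_product (fun (a : A) (b : B) => (iA a * iB b : AB)))
  (T : comAlgType R) (iT : {lrmorphism AB -> T})
  (T_completion : is_adic_completion (pi%:A : AB) iT)
  (jAT : {lrmorphism Ahat -> T})
  (jATE : forall a, jAT (jA a) = iT (iA a))
  (sigmaT : {lrmorphism T -> T})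
  (sigmaT_A : forall a, sigmaT (jAT a) = jAT (sigmah a))
  (sigmaT_B : forall b, sigmaT (iT (iB b)) = iT (iB b))
  (* T[1/pi] and the element V in it *)
  (TK : comUnitRingType) (iK : {rmorphism T -> TK})
  (TK_localization : is_localization (pi%:A : T) iK)
  (V : TK)
  (V_var : forall (m : nat) (b : B), jB b = iota pi ^+ m *: ps_var K tt ->
     iK (iT (iB b)) = iK pi%:A ^+ m * V)
  (* the matrices *)
  (I : countType) (i0 : I) (M M' : imatrix I I Ahat)
  (M_nuclear : nuclear RR (pi%:A : Ahat) M)
  (M_normal : one_normal (pi%:A : Ahat) i0 M)
  (M'_nuclear : nuclear RR (pi%:A : Ahat) M')
  (M'_normal : one_normal (pi%:A : Ahat) i0 M')
  (nu_M : admissible p (mu_of RR p i0 M) nu)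
  (nu_M' : admissible p (mu_of RR p i0 M') nu)
  (r : int) :
  sigma_similar (pi%:A : Ahat) sigmah M' M ->
  sigma_similar (pi%:A : T) sigmaT
    (Bmatrix jAT iK pi%:A i0 V r M') (Bmatrix jAT iK pi%:A i0 V r M) /\
  sigma_similar (pi%:A : T) sigmaT
    (Bmatrix jAT iK pi%:A i0 (- V) r M') (Bmatrix jAT iK pi%:A i0 (- V) r M).
Proof.
move=> [S [S' [P [Q [SS' S'S [S'M' PS] [M'S S'Q]]]]]].
have natR_neq0 : forall n', (0 < n')%N -> (n'%:R : R) != 0 :=
  R_natr_neq0 p_prime Zp_padic R_integers.
have [e [u [e_gt0 uU pE]]] := R_p_decomp p_prime Zp_padic R_integers pi_uniformizer.
have pi0 : pi != 0 := pi_neq0 p_prime Zp_padic R_integers pi_uniformizer.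
have natE n' := R_nat_decomp p_prime Zp_padic R_integers pi_uniformizer e_gt0 uU pE (n := n').
have iota_injective := iota_inj R_integers.
have A_reg : GRing.lreg (pi%:A : A) := flat_lreg A_flat pi0.
have jApi : jA pi%:A = pi%:A by exact: rmorph_alg.
have hat_reg : GRing.lreg (pi%:A : Ahat).
  by rewrite -jApi; exact: completion_lreg Ahat_completion A_reg.
have jB_inj : injective jB by case: B_subring.
(* B has no pi-torsion because it embeds in power series over K; flatness of A carries this over to
   the tensor product, and completion to T. *)
have piB_inj : injective (fun b : B => pi *: b).
  move=> b b' /(congr1 jB); rewrite !jB_scale => E; apply: jB_inj; apply/funext => q.
  have := congr1 (fun f => f q) E; rewrite /= !ps_coefZ; apply: mulfI.
  by rewrite (iota_eq0 R_integers).
have AB_reg : GRing.lreg (pi%:A : AB) := flat_tensor_lreg A_flat AB_tensor piB_inj.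
have iTpi : iT pi%:A = pi%:A by exact: rmorph_alg.
have T_reg : GRing.lreg (pi%:A : T).
  by rewrite -iTpi; exact: completion_lreg T_completion AB_reg.
have T_complete : adic_complete (pi%:A : T).
  by rewrite -iTpi; exact: completion_adic_complete T_completion.
have jATpi : jAT pi%:A = pi%:A by exact: rmorph_alg.
have sTpi : sigmaT pi%:A = pi%:A by exact: rmorph_alg.
have algE (L : comAlgType R) (x y : R) : (x * y)%:A = x%:A * y%:A :> L by rewrite mulr_algl scalerA.
have algX (L : comAlgType R) (x : R) N : (x ^+ N)%:A = x%:A ^+ N :> L by rewrite exprZn expr1n.
have natA (L : comAlgType R) N : (N%:R : R)%:A = N%:R :> L by rewrite scaler_nat.
have uUA (L : comAlgType R) (x : R) : x \is a GRing.unit -> x%:A * x^-1%:A = 1 :> L.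
  by move=> xU; rewrite -algE mulrV // scale1r.
have reduced := @hat_reduced _ _ _ _ _ _ Abar_quotient Abar_smooth _ _ Ahat_completion.
have pEhat : p%:R = (pi%:A : Ahat) ^+ e * u%:A by rewrite -natA pE algE algX.
have [m1 [a1 [b1 [good1 elem1]]]] :=
  admissible_good p_prime e_gt0 pEhat hat_reg reduced nu_M.
have [m2 [a2 [b2 [good2 elem2]]]] :=
  admissible_good p_prime e_gt0 pEhat hat_reg reduced nu_M'.
(* Good exponents do not involve the matrix, and the congruence persists for smaller m, so the
   triple with the smaller m serves both matrices. *)
have [m [l1 [l2 [[m_gt0 ml thetapos] elemM elemM']]]] : exists m l1 l2,
    [/\ good_exponents p e nu m l1 l2, elementary_mod (pi%:A : Ahat) i0 M m
      & elementary_mod (pi%:A : Ahat) i0 M' m].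
  have [m12|/ltnW m21] := leqP m1 m2.
    by exists m1, a1, b1; split=> //; exact: elementary_le elem2.
  by exists m2, a2, b2; split=> //; exact: elementary_le elem1.
have shpi : sigmah pi%:A = pi%:A by exact: rmorph_alg.
have [S_fixed S00 cols] := similar_columns shpi elemM' elemM SS' S'M' PS M'S.
have [c' Sc'] := hat_fixed k_residue redA_scale Abar_quotient Abar_connected
  sigma_frobenius Ahat_completion sigmahE hat_reg S_fixed.
(* Otherwise pi would divide c', hence S_00, and S_00 S'_00 = 1 modulo pi would make the special
   fibre zero. *)
have c'U : c' \is a GRing.unit.
  have [_ dec] := pi_uniformizer.
  apply: contrapT => c'N; apply: (hat_proper Abar_quotient Ahat_completion).
  have [w c'E] : exists w, c' = pi * w.
    have [->|c'0] := eqVneq c' 0; first by exists 0; rewrite mulr0.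
    have [[|N] [w [wU c'E]]] := dec _ c'0; first by case: c'N; rewrite c'E mul1r.
    by exists (pi ^+ N * w); rewrite c'E exprS mulrA.
  have S0 : in_ideal (pi%:A : Ahat) (S i0 i0).
    apply: in_ideal_subl1 (_ : in_ideal _ c'%:A); last by exists w%:A; rewrite c'E algE.
    by have := in_ideal_le m_gt0 Sc'; rewrite expr1.
  have S001 : in_ideal (pi%:A : Ahat) (S i0 i0 * S' i0 i0 - 1).
    by have := in_ideal_le m_gt0 S00; rewrite expr1.
  by apply: in_ideal_subl1 (in_ideal_sym S001) _; exact: in_idealMr.
have c'c : (c'^-1%:A : Ahat) * c'%:A = 1 by rewrite mulrC uUA.
have [S_col S'_col P_col Q_col] := cols _ _ c'c Sc'.
have sc' : sigmah c'%:A = c'%:A by exact: rmorph_alg.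
have [delta [delta0 deltaE delta_null]] := log_coefs p_prime natE m_gt0 ml.
have [b [d [beta [betaE bE b_null]]]] :=
  exp_coefs p_prime e_gt0 natE iota_injective pi0 uU pE jB_scale B_subring thetapos.
have [tU _ TK_ker] := TK_localization.
(* The kernel of the localization consists of pi-power torsion, and pi is regular in T. *)
have iK_inj : injective iK.
  move=> x y /eqP; rewrite -subr_eq0 -rmorphB => /eqP /TK_ker [N].
  rewrite mulrBr => /eqP; rewrite subr_eq0 => /eqP; exact: lregX.
have natU n' : (0 < n')%N -> (n'%:R : TK) \is a GRing.unit.
  move=> /natE [w wU E]; rewrite -(rmorph_nat iK) -natA E algE algX rmorphM rmorphXn.
  rewrite unitrM unitrX //; apply/unitrPr; exists (iK w^-1%:A).
  by rewrite -rmorphM uUA // rmorph1.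
have nat_reg n' : (0 < n')%N -> GRing.lreg (n'%:R : T).
  move=> /natU nU x y E; apply: iK_inj; apply: (mulrI nU).
  by rewrite -(rmorph_nat iK) -!rmorphM E.
have p_t : in_ideal (pi%:A : T) p%:R.
  exists ((pi ^+ e.-1)%:A * u%:A).
  by rewrite -natA pE -!algE mulrA -exprS prednK.
have deltaTE n' : (0 < n')%N -> n'%:R * (pi%:A : T) ^+ l1 * (delta n')%:A =
    (-1) ^+ n'.+1 * pi%:A ^+ (m * n' + l2).
  move=> n'0; have := congr1 (in_alg T) (deltaE n' n'0).
  by rewrite !rmorphM !rmorphXn rmorphN1 rmorph_nat.
have deltaT0 : (delta 0)%:A = 0 :> T by rewrite delta0 scale0r.
have deltaT_null : adic_null (pi%:A : T) (fun n => (delta n)%:A).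
  move=> N; have [n0 n0P] := delta_null N; exists n0 => n' /n0P [y ->].
  by exists y%:A; rewrite algE algX.
have s_delta n' : sigmaT (delta n')%:A = (delta n')%:A by exact: rmorph_alg.
have map_sigma (X : imatrix I I Ahat) :
    imatrix_map jAT (mx_map sigmah X) = mx_map sigmaT (imatrix_map jAT X).
  by apply/funext => i; apply/funext => i'; rewrite /imatrix_map /mx_map sigmaT_A.
(* V and -V are treated at once: the sign only affects [gamma], while the coefficients of the
   logarithm stay the same. *)
have main v gamma : adic_null (pi%:A : T) gamma -> (forall j, sigmaT (gamma j) = gamma j) ->
    (forall j, (j`!)%:R * iK pi%:A ^+ (l2 * j) * iK (gamma j) = v ^+ j * iK pi%:A ^+ (l1 * j)) ->
    sigma_similar (pi%:A : T) sigmaT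
      (Bmatrix jAT iK pi%:A i0 v r M') (Bmatrix jAT iK pi%:A i0 v r M).
  move=> gamma_null s_gamma gammaE.
  have gamma0 := divided_power0 iK_inj gammaE.
  have gammaM := divided_powerM iK_inj tU natU gammaE.
  have colT X (x : R) : column_mod (pi%:A : Ahat) m i0 X x%:A ->
      column_mod (pi%:A : T) m i0 (imatrix_map jAT X) x%:A.
    by move=> /(column_mod_map jATpi); rewrite /= rmorph_alg.
  have elem_col X : elementary_mod (pi%:A : Ahat) i0 X m ->
      column_mod (pi%:A : T) m i0 (imatrix_map jAT X) 1.
    move=> [X00 Xij]; have := colT X 1; rewrite !scale1r; apply.
    by split=> // i ii0; apply: Xij; apply: contra ii0 => /eqP[->].
  have prodT (X Y Z : imatrix I I Ahat) : is_mx_product pi%:A X Y Z ->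
      is_mx_product (pi%:A : T) (imatrix_map jAT X) (imatrix_map jAT Y) (imatrix_map jAT Z).
    exact: is_mx_product_map.
  have powE X z : normalized (pi%:A : T) m (imatrix_map jAT X) 1 z ->
      ps_power iK pi%:A v (lambda jAT i0 (X^~ i0)) =
      pwC (pi%:A : T) (fun n => (delta n)%:A) gamma z.
    move=> [_]; rewrite scale1r => XE.
    (* [lambda] along [jAT] is convertible with [lambda] along the identity of the matrix mapped to
       T. *)
    have -> : lambda jAT i0 (X^~ i0) = 1 + (pi%:A : T) ^+ m *: z by exact: XE.
    exact: (ps_powerE iK_inj tU natU T_complete deltaT0 deltaTE deltaT_null gammaE gamma_null).
  have c'cT : (c'^-1%:A : T) * c'%:A = 1 by rewrite mulrC uUA.
  have sc'T : sigmaT c'%:A = c'%:A by exact: rmorph_alg.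
  have SS'T := prodT _ _ _ SS'; have S'ST := prodT _ _ _ S'S.
  rewrite !imatrix_map_identity in SS'T S'ST.
  have PST := prodT _ _ _ PS; have M'ST := prodT _ _ _ M'S; rewrite !map_sigma in PST M'ST.
  have similar := similar_bmat T_reg T_complete p_prime p_t nat_reg m_gt0 deltaT0 deltaTE
    deltaT_null gamma0 gammaM gamma_null sTpi s_delta s_gamma c'cT sc'T
    (elem_col _ elemM') (elem_col _ elemM) (colT _ _ S_col) (colT _ _ S'_col)
    (colT _ _ P_col) (colT _ _ (Q_col _ sc')) SS'T S'ST (prodT _ _ _ S'M') PST M'ST
    (prodT _ _ _ S'Q).
  exact: (similar r _ _ (powE M') (powE M)).
have gammaE := exp_coefs_morph (chi := (iT \o iB : {lrmorphism B -> T})) tU V_var betaE bE.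
have gamma_null : adic_null (pi%:A : T) (fun j => iT (iB (b j))).
  move=> N; have [j0 j0P] := b_null N; exists j0 => j /j0P [b' ->].
  by exists (iT (iB b')); rewrite !linearZ /= -algX -scalerAl mul1r.
split; first by apply: (main V _ gamma_null _ gammaE) => j; apply: sigmaT_B.
apply: (main (- V) (fun j => (-1) ^+ j * iT (iB (b j)))).
- by move=> N; have [j0 j0P] := gamma_null N; exists j0 => j /j0P; apply: in_idealM.
- by move=> j; rewrite rmorphM rmorphXn rmorphN1 /= sigmaT_B.
exact: divided_power_opp gammaE.
Qed.
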